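(* Let $\mathbb{K}$ be a field, let $h\ge1$ and $n_1,n_2\ge 2$ be integers, and let $\mathbf{a}_1,\mathbf{d}_1,\mathbf{a}_2,\mathbf{d}_2\in\mathbb{N}^4$ be linearly independent over $\mathbb{Q}$. Let $\mathfrak{S}_2$ be the join of the affine semigroups generated by $S_i=\{\mathbf{a}_i,h\mathbf{a}_i+\mathbf{d}_i,\dots,h\mathbf{a}_i+n_i\mathbf{d}_i\}$, $i=1,2$. Then the associated graded ring $$\mathrm{gr}_{\mathfrak{m}}(\mathbb{K}[\mathfrak{S}_2])=\bigoplus_{i\ge0}\mathfrak{m}^i/\mathfrak{m}^{i+1}$$ is Cohen-Macaulay. Moreover, $\beta_i(\mathrm{gr}_{\mathfrak{m}}(\mathbb{K}[\mathfrak{S}_2]))=\beta_i(\mathbb{K}[\mathfrak{S}_2])$ for all $i\ge0$, and the Castelnuovo-Mumford regularity of $\mathrm{gr}_{\mathfrak{m}}(\mathbb{K}[\mathfrak{S}_2])$ is $2$.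
   Context: $\mathfrak{S}_2=\langle S_1\cup S_2\rangle\subset\mathbb{N}^4$ is the semigroup (containing $0$) generated by $S_1\cup S_2$. $\mathbb{K}[\mathfrak{S}_2]$ is the subalgebra of $\mathbb{K}[t_1,\dots,t_4]$ spanned by the monomials $\mathbf{t}^\gamma$, $\gamma\in\mathfrak{S}_2$, and $\mathfrak{m}$ is its maximal ideal generated by the monomials $\mathbf{t}^{\gamma}$, $\gamma\in S_1\cup S_2$. Let $R=\mathbb{K}[x_1,\dots,x_{n_1+n_2+2}]$, whose variables correspond to the elements of $S_1\cup S_2$. $\beta_i$ denotes the $i$-th total Betti number over $R$: for $\mathbb{K}[\mathfrak{S}_2]$ via the surjection sending variables to the corresponding monomials $\mathbf{t}^\gamma$ (using the $\mathbb{N}^4$-grading), and for $\mathrm{gr}_{\mathfrak{m}}(\mathbb{K}[\mathfrak{S}_2])$ via the surjection sending variables to the corresponding classes in $\mathfrak{m}/\mathfrak{m}^2$ (using the standard grading). The regularity is with respect to the standard grading. *)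

(* Defs.v *)
From HB Require Import structures.
From mathcomp Require Import all_boot all_algebra.
From mathcomp Require Import boolp.
From mathcomp Require Import mpoly.

Set Implicit Arguments.
Unset Strict Implicit.
Unset Printing Implicit Defensive.

Import GRing.Theory.
Local Open Scope ring_scope.
Local Open Scope quotient_scope.

(* ['X_{1..k}] is used both for exponents of monomials and for elements of
   N^k; the instance provides [a + b] and [a *+ h] in [ring_scope]. *)
HB.instance Definition _ k :=
  GRing.isNmodule.Build 'X_{1..k} (@addmA k) (@addmC k) (@add0m k).

Section Ideals.
Variable A : comPzRingType.
Implicit Types (E I J P : A -> Prop) (xs : seq A).

Definition ideal_gen E : A -> Prop := fun x =>
  exists (n : nat) (a e : 'I_n -> A),
    (forall i, E (e i)) /\ x = \sum_i a i * e i.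

Fixpoint ideal_pow I (n : nat) : A -> Prop :=
  if n is n'.+1
  then ideal_gen (fun z => exists x y, [/\ I x, ideal_pow I n' y & z = x * y])
  else fun _ => True.

Definition is_ideal I : Prop :=
  [/\ I 0, (forall x y, I x -> I y -> I (x + y))
    & (forall a x, I x -> I (a * x))].

Definition is_prime P : Prop :=
  [/\ is_ideal P, ~ P 1 & forall x y, P (x * y) -> P x \/ P y].

Definition is_maximal P : Prop :=
  [/\ is_ideal P, ~ P 1
    & forall J, is_ideal J -> ~ J 1 -> (forall x, P x -> J x) ->
        forall x, J x -> P x].

Definition noetherian : Prop := forall I, is_ideal I ->
  exists xs, forall x, I x <-> ideal_gen (fun y => y \in xs) x.

(* a chain of primes Q 0 < Q 1 < ... < Q h = P *)
Definition prime_chain P (h : nat) : Prop :=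
  exists Q : nat -> A -> Prop,
    [/\ (forall i, (i <= h)%N -> is_prime (Q i)),
        (forall i, (i < h)%N -> (forall x, Q i x -> Q i.+1 x)
                                /\ exists x, Q i.+1 x /\ ~ Q i x)
      & forall x, Q h x <-> P x].

Definition has_height P (h : nat) : Prop :=
  prime_chain P h /\ forall h', prime_chain P h' -> (h' <= h)%N.

Definition regular_seq xs : Prop :=
  (forall i, (i < size xs)%N -> forall y,
     let I := ideal_gen (fun z => z \in take i xs) in
     I (xs`_i * y) -> I y)
  /\ ~ ideal_gen (fun z => z \in xs) 1.

Definition has_depth P (d : nat) : Prop :=
  (exists xs, [/\ regular_seq xs, (forall x, x \in xs -> P x) & size xs = d])
  /\ forall xs, regular_seq xs -> (forall x, x \in xs -> P x) ->
       (size xs <= d)%N.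

(* Eisenbud, Commutative Algebra, Section 18.2: a noetherian ring in which
   depth P = codim P for every maximal ideal P. *)
Definition cohen_macaulay : Prop :=
  noetherian /\
  forall P, is_maximal P -> exists d, has_height P d /\ has_depth P d.

End Ideals.

Arguments ideal_pow {A} I n _ : simpl never.
Arguments cohen_macaulay A : clear implicits.
Arguments noetherian A : clear implicits.

Section IdealTheory.
Variable A : comPzRingType.
Implicit Types (E I : A -> Prop).

Lemma ideal_gen0 E : ideal_gen E 0.
Proof.
exists 0%N, (fun=> 0), (fun=> 0); split; first by case.
by rewrite big_ord0.
Qed.

Lemma ideal_genD E x y : ideal_gen E x -> ideal_gen E y -> ideal_gen E (x + y).
Proof.
move=> [n [a [e [he ->]]]] [m [b [f [hf ->]]]].
exists (n + m)%N,
  (fun i => match split i with inl j => a j | inr j => b j end),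
  (fun i => match split i with inl j => e j | inr j => f j end).
split; first by move=> i; case: (split i).
rewrite big_split_ord /=; congr (_ + _); apply: eq_bigr => i _.
  by rewrite (unsplitK (inl i)).
by rewrite (unsplitK (inr i)).
Qed.

Lemma ideal_genMl E a x : ideal_gen E x -> ideal_gen E (a * x).
Proof.
move=> [n [b [e [he ->]]]]; exists n, (fun i => a * b i), e; split => //.
by rewrite mulr_sumr; apply: eq_bigr => i _; rewrite mulrA.
Qed.

Lemma ideal_gen_mem E x : E x -> ideal_gen E x.
Proof.
move=> Ex; exists 1%N, (fun=> 1), (fun=> x); split => //.
by rewrite big_ord1 mul1r.
Qed.

Lemma ideal_gen_ind E (P : A -> Prop) :
  P 0 -> (forall x y, P x -> P y -> P (x + y)) ->
  (forall a e, E e -> P (a * e)) -> forall x, ideal_gen E x -> P x.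
Proof.
move=> P0 PD PM x [n [a [e [he ->]]]].
by apply: big_ind => // i _; apply: PM.
Qed.

Lemma ideal_pow0 I n : ideal_pow I n 0.
Proof. by case: n => // n; apply: ideal_gen0. Qed.

Lemma ideal_powD I n x y :
  ideal_pow I n x -> ideal_pow I n y -> ideal_pow I n (x + y).
Proof. by case: n => // n; apply: ideal_genD. Qed.

Lemma ideal_powMl I n a x : ideal_pow I n x -> ideal_pow I n (a * x).
Proof. by case: n => // n; apply: ideal_genMl. Qed.

Lemma ideal_powN I n x : ideal_pow I n x -> ideal_pow I n (- x).
Proof. by rewrite -mulN1r; apply: ideal_powMl. Qed.

Lemma ideal_pow_sum I n (r : nat) (F : 'I_r -> A) :
  (forall i, ideal_pow I n (F i)) -> ideal_pow I n (\sum_i F i).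
Proof.
move=> hF; apply: big_ind => //; first exact: ideal_pow0.
exact: ideal_powD.
Qed.

Lemma ideal_powM I m n x y :
  ideal_pow I m x -> ideal_pow I n y -> ideal_pow I (m + n)%N (x * y).
Proof.
elim: m x => [|m IH] x; first by move=> _ /ideal_powMl; apply.
move=> hx hy; rewrite addSn; move: x hx.
apply: ideal_gen_ind; first by rewrite mul0r; apply: ideal_pow0.
  by move=> u v hu hv; rewrite mulrDl; apply: ideal_powD.
move=> a _ [u [v [Iu Iv ->]]]; rewrite -mulrA; apply: ideal_powMl.
apply: ideal_gen_mem; exists u, (v * y); split=> //; last by rewrite mulrA.
exact: IH.
Qed.

Lemma ideal_pow1 I x : I x -> ideal_pow I 1 x.
Proof.
move=> Ix; apply: ideal_gen_mem; exists x, 1; split=> //.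
by rewrite mulr1.
Qed.

End IdealTheory.

(* gr_I(A) is the quotient of the Rees algebra, i.e. of the polynomials p over
   A with p_i in I^i for all i, by the ideal of those with p_i in I^(i+1) for
   all i; this is the direct sum of the I^i / I^(i+1). *)
Section AssociatedGraded.
Variables (A : comNzRingType) (I : A -> Prop).

Definition rees_pred : {pred {poly A}} :=
  fun p => `[< forall i, ideal_pow I i p`_i >].

Lemma reesP (p : {poly A}) :
  reflect (forall i, ideal_pow I i p`_i) (p \in rees_pred).
Proof. exact: asboolP. Qed.

Lemma rees_pred_subalg : subalg_closed rees_pred.
Proof.
split.
- apply/reesP => i; rewrite coef1; case: i => [|i] //=; exact: ideal_gen0.
- move=> a p q /reesP hp /reesP hq; apply/reesP => i.
  rewrite coefD coefZ; apply: ideal_powD => //; exact: ideal_powMl.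
- move=> p q /reesP hp /reesP hq; apply/reesP => i.
  rewrite coefM; apply: ideal_pow_sum => j.
  rewrite -{1}(subnKC (ltn_ord j : (j <= i)%N)); exact: ideal_powM.
Qed.

HB.instance Definition _ :=
  GRing.isSubalgClosed.Build A {poly A} rees_pred rees_pred_subalg.

Record rees := Rees { rees_val : {poly A}; _ : rees_val \in rees_pred }.

HB.instance Definition _ := [isSub for rees_val].
HB.instance Definition _ := [Choice of rees by <:].
HB.instance Definition _ := [SubChoice_isSubComNzRing of rees by <:].
HB.instance Definition _ := [SubZmodule_isSubLmodule of rees by <:].
HB.instance Definition _ := [SubNzRing_SubLmodule_isSubLalgebra of rees by <:].
HB.instance Definition _ := [SubLalgebra_isSubAlgebra of rees by <:].

Definition gr_pred : {pred rees} :=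
  fun p => `[< forall i, ideal_pow I i.+1 (rees_val p)`_i >].

Lemma gr_predP (p : rees) :
  reflect (forall i, ideal_pow I i.+1 (rees_val p)`_i) (p \in gr_pred).
Proof. exact: asboolP. Qed.

Lemma gr_pred_zmod : zmod_closed gr_pred.
Proof.
split; first by apply/gr_predP => i; rewrite coef0; exact: ideal_pow0.
move=> p q /gr_predP hp /gr_predP hq; apply/gr_predP => i.
by rewrite /= coefB; apply: ideal_powD => //; apply: ideal_powN.
Qed.

Lemma gr_predMl (p q : rees) : q \in gr_pred -> p * q \in gr_pred.
Proof.
move=> /gr_predP hq; apply/gr_predP => i.
rewrite /= coefM; apply: ideal_pow_sum => j.
rewrite -{1}(subnKC (ltn_ord j : (j <= i)%N)) -addnS; apply: ideal_powM => //.
by have /reesP := valP p.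
Qed.

HB.instance Definition _ := GRing.isZmodClosed.Build rees gr_pred gr_pred_zmod.

Definition gr : Type := Quotient.quot gr_pred.

HB.instance Definition _ := GRing.Zmodule.on gr.

Definition gr_class (p : rees) : gr := \pi_(Quotient.quot gr_pred) p.

Definition gr_repr (x : gr) : rees := repr x.

Lemma gr_reprK : cancel gr_repr gr_class. Proof. exact: reprK. Qed.

Lemma gr_classP (p q : rees) : gr_class p = gr_class q <-> p - q \in gr_pred.
Proof. by rewrite Quotient.idealrBE; split => [/eqP|/eqP]. Qed.

Lemma gr_classD : {morph gr_class : p q / p + q}.
Proof. by move=> p q; exact: (raddfD \pi_(Quotient.quot gr_pred)). Qed.

Lemma gr_classB : {morph gr_class : p q / p - q}.
Proof. by move=> p q; exact: (raddfB \pi_(Quotient.quot gr_pred)). Qed.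

Definition gr_one : gr := gr_class 1.
Definition gr_mul (x y : gr) : gr := gr_class (gr_repr x * gr_repr y).

Lemma gr_mulE p q : gr_mul (gr_class p) (gr_class q) = gr_class (p * q).
Proof.
apply/gr_classP; set p' := gr_repr _; set q' := gr_repr _.
have hp : p' - p \in gr_pred by apply/gr_classP; exact: gr_reprK.
have hq : q' - q \in gr_pred by apply/gr_classP; exact: gr_reprK.
have -> : p' * q' - p * q = q' * (p' - p) + p * (q' - q).
  by rewrite !mulrBr [q' * p']mulrC [q' * p]mulrC addrA subrK.
by rewrite rpredD // gr_predMl.
Qed.

Lemma gr_mulA : associative gr_mul.
Proof.
move=> x y z; rewrite -[x]gr_reprK -[y]gr_reprK -[z]gr_reprK.
by rewrite !gr_mulE mulrA.
Qed.

Lemma gr_mulC : commutative gr_mul.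
Proof. by move=> x y; rewrite /gr_mul mulrC. Qed.

Lemma gr_mul1 : left_id gr_one gr_mul.
Proof. by move=> x; rewrite -[x]gr_reprK gr_mulE mul1r. Qed.

Lemma gr_mulDl : left_distributive gr_mul +%R.
Proof.
move=> x y z; rewrite -[x]gr_reprK -[y]gr_reprK -[z]gr_reprK.
by rewrite -gr_classD !gr_mulE -gr_classD mulrDl.
Qed.

HB.instance Definition _ :=
  GRing.Zmodule_isComPzRing.Build gr gr_mulA gr_mulC gr_mul1 gr_mulDl.

HB.instance Definition _ := GRing.isZmodMorphism.Build rees gr gr_class gr_classB.

Fact gr_class_monoid : monoid_morphism gr_class.
Proof. by split=> // p q; rewrite -gr_mulE. Qed.

HB.instance Definition _ :=
  GRing.isMonoidMorphism.Build rees gr gr_class gr_class_monoid.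

(* the component I^i / I^(i+1) of gr_I(A) *)
Definition gr_comp (i : nat) (x : gr) : Prop :=
  exists p : rees, (exists c : A, val p = c *: 'X^i) /\ x = gr_class p.

Lemma gr_gen_subproof (x : A) : I x -> x *: 'X \in rees_pred.
Proof.
move=> Ix; apply/reesP => i; rewrite coefZ coefX.
have [->|_] := eqVneq; first by rewrite mulr1; exact: ideal_pow1.
by rewrite mulr0; exact: ideal_pow0.
Qed.

(* the element of degree one of the Rees algebra defined by x in I; its image
   under [gr_class] is the class of x in I / I^2 *)
Definition rees_gen (x : A) (Ix : I x) : rees := Rees (gr_gen_subproof Ix).

End AssociatedGraded.

Section RestrictScalars.
Variables (R A : comPzRingType) (phi : {rmorphism R -> A}).

(* A viewed as an R-module through phi; the vacuous [let] keeps phi in the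
   type, so that the module structure can be inferred from it. *)
Definition restrict : Type := let _ := phi in A.

HB.instance Definition _ := GRing.Zmodule.on restrict.

Definition restrict_scale (r : R) (x : restrict) : restrict :=
  phi r * (x : A).

Fact restrict_scaleA a b x :
  restrict_scale a (restrict_scale b x) = restrict_scale (a * b) x.
Proof. by rewrite /restrict_scale rmorphM mulrA. Qed.

Fact restrict_scale1 : left_id 1 restrict_scale.
Proof. by move=> x; rewrite /restrict_scale rmorph1 mul1r. Qed.

Fact restrict_scaleDr : right_distributive restrict_scale +%R.
Proof. by move=> a x y; exact: (mulrDr (phi a : A)). Qed.

Fact restrict_scaleDl x : {morph restrict_scale^~ x : a b / a + b}.
Proof. by move=> a b; rewrite /restrict_scale rmorphD; exact: mulrDl. Qed.

HB.instance Definition _ := GRing.Zmodule_isLmodule.Build R restrict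
  restrict_scaleA restrict_scale1 restrict_scaleDr restrict_scaleDl.

End RestrictScalars.

Section Betti.
Variables (K : fieldType) (n : nat) (G : nmodType) (w : 'I_n -> G).

(* degree of the monomial x^m when x_j has degree w j *)
Definition wdeg (m : 'X_{1..n}) : G := \sum_j w j *+ m j.

Definition whomog (p : {mpoly K[n]}) (g h : G) : Prop :=
  forall m, m \in msupp p -> wdeg m + g = h.

Variables (M : lmodType {mpoly K[n]}) (comp : G -> M -> Prop).

(* ... -> F_2 -> F_1 -> F_0 -> M -> 0, where F_i is free with homogeneous
   basis e_(i,k), k < mgr_rank i, of degrees mgr_shift i k; elements of F_i
   are row vectors, and the differential F_(i+1) -> F_i is u |-> u *m D i. *)
Record min_graded_res := MinGradedRes {
  mgr_rank : nat -> nat;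
  mgr_shift : forall i, 'I_(mgr_rank i) -> G;
  mgr_aug : 'I_(mgr_rank 0) -> M;
  mgr_diff : forall i, 'M[{mpoly K[n]}]_(mgr_rank i.+1, mgr_rank i);
  mgr_aug_homog : forall k, comp (mgr_shift k) (mgr_aug k);
  mgr_diff_homog : forall i k l,
    whomog (mgr_diff i k l) (mgr_shift l) (mgr_shift k);
  mgr_aug_surj : forall x, exists u : 'rV_(mgr_rank 0),
    x = \sum_k u 0 k *: mgr_aug k;
  mgr_aug_exact : forall u : 'rV_(mgr_rank 0),
    \sum_k u 0 k *: mgr_aug k = 0 <-> exists v, u = v *m mgr_diff 0;
  mgr_diff_exact : forall i (u : 'rV_(mgr_rank i.+1)),
    u *m mgr_diff i = 0 <-> exists v, u = v *m mgr_diff i.+1;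
  (* the differentials vanish modulo the ideal (x_1, ..., x_n) *)
  mgr_minimal : forall i k l, (mgr_diff i k l)@_0%MM = 0
}.

Definition is_betti (i b : nat) : Prop :=
  exists F : min_graded_res, b = mgr_rank F i.

Definition is_graded_betti (i : nat) (g : G) (b : nat) : Prop :=
  exists F : min_graded_res, b = #|[pred k | @mgr_shift F i k == g]|.

Definition the_nat (P : nat -> Prop) : nat :=
  if pselect (exists b, P b) is left e then projT1 (cid e) else 0%N.

(* Minimal graded free resolutions are unique up to isomorphism, so the value
   selected by [the_nat] does not depend on the chosen resolution. *)
Definition betti (i : nat) : nat := the_nat (is_betti i).

Definition graded_betti (i : nat) (g : G) : nat := the_nat (is_graded_betti i g).

End Betti.

(* reg M = max {j - i | beta_(i,j)(M) <> 0} for the standard grading *)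
Definition has_regularity (K : fieldType) (n : nat) (M : lmodType {mpoly K[n]})
    (comp : nat -> M -> Prop) (r : nat) : Prop :=
  let beta := graded_betti (fun _ : 'I_n => 1%N) comp in
  (exists i, beta i (i + r)%N <> 0%N)
  /\ forall i j, beta i j <> 0%N -> (j <= i + r)%N.

Inductive semigroup_gen k (S : 'X_{1..k} -> Prop) : 'X_{1..k} -> Prop :=
| Semigroup0 : semigroup_gen S 0
| SemigroupD a b : S a -> semigroup_gen S b -> semigroup_gen S (a + b).

Section SemigroupRing.
Variables (K : fieldType) (k n : nat) (S : n.-tuple 'X_{1..k}).

Definition semigroup : 'X_{1..k} -> Prop := semigroup_gen (fun a => a \in S).

Lemma semigroupD a b : semigroup a -> semigroup b -> semigroup (a + b).
Proof.
move=> ha hb; elim: ha => [|c d Sc _ IH]; first by rewrite add0m.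
by rewrite -addmA; apply: SemigroupD.
Qed.

Lemma semigroup_mem a : a \in S -> semigroup a.
Proof. by move=> Sa; rewrite -[a]addr0; apply: SemigroupD => //; left. Qed.

Definition sgring_pred : {pred {mpoly K[k]}} :=
  fun p => `[< forall m, m \in msupp p -> semigroup m >].

Lemma sgring_predP p :
  reflect (forall m, m \in msupp p -> semigroup m) (p \in sgring_pred).
Proof. exact: asboolP. Qed.

Lemma sgring_subalg : subalg_closed sgring_pred.
Proof.
split.
- apply/sgring_predP => m; rewrite msupp1 inE => /eqP ->; left.
- move=> a p q /sgring_predP hp /sgring_predP hq; apply/sgring_predP => m.
  by move/msuppD_le; rewrite mem_cat => /orP[/msuppZ_le/hp|/hq].
- move=> p q /sgring_predP hp /sgring_predP hq; apply/sgring_predP => m.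
  by move/msuppM_le/allpairsP => [[a b] /= [/hp ha /hq hb ->]]; apply: semigroupD.
Qed.

HB.instance Definition _ := GRing.isSubalgClosed.Build K {mpoly K[k]}
  sgring_pred sgring_subalg.

(* K[<S>], the subalgebra of K[t_1, ..., t_k] spanned by the t^a, a in <S> *)
Record sgring := SgRing
  { sgring_val : {mpoly K[k]}; _ : sgring_val \in sgring_pred }.

HB.instance Definition _ := [isSub for sgring_val].
HB.instance Definition _ := [Choice of sgring by <:].
HB.instance Definition _ := [SubChoice_isSubComNzRing of sgring by <:].
HB.instance Definition _ := [SubZmodule_isSubLmodule of sgring by <:].
HB.instance Definition _ :=
  [SubNzRing_SubLmodule_isSubLalgebra of sgring by <:].
HB.instance Definition _ := [SubLalgebra_isSubAlgebra of sgring by <:].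

Lemma sgring_gen_subproof (j : 'I_n) : 'X_[tnth S j] \in sgring_pred.
Proof.
apply/sgring_predP => m; rewrite msuppX inE => /eqP ->.
by apply: semigroup_mem; exact: mem_tnth.
Qed.

Definition sgring_gen (j : 'I_n) : sgring :=
  SgRing (sgring_gen_subproof j).

Definition sgring_comp (g : 'X_{1..k}) (x : sgring) : Prop :=
  exists c : K, val x = c *: 'X_[g].

Definition sgring_max : sgring -> Prop :=
  ideal_gen (fun x => exists j, x = sgring_gen j).

Lemma sgring_max_gen j : sgring_max (sgring_gen j).
Proof. by apply: ideal_gen_mem; exists j. Qed.

Definition sgring_pres : {mpoly K[n]} -> sgring :=
  mmap (in_alg sgring) sgring_gen.

HB.instance Definition _ := GRing.RMorphism.on sgring_pres.

Definition rees_pres : {mpoly K[n]} -> rees sgring_max :=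
  mmap (in_alg (rees sgring_max) \o in_alg sgring)
       (fun j => rees_gen (sgring_max_gen j)).

HB.instance Definition _ := GRing.RMorphism.on rees_pres.

(* x_j |-> class of t^a in m / m^2, where a is the j-th element of S *)
Definition gr_pres : {mpoly K[n]} -> gr sgring_max :=
  @gr_class _ sgring_max \o rees_pres.

HB.instance Definition _ := GRing.RMorphism.on gr_pres.

Definition betti_sgring (i : nat) : nat :=
  betti (tnth S) (M := restrict sgring_pres) sgring_comp i.

Definition betti_gr (i : nat) : nat :=
  betti (fun _ : 'I_n => 1%N) (M := restrict gr_pres)
    (@gr_comp _ sgring_max) i.

Definition gr_has_regularity (r : nat) : Prop :=
  has_regularity (M := restrict gr_pres) (@gr_comp _ sgring_max) r.

End SemigroupRing.

Arguments sgring_gen K {k n} S j.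
Arguments sgring_max K {k n} S _.
Arguments sgring_pres K {k n} S _.
Arguments gr_pres K {k n} S _.

Definition arith_gens k (h n : nat) (a d : 'X_{1..k}) : n.+1.-tuple 'X_{1..k} :=
  cons_tuple a [tuple a *+ h + d *+ i.+1 | i < n].

Definition join_gens k (h n1 n2 : nat) (a1 d1 a2 d2 : 'X_{1..k}) :
    (n1.+1 + n2.+1).-tuple 'X_{1..k} :=
  cat_tuple (arith_gens h n1 a1 d1) (arith_gens h n2 a2 d2).

Definition lin_indep_Q k r (v : r.-tuple 'X_{1..k}) : Prop :=
  row_free (\matrix_(i < r, j < k) (tnth v i j)%:R : 'M[rat]_(r, k)).

(* Main.v *)
(* Let Z consist of the variables mapped to a_1, h a_1 + n_1 d_1, a_2 and
   h a_2 + n_2 d_2, and let X consist of the other variables. Both K[S_2] and its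
   associated graded ring are free over K[Z] with basis the products e_k e'_l,
   k < n_1, l < n_2, where e_0 = e'_0 = 1 and e_k, e'_l are the k-th and l-th
   inner variables of the two factors; on this basis a variable x in X acts by a
   matrix xi_x with entries 0 or monomials in K[Z]. The Koszul complex of the
   commuting endomorphisms x - xi_x is therefore a graded free resolution over R.
   The matrices of the two rings differ only by entries without constant term, a
   minimal resolution is a retract of the Koszul complex up to homotopy, and its
   ranks are the dimensions of the homology of the Koszul complex modulo the
   variables: hence the Betti numbers agree. The shifts in degree i are at most
   i + 2, with equality for a homology class in the top degree, so the regularity
   of the associated graded ring is 2.

   Let P be a maximal ideal of the associated graded ring G. By Zariski's lemma
   each z in Z is a root of a monic polynomial f_z over K modulo P. By division
   with remainder and freeness over K[Z], the four elements f_z(z) of P form a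
   regular sequence. A regular sequence of length d in a prime ideal P gives a
   chain of primes of length d below P. Finally, a regular sequence and a chain of
   primes of length d both give a chain of ideals I_0, ..., I_d with
   nonzerodivisors y_i in I_(i+1) modulo I_i; the monomials of exponents less than
   k in the y_i are then k^d linearly independent elements of degree O(k), whereas
   the elements of degree at most D of G span a space of dimension O(D^4), so
   d <= 4. Hence the depth and the height of P are both 4. *)
Require Import Defs.
From HB Require Import structures.
From mathcomp Require Import all_boot all_algebra.
From mathcomp Require Import mpoly.
From mathcomp Require classical_sets.
From mathcomp Require Import boolp zify ring.

Set Implicit Arguments.
Unset Strict Implicit.
Unset Printing Implicit Defensive.
Import GRing.Theory.
Local Open Scope ring_scope.

(** * Division with remainder and the Koszul complex *)

(** The associated graded ring has the same monomial basis as the semigroup ring because of a degree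
    estimate. In one factor, a monomial with coordinates A and D along a and d that uses c
    generators other than a has degree A - (h - 1) c, and c is at least D / n rounded up. The
    monomials z e_k attain this bound, so each standard monomial z e_k e'_l has the largest degree
    in its fibre and its class survives in the graded ring.

    [betti] and [graded_betti] select a value by choice and fall back to 0 if there is no
    resolution. Hence minimal resolutions have to be constructed for both rings, and the ranks
    compared for arbitrary ones. As the two gradings live in different monoids, the comparison goes
    through the complex over K obtained from either Koszul complex modulo the variables.

    [cohen_macaulay] ranges over all maximal ideals, and K need not be algebraically closed. A
    residue field may therefore be a proper extension of K, and monic polynomials f_z(z) take the
    place of linear forms z - c. *)

Section MonomialParts.
Variables (K : comNzRingType) (n : nat).
Implicit Types (p q : {mpoly K[n]}) (P : pred 'X_{1..n}) (k : 'I_n).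

Definition mpart P p : {mpoly K[n]} :=
  \sum_(m <- msupp p | P m) p@_m *: 'X_[m].

Lemma mcoeff_mpart P p m : (mpart P p)@_m = if P m then p@_m else 0.
Proof.
rewrite /mpart raddf_sum /=.
under eq_bigr do rewrite mcoeffZ mcoeffX.
case: (boolP (m \in msupp p)) => [mp|/memN_msupp_eq0 pm].
  rewrite big_mkcond (bigD1_seq m) ?msupp_uniq //= eqxx mulr1 big1 ?addr0 //.
  by move=> i /negPf ->; rewrite mulr0; case: ifP.
rewrite pm if_same big_seq_cond big1 // => i /andP[ip _].
case: eqP ip => [->|]; last by rewrite mulr0.
by rewrite mcoeff_msupp pm eqxx.
Qed.

Lemma mpart_is_zmod P : zmod_morphism (mpart P).
Proof.
move=> p q; apply/mpolyP => m; rewrite mcoeffB !mcoeff_mpart mcoeffB.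
by case: ifP; rewrite ?subr0.
Qed.

HB.instance Definition _ P :=
  GRing.isZmodMorphism.Build {mpoly K[n]} {mpoly K[n]} (mpart P) (mpart_is_zmod P).

(** When [P] and [Q] are conditions on a degree, this commutes the extraction of a homogeneous
    component with multiplication by a homogeneous [q]. *)
Lemma mpartM (P Q : pred 'X_{1..n}) p q :
  (forall m m', m' \in msupp q -> P (m + m')%MM = Q m) ->
  mpart P (p * q) = mpart Q p * q.
Proof.
move=> hPQ; apply/mpolyP => m; rewrite mcoeff_mpart !mcoeffM.
transitivity (\sum_(k : 'X_{1..n < (mdeg m).+1, (mdeg m).+1} | m == (k.1 + k.2)%MM)
    (if P m then p@_k.1 * q@_k.2 else 0)).
  by case: ifP => // _; rewrite big1.
apply: eq_bigr => k /eqP mE; rewrite mcoeff_mpart.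
have {mE}-> : P m = P (k.1 + k.2)%MM by rewrite {1}mE.
case: (boolP (val k.2 \in msupp q)) => [kq|/memN_msupp_eq0 ->].
  by rewrite hPQ //; case: ifP; rewrite ?mul0r.
by rewrite !mulr0 if_same.
Qed.

Lemma msupp_mpart P p m : m \in msupp (mpart P p) -> P m && (m \in msupp p).
Proof. by rewrite !mcoeff_msupp mcoeff_mpart; case: (P m); rewrite ?eqxx. Qed.

(** For [d = 1] this says that the variable [k] does not occur in [p]; for [d = 0] it says
    [p = 0]. *)
Definition xdeg_lt k d p := forall m, m \in msupp p -> (m k < d)%N.

Lemma xdeg_ltP k d p :
  xdeg_lt k d p <-> forall m : 'X_{1..n}, (d <= m k)%N -> p@_m = 0.
Proof.
split=> h m; last by rewrite mcoeff_msupp ltnNge; apply: contraNN => /h ->.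
by move=> dm; apply/memN_msupp_eq0; apply: contraL dm => /h; rewrite -ltnNge.
Qed.

Lemma xdeg_lt0 k d : xdeg_lt k d 0.
Proof. by move=> m; rewrite msupp0. Qed.

Lemma xdeg_ltW k d e p : (d <= e)%N -> xdeg_lt k d p -> xdeg_lt k e p.
Proof. by move=> de h m /h /leq_trans; apply. Qed.

Lemma xdeg_ltD k d p q : xdeg_lt k d p -> xdeg_lt k d q -> xdeg_lt k d (p + q).
Proof. by move=> hp hq m /msuppD_le; rewrite mem_cat => /orP[/hp|/hq]. Qed.

Lemma xdeg_ltN k d p : xdeg_lt k d p -> xdeg_lt k d (- p).
Proof. by move=> hp m; rewrite (perm_mem (msuppN p)) => /hp. Qed.

Lemma xdeg_ltB k d p q : xdeg_lt k d p -> xdeg_lt k d q -> xdeg_lt k d (p - q).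
Proof. by move=> hp hq; apply: xdeg_ltD => //; apply: xdeg_ltN. Qed.

(** The strict bounds allow degrees d - 1 and e - 1, whose sum stays below d + e - 1. In particular,
    for d = e = 1, absence of a variable is preserved by products. *)
Lemma xdeg_ltM k d e p q :
  xdeg_lt k d p -> xdeg_lt k e q -> xdeg_lt k (d + e).-1 (p * q).
Proof.
move=> hp hq m /msuppM_le /allpairsP[[a b] /= [/hp ha /hq hb ->]].
by rewrite mnmDE; lia.
Qed.

Lemma xdeg_lt_sum (I : Type) (r : seq I) (P : pred I) k d (F : I -> {mpoly K[n]}) :
  (forall i, P i -> xdeg_lt k d (F i)) -> xdeg_lt k d (\sum_(i <- r | P i) F i).
Proof.
by move=> hF; apply: big_ind => //; [exact: xdeg_lt0 | exact: xdeg_ltD].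
Qed.

Lemma xdeg_ltX k d (m : 'X_{1..n}) : (m k < d)%N -> xdeg_lt k d 'X_[m].
Proof. by move=> hm m'; rewrite msuppX inE => /eqP ->. Qed.

Lemma xdeg_lt_msize k p : xdeg_lt k (msize p) p.
Proof.
by move=> m /msize_mdeg_lt; apply: leq_ltn_trans; rewrite mdegE (bigD1 k) ?leq_addr.
Qed.

Definition mxdeg_lt a b k d (A : 'M[{mpoly K[n]}]_(a, b)) :=
  forall i j, xdeg_lt k d (A i j).

Lemma mxdeg_ltM a b c k d e (A : 'M_(a, b)) (B : 'M_(b, c)) :
  mxdeg_lt k d A -> mxdeg_lt k e B -> mxdeg_lt k (d + e).-1 (A *m B).
Proof.
by move=> hA hB i j; rewrite mxE; apply: xdeg_lt_sum => l _; apply: xdeg_ltM.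
Qed.

Lemma mxdeg_ltD a b k d (A B : 'M_(a, b)) :
  mxdeg_lt k d A -> mxdeg_lt k d B -> mxdeg_lt k d (A + B).
Proof. by move=> hA hB i j; rewrite mxE; apply: xdeg_ltD. Qed.

Lemma mxdeg_ltN a b k d (A : 'M_(a, b)) :
  mxdeg_lt k d A -> mxdeg_lt k d (- A).
Proof. by move=> hA i j; rewrite mxE; apply: xdeg_ltN. Qed.

Lemma mxdeg_ltB a b k d (A B : 'M_(a, b)) :
  mxdeg_lt k d A -> mxdeg_lt k d B -> mxdeg_lt k d (A - B).
Proof. by move=> hA hB; apply: mxdeg_ltD => //; apply: mxdeg_ltN. Qed.

Lemma mxdeg_ltW a b k d e (A : 'M_(a, b)) :
  (d <= e)%N -> mxdeg_lt k d A -> mxdeg_lt k e A.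
Proof. by move=> de hA i j; apply: xdeg_ltW (hA i j). Qed.

Lemma mxdeg_lt_bound a b k (A : 'M_(a, b)) : exists d, mxdeg_lt k d A.
Proof.
exists (\max_i \max_j msize (A i j)) => i j.
apply: xdeg_ltW (@xdeg_lt_msize k _).
by apply: leq_trans (leq_bigmax i); apply: (leq_bigmax (F := fun j => msize (A i j))).
Qed.

Definition xshift k d p : {mpoly K[n]} :=
  \sum_(m <- msupp p | (d <= m k)%N) p@_m *: 'X_[m - U_(k) *+ d].

Lemma mulX_xshift k d p :
  p = 'X_k ^+ d * xshift k d p + mpart (fun m : 'X_{1..n} => (m k < d)%N) p.
Proof.
rewrite [in LHS](mpolyE p) (bigID (fun m : 'X_{1..n} => d <= m k)%N) /=; congr (_ + _).
  rewrite mulr_sumr; apply: eq_bigr => m dm.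
  rewrite -scalerAr mpolyXn -mpolyXD addmC submK //.
  by apply/mnm_lepP => i; rewrite mulmnE mnm1E; case: eqP => [<-|] //; lia.
by apply: eq_bigl => m; rewrite -ltnNge.
Qed.

Lemma msupp_xshift k d p m :
  m \in msupp (xshift k d p) -> (m + U_(k) *+ d)%MM \in msupp p.
Proof.
move=> /msupp_sum_le /flattenP[s /mapP[m' ]].
rewrite mem_filter => /andP[dm m'p ->] /msuppZ_le; rewrite msuppX inE => /eqP ->.
rewrite submK //.
by apply/mnm_lepP => i; rewrite mulmnE mnm1E; case: eqP => [<-|] //; lia.
Qed.

End MonomialParts.

Section Division.
Variables (K : comNzRingType) (n r : nat) (k : 'I_n) (d : nat).
Variable Theta : 'M[{mpoly K[n]}]_r.
Hypothesis Theta_deg : mxdeg_lt k d Theta.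
Let Phi := ('X_k ^+ d)%:M - Theta.

(** Rewriting X_k^d as [Theta] lowers the degree in X_k. The last clause holds because the rewriting
    introduces only variables that occur in [Theta]; it lets several variables be eliminated one
    after the other. *)
Lemma divmx_exists (w : 'rV[{mpoly K[n]}]_r) : exists q rho : 'rV_r,
  [/\ w = q *m Phi + rho, mxdeg_lt k d rho &
      forall j, j != k -> mxdeg_lt j 1 Theta -> mxdeg_lt j 1 w ->
        mxdeg_lt j 1 q /\ mxdeg_lt j 1 rho].
Proof.
have [e] := mxdeg_lt_bound k w; elim: e w => [|e IH] w hw.
  exists 0, w; split=> //; first by rewrite mul0mx add0r.
    exact: mxdeg_ltW hw.
  by move=> j _ _ hj; split=> // a b; rewrite mxE; apply: xdeg_lt0.
have [ed|de] := ltnP e d.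
  exists 0, w; split=> //; first by rewrite mul0mx add0r.
    exact: mxdeg_ltW hw.
  by move=> j _ _ hj; split=> // a b; rewrite mxE; apply: xdeg_lt0.
pose w1 : 'rV_r := \row_j xshift k d (w 0 j).
pose w0 : 'rV_r := \row_j mpart (fun m : 'X_{1..n} => (m k < d)%N) (w 0 j).
have wE : w = w1 *m Phi + (w1 *m Theta + w0).
  rewrite mulmxBr addrA subrK mul_mx_scalar; apply/rowP => j.
  by rewrite !mxE -mulX_xshift.
have w0d : mxdeg_lt k d w0.
  by move=> i j; rewrite mxE => m /msupp_mpart /andP[].
have w1d : mxdeg_lt k (e.+1 - d) w1.
  move=> i j m; rewrite mxE => /msupp_xshift /hw.
  by rewrite mnmDE mulmnE mnm1E eqxx; lia.
(* The degree of [w1] is below e + 1 - d and that of [Theta] below d, so the product has degree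
   below e. *)
have [|q [rho [qE rhod hfree]]] := IH (w1 *m Theta + w0).
  apply: mxdeg_ltD; last exact: mxdeg_ltW w0d.
  by apply: mxdeg_ltW (mxdeg_ltM w1d Theta_deg); lia.
exists (w1 + q), rho; split=> //.
  by rewrite wE qE mulmxDl addrA.
move=> j jk Tj wj.
have w1j : mxdeg_lt j 1 w1.
  move=> a b m; rewrite mxE => /msupp_xshift /wj.
  by rewrite mnmDE; apply: leq_ltn_trans; apply: leq_addr.
have w0j : mxdeg_lt j 1 w0.
  by move=> a b m; rewrite mxE => /msupp_mpart /andP[_ /wj].
have [||qj rhoj] := hfree j jk => //; last by split=> //; apply: mxdeg_ltD.
by apply: mxdeg_ltD => //; apply: (mxdeg_ltM w1j Tj).
Qed.

(** If e bounds the degree of [q] in X_k, the coefficients of X_k^(e+d) in [q *m Phi] are those of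
    X_k^e in [q], since [q *m Theta] does not reach that degree; so the bound can be lowered. *)
Lemma divmx_unique (q : 'rV[{mpoly K[n]}]_r) : mxdeg_lt k d (q *m Phi) -> q = 0.
Proof.
move=> hq; have [e] := mxdeg_lt_bound k q; elim: e => [|e IH] qe.
  apply/rowP => j; rewrite mxE; apply/eqP; rewrite -msupp_eq0.
  move: (qe 0 j); rewrite /xdeg_lt; case: (msupp _) => // m s h.
  by have := h m (mem_head _ _).
apply: IH => i j; apply/xdeg_ltP => m em.
have [me|me] := ltnP e (m k); first exact: (xdeg_ltP _ _ _).1 (qe i j) m me.
have {em}me : m k = e by apply/eqP; rewrite eqn_leq me em.
pose m' := (m + U_(k) *+ d)%MM.
have m'k : m' k = (e + d)%N by rewrite mnmDE mulmnE mnm1E eqxx me mul1n.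
have := (xdeg_ltP _ _ _).1 (hq i j) m'; rewrite m'k leq_addl => /(_ isT).
have qT : mxdeg_lt k (e.+1 + d).-1 (q *m Theta) by apply: mxdeg_ltM.
have := (xdeg_ltP _ _ _).1 (qT i j) m'.
rewrite m'k addSn leqnn => /(_ isT).
have -> : (q *m Phi) i j = 'X_k ^+ d * q i j - (q *m Theta) i j.
  by rewrite mulmxBr mul_mx_scalar !mxE.
by rewrite mcoeffB => ->; rewrite mulrC mpolyXn /m' addmC mcoeffMX subr0.
Qed.

End Division.

Section Koszul.
Variables (K : comNzRingType) (n r : nat) (xi : 'I_n -> 'M[{mpoly K[n]}]_r).
Implicit Type X : seq 'I_n.

Definition kphi (x : 'I_n) : 'M_r := ('X_x)%:M - xi x.

Fixpoint ksize X : nat := if X is _ :: X' then (ksize X' + ksize X')%N else r.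

(** The endomorphism [A] acting on each of the 2^|X| copies of the free module of rank r. *)
Fixpoint kdiag X (A : 'M[{mpoly K[n]}]_r) : 'M_(ksize X) :=
  match X with
  | [::] => A
  | _ :: X' => block_mx (kdiag X' A) 0 0 (kdiag X' A)
  end.

(* the Koszul complex of the commuting endomorphisms [kphi x], x in X, of the
   free module of rank r, all homological degrees together: adding a variable x
   amounts to taking the mapping cone of [kphi x] *)
Fixpoint kdiff X : 'M[{mpoly K[n]}]_(ksize X) :=
  match X with
  | [::] => 0
  | x :: X' => block_mx (kdiff X') 0 (kdiag X' (kphi x)) (- kdiff X')
  end.

Fixpoint kinj X (w : 'rV[{mpoly K[n]}]_r) : 'rV_(ksize X) :=
  match X with
  | [::] => w
  | _ :: X' => row_mx (kinj X' w) 0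
  end.

(** The homological degree of a basis element: the number of variables of [X] whose cone shift it
    carries. *)
Fixpoint khd X : 'I_(ksize X) -> nat :=
  match X with
  | [::] => fun=> 0%N
  | _ :: X' => fun i =>
      match split i with inl j => khd j | inr j => (khd j).+1 end
  end.

Fixpoint ktop X (l : 'I_r) : 'I_(ksize X) :=
  match X with
  | [::] => l
  | _ :: X' => rshift (ksize X') (ktop X' l)
  end.

Lemma kdiagB X A B : kdiag X (A - B) = kdiag X A - kdiag X B.
Proof.
elim: X => //= x X ->; rewrite opp_block_mx add_block_mx !oppr0 !addr0 //.
Qed.

Lemma kdiag_scalar X a : kdiag X a%:M = a%:M.
Proof. by elim: X => //= x X ->; rewrite -scalar_mx_block. Qed.

Lemma kdiagM X A B : kdiag X (A *m B) = kdiag X A *m kdiag X B.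
Proof.
elim: X => //= x X ->.
by rewrite mulmx_block !mulmx0 !mul0mx !addr0 !add0r.
Qed.

Lemma kdiff_kdiag X A : (forall x, x \in X -> comm_mx A (kphi x)) ->
  comm_mx (kdiag X A) (kdiff X).
Proof.
elim: X => [_|x X IH hA]; first by rewrite /comm_mx /= mulmx0 mul0mx.
have {}IH : comm_mx (kdiag X A) (kdiff X).
  by apply: IH => y yX; apply: hA; rewrite inE yX orbT.
rewrite /comm_mx /= !mulmx_block !mulmx0 !mul0mx !addr0 !add0r.
by rewrite IH mulmxN mulNmx IH -!kdiagM hA // mem_head.
Qed.

Lemma kdiff_sqr X :
  (forall x y, x \in X -> y \in X -> comm_mx (kphi x) (kphi y)) ->
  kdiff X *m kdiff X = 0.
Proof.
elim: X => [_|x X IH hX]; first by rewrite /= mulmx0.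
have {}IH : kdiff X *m kdiff X = 0.
  by apply: IH => y z yX zX; apply: hX; rewrite inE ?yX ?zX orbT.
have hc : comm_mx (kdiag X (kphi x)) (kdiff X).
  by apply: kdiff_kdiag => y yX; apply: hX; rewrite inE ?eqxx ?yX ?orbT.
rewrite /= mulmx_block !mulmx0 !mul0mx !addr0 !add0r.
by rewrite !mulNmx !mulmxN IH hc addrN !oppr0 block_mx0.
Qed.

Lemma mxdeg_lt0 a b k d : mxdeg_lt k d (0 : 'M[{mpoly K[n]}]_(a, b)).
Proof. by move=> i j; rewrite mxE; apply: xdeg_lt0. Qed.

Lemma mxdeg_lt_block m1 m2 n1 n2 k d (A : 'M[{mpoly K[n]}]_(m1, n1))
    (B : 'M_(m1, n2)) (C : 'M_(m2, n1)) (D : 'M_(m2, n2)) :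
  mxdeg_lt k d A -> mxdeg_lt k d B -> mxdeg_lt k d C -> mxdeg_lt k d D ->
  mxdeg_lt k d (block_mx A B C D).
Proof.
move=> hA hB hC hD i j.
rewrite -[i](splitK i) -[j](splitK j).
case: (split i) => i'; case: (split j) => j' /=.
- by rewrite block_mxEul.
- by rewrite block_mxEur.
- by rewrite block_mxEdl.
by rewrite block_mxEdr.
Qed.

Lemma mxdeg_lt_kdiag X k d A : mxdeg_lt k d A -> mxdeg_lt k d (kdiag X A).
Proof.
by move=> hA; elim: X => //= x X IH; apply: mxdeg_lt_block => //; apply: mxdeg_lt0.
Qed.

Lemma mxdeg_lt_kphi x k :
  x != k -> mxdeg_lt k 1 (xi x) -> mxdeg_lt k 1 (kphi x).
Proof.
move=> xk hx; apply: mxdeg_ltB => // i j; rewrite mxE.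
case: eqP => _; last by rewrite mulr0n; apply: xdeg_lt0.
by rewrite mulr1n; apply: xdeg_ltX; rewrite mnm1E (negPf xk).
Qed.

Lemma mxdeg_lt_kdiff X k :
  k \notin X -> (forall x, x \in X -> mxdeg_lt k 1 (xi x)) ->
  mxdeg_lt k 1 (kdiff X).
Proof.
elim: X => [_ _|x X IH]; first exact: mxdeg_lt0.
rewrite inE negb_or => /andP[kx kX] hX /=.
have {}IH : mxdeg_lt k 1 (kdiff X).
  by apply: IH => // y yX; apply: hX; rewrite inE yX orbT.
apply: mxdeg_lt_block => //; first exact: mxdeg_lt0.
  by apply: mxdeg_lt_kdiag; apply: mxdeg_lt_kphi; [rewrite eq_sym | apply: hX; rewrite mem_head].
exact: mxdeg_ltN.
Qed.

(* Every cycle is homologous to one concentrated in degree 0 with coordinates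
   free of the variables of X: divide by the last endomorphism, whose kernel and
   cokernel are controlled by the uniqueness of the division. *)
Lemma kcycle (X0 : pred 'I_n) X (u : 'rV_(ksize X)) :
  (forall x y, X0 y -> mxdeg_lt y 1 (xi x)) ->
  (forall x y, comm_mx (xi x) (xi y)) ->
  all X0 X -> uniq X -> u *m kdiff X = 0 ->
  exists v w, [/\ u = v *m kdiff X + kinj X w,
    (forall j, j \in X -> mxdeg_lt j 1 w) &
    (forall j, X0 j -> j \notin X -> mxdeg_lt j 1 u -> mxdeg_lt j 1 w)].
Proof.
move=> xi_free xi_comm.
have phi_comm x y : comm_mx (kphi x) (kphi y).
  rewrite /kphi; apply: comm_mxB; last apply: comm_mx_sym.
    by apply: comm_mx_scalar.
  by apply: comm_mxB; [apply: comm_mx_scalar | apply: xi_comm].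
elim: X u => [|x X IH] u.
  move=> _ _ _; exists 0, u; rewrite /= mulmx0 add0r; split=> // j; by rewrite in_nil.
move=> /= /andP[X0x X0X] /andP[xX uX].
rewrite -[u]hsubmxK; set c1 := lsubmx u; set c2 := rsubmx u.
rewrite mul_row_block mulmx0 add0r mulmxN => /eqP.
rewrite row_mx_eq0 oppr_eq0 => /andP[/eqP e1 /eqP e2].
have kphiE : kdiag X (kphi x) = ('X_x ^+ 1)%:M - kdiag X (xi x).
  by rewrite kdiagB kdiag_scalar expr1.
have xid : mxdeg_lt x 1 (kdiag X (xi x)).
  by apply: mxdeg_lt_kdiag; apply: xi_free.
have dX : mxdeg_lt x 1 (kdiff X).
  by apply: mxdeg_lt_kdiff => // y _; apply: xi_free.
have [q [rho [c1E rhod hfree]]] := divmx_exists xid c1.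
have dcomm : comm_mx (kdiag X (kphi x)) (kdiff X) by apply: kdiff_kdiag.
(* The first component of the cycle equation, after inserting the division of [c1] by the
   endomorphism of [x]. *)
have h : (q *m kdiff X + c2) *m kdiag X (kphi x) = - (rho *m kdiff X).
  apply/eqP; rewrite -addr_eq0 mulmxDl -mulmxA -dcomm mulmxA.
  by rewrite -[X in _ == X]e1 [in X in _ == X]c1E mulmxDl -kphiE addrAC.
have rdX : mxdeg_lt x 1 (rho *m kdiff X).
  by apply: (mxdeg_ltM (d := 1) (e := 1)).
(* The right side of [h] is free of [x], so it is a remainder, and uniqueness of the division forces
   its quotient to vanish. *)
have c2E : c2 = - (q *m kdiff X).
  apply/eqP; rewrite -addr_eq0 addrC; apply/eqP.
  apply: (divmx_unique xid); rewrite -kphiE h.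
  exact: mxdeg_ltN.
have rho0 : rho *m kdiff X = 0.
  by apply/eqP; rewrite -oppr_eq0 -h c2E addrN mul0mx.
have [v [w [rhoE wX wX0]]] := IH rho X0X uX rho0.
exists (row_mx v q), w; split.
- rewrite mul_row_block mulmx0 add0r add_row_mx addr0 mulmxN -c2E.
  congr row_mx; rewrite c1E -kphiE [in LHS]rhoE addrA.
  by congr (_ + _); rewrite addrC.
- move=> j; rewrite inE => /orP[/eqP -> |]; last exact: wX.
  exact: wX0.
move=> j X0j; rewrite inE negb_or => /andP[jx jX] ju.
apply: wX0 => //.
have c1j : mxdeg_lt j 1 c1 by move=> a b; rewrite mxE -[u]hsubmxK; apply: ju.
by have [||_] := hfree j jx => //; apply: mxdeg_lt_kdiag; apply: xi_free.
Qed.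

Lemma ksplitP X x (P : 'I_(ksize (x :: X)) -> Prop) :
  (forall j : 'I_(ksize X), P (lshift (ksize X) j)) ->
  (forall j : 'I_(ksize X), P (rshift (ksize X) j)) -> forall i, P i.
Proof.
by move=> hl hr i; rewrite -[i](@splitK (ksize X) (ksize X)); case: (split i).
Qed.

Lemma khd_lshift x X (j : 'I_(ksize X)) :
  @khd (x :: X) (lshift (ksize X) j) = khd j.
Proof. by rewrite /= (unsplitK (inl j)). Qed.

Lemma khd_rshift x X (j : 'I_(ksize X)) :
  @khd (x :: X) (rshift (ksize X) j) = (khd j).+1.
Proof. by rewrite /= (unsplitK (inr j)). Qed.

Lemma kdiag_hd X A (i j : 'I_(ksize X)) : khd i != khd j -> kdiag X A i j = 0.
Proof.
elim: X i j => [i j|x X IH]; first by rewrite eqxx.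
apply: ksplitP => i; apply: ksplitP => j; rewrite ?khd_lshift ?khd_rshift => h /=.
- by rewrite block_mxEul IH.
- by rewrite block_mxEur mxE.
- by rewrite block_mxEdl mxE.
by rewrite block_mxEdr IH // -eqSS.
Qed.

Lemma kdiff_hd X (i j : 'I_(ksize X)) : khd i != (khd j).+1 -> kdiff X i j = 0.
Proof.
elim: X i j => [i j _|x X IH]; first by rewrite mxE.
apply: ksplitP => i; apply: ksplitP => j; rewrite ?khd_lshift ?khd_rshift => h /=.
- by rewrite block_mxEul IH.
- by rewrite block_mxEur mxE.
- by rewrite block_mxEdl kdiag_hd.
by rewrite block_mxEdr mxE IH ?oppr0 // -eqSS.
Qed.

Lemma khd_ktop X l : khd (ktop X l) = size X.
Proof. by elim: X => // x X IH; rewrite khd_rshift IH. Qed.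

Section Augmentation.
Variables (M : lmodType {mpoly K[n]}) (b : 'I_r -> M).

Fixpoint kaug X : 'I_(ksize X) -> M :=
  match X with
  | [::] => b
  | _ :: X' => fun i => match split i with inl j => kaug j | inr j => 0 end
  end.

Lemma kaug_kinj X w : \sum_i kinj X w 0 i *: kaug i = \sum_l w 0 l *: b l.
Proof.
elim: X => //= x X IH; rewrite big_split_ord /=.
rewrite [X in _ + X]big1 ?addr0; last first.
  by move=> i _; rewrite row_mxEr mxE scale0r.
rewrite -IH; apply: eq_bigr => i _.
by rewrite row_mxEl (unsplitK (inl i)).
Qed.

Lemma kaug_kdiag X (A : 'M_r) : (forall l, \sum_m A l m *: b m = 0) ->
  forall i, \sum_j kdiag X A i j *: kaug j = 0.
Proof.
move=> hA; elim: X => [|x X IH]; first exact: hA.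
apply: ksplitP => i; rewrite big_split_ord /=.
  rewrite [X in _ + X]big1 ?addr0; last first.
    by move=> j _; rewrite (unsplitK (inr j)) scaler0.
  rewrite -[RHS](IH i); apply: eq_bigr => j _.
  by rewrite block_mxEul (unsplitK (inl j)).
rewrite !big1 ?addr0 // => j _; first by rewrite (unsplitK (inr j)) scaler0.
by rewrite block_mxEdl mxE scale0r.
Qed.

Lemma kaug_kdiff X :
  (forall x l, x \in X -> \sum_m kphi x l m *: b m = 0) ->
  forall i, \sum_j kdiff X i j *: kaug j = 0.
Proof.
elim: X => [_ i|x X IH hX].
  by rewrite big1 // => j _; rewrite mxE scale0r.
have {}IH : forall i : 'I_(ksize X), \sum_j kdiff X i j *: kaug j = 0.
  by apply: IH => y l yX; apply: hX; rewrite inE yX orbT.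
apply: ksplitP => i; rewrite big_split_ord /=.
  rewrite [X in _ + X]big1 ?addr0; last first.
    by move=> j _; rewrite (unsplitK (inr j)) scaler0.
  rewrite -[RHS](IH i); apply: eq_bigr => j _.
  by rewrite block_mxEul (unsplitK (inl j)).
rewrite [X in _ + X]big1 ?addr0; last first.
  by move=> j _; rewrite (unsplitK (inr j)) scaler0.
rewrite -[RHS](@kaug_kdiag X (kphi x) _ i); last by move=> l; apply: hX; rewrite mem_head.
apply: eq_bigr => j _.
by rewrite block_mxEdl (unsplitK (inl j)).
Qed.

Lemma kaug_hd X (i : 'I_(ksize X)) : khd i != 0%N -> kaug i = 0.
Proof.
elim: X i => [i|x X IH]; first by rewrite eqxx.
apply: ksplitP => i; rewrite ?khd_lshift ?khd_rshift => h /=.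
  by rewrite (unsplitK (inl i)) IH.
by rewrite (unsplitK (inr i)).
Qed.

End Augmentation.
End Koszul.

Lemma map_kdiag (K : comNzRingType) (n r : nat) (R' : nzRingType)
    (f : {rmorphism {mpoly K[n]} -> R'}) (X : seq 'I_n) (A B : 'M_r) :
  map_mx f A = map_mx f B -> map_mx f (kdiag X A) = map_mx f (kdiag X B).
Proof.
by move=> hAB; elim: X => //= x X IH; rewrite !map_block_mx IH !map_mx0.
Qed.

(** Applied to the constant coefficient, this identifies the Koszul complexes of the two rings
    modulo the variables. *)
Lemma map_kdiff (K : comNzRingType) (n r : nat) (R' : nzRingType)
    (f : {rmorphism {mpoly K[n]} -> R'}) (X : seq 'I_n) (xi xi' : 'I_n -> 'M_r) :
  (forall x, x \in X -> map_mx f (xi x) = map_mx f (xi' x)) ->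
  map_mx f (kdiff xi X) = map_mx f (kdiff xi' X).
Proof.
elim: X => [_|x X IH hX] /=; first by rewrite !map_mx0.
have {}IH : map_mx f (kdiff xi X) = map_mx f (kdiff xi' X).
  by apply: IH => y yX; apply: hX; rewrite inE yX orbT.
rewrite !map_block_mx !map_mxN !map_mx0 IH; congr block_mx.
by apply: map_kdiag; rewrite /kphi !map_mxB hX ?mem_head.
Qed.

(** * Comparison of graded resolutions *)

(** The type varies with the index because the matrices of chain maps and homotopies change size;
    [Q] is the invariant that makes the next step possible. *)
Lemma dependent_choice (T : nat -> Type) (Q : forall i, T i -> Prop)
    (P : T 0%N -> Prop) (S : forall i, T i -> T i.+1 -> Prop) :
  (exists x, P x /\ Q 0%N x) ->
  (forall i x, Q i x -> exists y, S i x y /\ Q i.+1 y) ->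
  exists f : forall i, T i, [/\ P (f 0%N), forall i, Q i (f i)
    & forall i, S i (f i) (f i.+1)].
Proof.
move=> /cid[x0 [Px0 Qx0]] next.
pose step i (x : {x : T i | Q i x}) : {x : T i.+1 | Q i.+1 x} :=
  let e := cid (next i (projT1 x) (projT2 x)) in
  exist _ (projT1 e) (proj2 (projT2 e)).
pose g := fix g i : {x : T i | Q i x} :=
  match i with 0%N => exist _ x0 Qx0 | j.+1 => step j (g j) end.
exists (fun i => projT1 (g i)); split=> // i; first exact: (projT2 (g i)).
by rewrite /= /step; case: cid => y /= [].
Qed.

Section Homogeneous.
Variables (K : fieldType) (n : nat) (Gr : nmodType) (w : 'I_n -> Gr).
Implicit Types (p q : {mpoly K[n]}).

Lemma wdegD m m' : wdeg w (m + m')%MM = wdeg w m + wdeg w m'.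
Proof.
rewrite /wdeg; under eq_bigr do rewrite mnmDE mulrnDr.
exact: big_split.
Qed.

Lemma wdeg0 : wdeg w 0%MM = 0.
Proof. by rewrite /wdeg big1 // => j _; rewrite mnm0E. Qed.

Lemma wdegU j : wdeg w U_(j)%MM = w j.
Proof.
rewrite /wdeg (bigD1 j) //= mnm1E eqxx big1 ?addr0 // => i ij.
by rewrite mnm1E eq_sym (negPf ij).
Qed.

Lemma whomogM p q g h l :
  whomog w p g h -> whomog w q l g -> whomog w (p * q) l h.
Proof.
move=> hp hq m /msuppM_le /allpairsP[[a b] /= [/hp ha /hq hb ->]].
by rewrite wdegD -addrA hb ha.
Qed.

Lemma whomog_sum (I : Type) (r : seq I) (P : pred I) (F : I -> {mpoly K[n]}) g h :
  (forall i, P i -> whomog w (F i) g h) -> whomog w (\sum_(i <- r | P i) F i) g h.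
Proof.
move=> hF; apply: (big_ind (fun p => whomog w p g h)) => // [m|p q hp hq m].
  by rewrite msupp0.
by move=> /msuppD_le; rewrite mem_cat => /orP[/hp|/hq].
Qed.

Lemma whomogN p g h : whomog w p g h -> whomog w (- p) g h.
Proof. by move=> hp m; rewrite (perm_mem (msuppN p)) => /hp. Qed.

(** The part of a coordinate that contributes to degree [t] on a basis element of degree [g]; it is
    phrased by addition because [Gr] has no subtraction. *)
Definition hpart g t p := mpart (fun m => wdeg w m + g == t) p.

Lemma whomog_hpart g t p : whomog w (hpart g t p) g t.
Proof. by move=> m /msupp_mpart /andP[/eqP]. Qed.

Lemma hpart_id g t p : whomog w p g t -> hpart g t p = p.
Proof.
move=> hp; apply/mpolyP => m; rewrite mcoeff_mpart.
case: eqP => // ne; case: (boolP (m \in msupp p)) => [/hp //|].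
by move/memN_msupp_eq0 ->.
Qed.

Lemma hpartM g h t p q :
  whomog w q g h -> hpart g t (p * q) = hpart h t p * q.
Proof. by move=> hq; apply: mpartM => m m' /hq e; rewrite wdegD -addrA e. Qed.

Definition mhom a b (sha : 'I_a -> Gr) (shb : 'I_b -> Gr)
    (A : 'M[{mpoly K[n]}]_(a, b)) :=
  forall k l, whomog w (A k l) (shb l) (sha k).

Lemma mhomM a b c (sha : 'I_a -> Gr) (shb : 'I_b -> Gr) (shc : 'I_c -> Gr) A B :
  mhom sha shb A -> mhom shb shc B -> mhom sha shc (A *m B).
Proof. by move=> hA hB k l; rewrite mxE; apply: whomog_sum => j _; apply: whomogM. Qed.

Definition hrow b (shb : 'I_b -> Gr) t (u : 'rV[{mpoly K[n]}]_b) :=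
  \row_k hpart (shb k) t (u 0 k).

Lemma mhom_hrow b (shb : 'I_b -> Gr) t u : mhom (fun=> t) shb (hrow shb t u).
Proof. by move=> k l; rewrite mxE; apply: whomog_hpart. Qed.

Lemma hrow_id b (shb : 'I_b -> Gr) t u : mhom (fun=> t) shb u -> hrow shb t u = u.
Proof. by move=> hu; apply/rowP => k; rewrite mxE hpart_id. Qed.

Lemma hrowM b c (shb : 'I_b -> Gr) (shc : 'I_c -> Gr) t u D :
  mhom shb shc D -> hrow shc t (u *m D) = hrow shb t u *m D.
Proof.
move=> hD; apply/rowP => k; rewrite !mxE /hpart raddf_sum.
by apply: eq_bigr => j _; rewrite mxE; apply: hpartM.
Qed.

End Homogeneous.

Section Complex.
Variables (K : fieldType) (n : nat) (M : lmodType {mpoly K[n]}).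
Variables (rk : nat -> nat) (df : forall i, 'M[{mpoly K[n]}]_(rk i.+1, rk i)).
Variable (au : 'I_(rk 0) -> M).

(** At index 0 the augmentation takes the role of the differential, so complex and exact refer to
    the augmented sequence. *)
Definition cycle i m : 'M[{mpoly K[n]}]_(m, rk i) -> Prop :=
  match i with
  | 0%N => fun x => forall k, \sum_l x k l *: au l = 0
  | j.+1 => fun x => x *m df j = 0
  end.

Definition is_complex := forall i, cycle (df i).

Definition exact_complex :=
  forall i (u : 'rV_(rk i)), cycle u -> exists v, u = v *m df i.

Lemma cycle_row i m (x : 'M_(m, rk i)) k : cycle x -> cycle (row k x).
Proof.
case: i x => [|i] x /= hx.
  by move=> k'; rewrite -[RHS](hx k); apply: eq_bigr => l _; rewrite mxE.
by rewrite -row_mul hx row0.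
Qed.

Lemma exact_mx i m (x : 'M_(m, rk i)) :
  exact_complex -> cycle x -> exists y, x = y *m df i.
Proof.
move=> ex hx.
have /choice[y yE] k : exists v, row k x = v *m df i.
  by apply: ex; apply: cycle_row.
exists (\matrix_k y k); apply/row_matrixP => k.
by rewrite row_mul rowK.
Qed.

(** Exactness gives some preimage of each row, and its homogeneous component of the right degree is
    again a preimage. *)
Lemma exact_mx_hom (Gr : nmodType) (w : 'I_n -> Gr) (sh : forall i, 'I_(rk i) -> Gr)
    i m (sm : 'I_m -> Gr) (x : 'M_(m, rk i)) :
  (forall i, mhom w (@sh i.+1) (@sh i) (df i)) ->
  exact_complex -> cycle x -> mhom w sm (@sh i) x ->
  exists y, x = y *m df i /\ mhom w sm (@sh i.+1) y.
Proof.
move=> hdf ex hx xhom.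
have /choice[y yE] k : exists v, row k x = v *m df i /\ mhom w (fun=> sm k) (@sh i.+1) v.
  have [v vE] := ex _ _ (cycle_row k hx).
  exists (hrow w (@sh i.+1) (sm k) v); split; last exact: mhom_hrow.
  rewrite -(hrowM _ _ (hdf i)) -vE hrow_id // => a b.
  by rewrite mxE; apply: xhom.
exists (\matrix_k y k); split.
  by apply/row_matrixP => k; rewrite row_mul rowK; case: (yE k).
by move=> k l; rewrite mxE; case: (yE k) => _ /(_ 0 l).
Qed.

End Complex.

Section Lift.
Variables (K : fieldType) (n : nat) (M : lmodType {mpoly K[n]}).
Variables (Gr : nmodType) (w : 'I_n -> Gr).
Variables (rF : nat -> nat) (dF : forall i, 'M[{mpoly K[n]}]_(rF i.+1, rF i)).
Variables (aF : 'I_(rF 0) -> M) (shF : forall i, 'I_(rF i) -> Gr).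
Variables (rG : nat -> nat) (dG : forall i, 'M[{mpoly K[n]}]_(rG i.+1, rG i)).
Variables (aG : 'I_(rG 0) -> M) (shG : forall i, 'I_(rG i) -> Gr).
Hypothesis dF_hom : forall i, mhom w (@shF i.+1) (@shF i) (dF i).
Hypothesis dG_hom : forall i, mhom w (@shG i.+1) (@shG i) (dG i).
Hypothesis F_complex : is_complex dF aF.
Hypothesis G_exact : exact_complex dG aG.
Hypothesis aug_lift : forall k, exists u : 'rV_(rG 0),
  aF k = \sum_l u 0 l *: aG l /\ mhom w (fun=> shF k) (@shG 0%N) u.

Lemma chain_lift : exists f : forall i, 'M_(rF i, rG i),
  [/\ (forall k, aF k = \sum_l f 0%N k l *: aG l),
      (forall i, mhom w (@shF i) (@shG i) (f i))
    & (forall i, f i.+1 *m dG i = dF i *m f i)].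
Proof.
(* The second condition is what exactness of G needs in order to produce the next matrix of the
   chain map. *)
pose Q i (x : 'M_(rF i, rG i)) :=
  mhom w (@shF i) (@shG i) x /\ cycle dG aG (dF i *m x).
have [||f [h1 h2 h3]] := @dependent_choice (fun i => 'M_(rF i, rG i)) Q
    (fun x => forall k, aF k = \sum_l x k l *: aG l)
    (fun i x y => y *m dG i = dF i *m x).
- have /choice[u uE] := aug_lift.
  have aE k : aF k = \sum_l (\matrix_k u k) k l *: aG l.
    by case: (uE k) => -> _; apply: eq_bigr => l _; rewrite mxE.
  exists (\matrix_k u k); split=> //; split.
    by move=> k l; rewrite mxE; case: (uE k) => _ /(_ 0 l).
  move=> k; rewrite -[RHS](F_complex 0%N k).
  under eq_bigr do rewrite mxE scaler_suml.
  rewrite exchange_big; apply: eq_bigr => j _; rewrite aE scaler_sumr.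
  by apply: eq_bigr => l _; rewrite scalerA.
- move=> i x [xhom xcyc].
  have [|y [yE yhom]] := exact_mx_hom (sh := shG) dG_hom G_exact xcyc (sm := @shF i.+1).
    exact: (mhomM (@dF_hom i) xhom).
  exists y; split=> //; split=> //=.
  by rewrite -mulmxA -yE mulmxA (F_complex i.+1) mul0mx.
by exists f; split=> // i; case: (h2 i).
Qed.

End Lift.

Section Homotopy.
Variables (K : fieldType) (n : nat) (M : lmodType {mpoly K[n]}).
Variables (rF : nat -> nat) (dF : forall i, 'M[{mpoly K[n]}]_(rF i.+1, rF i)).
Variable (aF : 'I_(rF 0) -> M).
Variables (rG : nat -> nat) (dG : forall i, 'M[{mpoly K[n]}]_(rG i.+1, rG i)).
Variable (aG : 'I_(rG 0) -> M).
Hypothesis F_complex : is_complex dF aF.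
Hypothesis G_exact : exact_complex dG aG.
Variable f : forall i, 'M[{mpoly K[n]}]_(rF i, rG i).
Hypothesis f_chain : forall i, f i.+1 *m dG i = dF i *m f i.
Hypothesis f_aug : cycle dG aG (f 0%N).

Lemma null_homotopy : exists s : forall i, 'M_(rF i, rG i.+1),
  f 0%N = s 0%N *m dG 0%N /\
  forall i, f i.+1 = s i.+1 *m dG i.+1 + dF i *m s i.
Proof.
(* Since [f] is a chain map, this says that [f i.+1 - dF i *m s] is a cycle, hence of the form
   [s' *m dG i.+1]. *)
pose Q i (s : 'M_(rF i, rG i.+1)) := dF i *m (f i - s *m dG i) = 0.
have [||s [h1 h2 h3]] := @dependent_choice (fun i => 'M_(rF i, rG i.+1)) Q
    (fun s => f 0%N = s *m dG 0%N)
    (fun i s s' => f i.+1 = s' *m dG i.+1 + dF i *m s).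
- have [s sE] := exact_mx G_exact f_aug.
  by exists s; split=> //; rewrite /Q -sE subrr mulmx0.
- move=> i s Qs.
  have cyc : cycle dG aG (f i.+1 - dF i *m s).
    by rewrite /= mulmxBl f_chain -mulmxA -mulmxBr.
  have [s' s'E] := exact_mx G_exact cyc.
  exists s'; split; first by rewrite -s'E subrK.
  by rewrite /Q -s'E opprB addrC subrK mulmxA (F_complex i.+1) mul0mx.
by exists s.
Qed.

End Homotopy.

Section Compare.
Variables (K : fieldType) (n : nat) (M : lmodType {mpoly K[n]}).
Variables (Gr : nmodType) (w : 'I_n -> Gr).
Variables (rF : nat -> nat) (dF : forall i, 'M[{mpoly K[n]}]_(rF i.+1, rF i)).
Variables (aF : 'I_(rF 0) -> M) (shF : forall i, 'I_(rF i) -> Gr).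
Variables (rG : nat -> nat) (dG : forall i, 'M[{mpoly K[n]}]_(rG i.+1, rG i)).
Variables (aG : 'I_(rG 0) -> M) (shG : forall i, 'I_(rG i) -> Gr).
Hypothesis dF_hom : forall i, mhom w (@shF i.+1) (@shF i) (dF i).
Hypothesis dG_hom : forall i, mhom w (@shG i.+1) (@shG i) (dG i).
Hypotheses (F_complex : is_complex dF aF) (F_exact : exact_complex dF aF).
Hypotheses (G_complex : is_complex dG aG) (G_exact : exact_complex dG aG).
Hypothesis aF_lift : forall k, exists u : 'rV_(rG 0),
  aF k = \sum_l u 0 l *: aG l /\ mhom w (fun=> shF k) (@shG 0%N) u.
Hypothesis aF_surj : forall x, exists u : 'rV_(rF 0), x = \sum_l u 0 l *: aF l.
Hypothesis F_min : forall i, map_mx (mcoeff 0%MM) (dF i) = 0.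

(** Modulo the variables the complex simply ends at index 0, so everything there is a cycle, unlike
    in [cycle]. *)
Definition cycle0 (d : forall i, 'M[K]_(rG i.+1, rG i)) i m : 'M[K]_(m, rG i) -> Prop :=
  match i with
  | 0%N => fun=> True
  | j.+1 => fun x => x *m d j = 0
  end.

Let c0 := mcoeff (R := K) (n := n) 0%MM.
Let d0 i := map_mx c0 (dG i).

(* Over the residue field a minimal resolution F is, up to homotopy, a retract of
   an arbitrary resolution G, so that F_i computes the homology of G at i. *)
Lemma compare_minimal i : exists (f : 'M[K]_(rF i, rG i)) (g : 'M_(rG i, rF i)),
  [/\ f *m g = 1%:M,
      (forall k l, f k l != 0 -> shF k = shG l),
      cycle0 d0 f, d0 i *m g = 0
    & forall m (x : 'M_(m, rG i)), cycle0 d0 x ->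
        exists y, x *m (g *m f) = x + y *m d0 i].
Proof.
have [f [fa fhom fc]] := chain_lift dF_hom dG_hom F_complex G_exact aF_lift.
(* With all degrees equal to 0 every matrix is homogeneous, so [chain_lift] also yields ungraded
   chain maps; only [f] has to respect the degrees. *)
have triv_hom a b (A : 'M[{mpoly K[n]}]_(a, b)) :
    mhom (fun _ : 'I_n => 0%N) (fun=> 0%N) (fun=> 0%N) A.
  by move=> k l m _; rewrite /wdeg big1 // => j _; rewrite mul0rn.
have [|g [ga _ gc]] := @chain_lift _ _ _ nat (fun=> 0%N) rG dG aG (fun _ _ => 0%N)
    rF dF aF (fun _ _ => 0%N) (fun i => triv_hom _ _ _) (fun i => triv_hom _ _ _)
    G_complex F_exact.
  move=> k; have [u uE] := aF_surj (aG k); exists u; split=> //.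
have aug_comp a b c (x : 'M[{mpoly K[n]}]_(a, b)) (y : 'M_(b, c)) (u : 'I_c -> M) k :
    \sum_l (x *m y) k l *: u l = \sum_j x k j *: (\sum_l y j l *: u l).
  under eq_bigr do rewrite mxE scaler_suml.
  rewrite exchange_big; apply: eq_bigr => j _; rewrite scaler_sumr.
  by apply: eq_bigr => l _; rewrite scalerA.
have aug_id a (u : 'I_a -> M) k : \sum_l (1%:M : 'M[{mpoly K[n]}]_a) k l *: u l = u k.
  rewrite (bigD1 k) //= mxE eqxx scale1r big1 ?addr0 // => l lk.
  by rewrite mxE eq_sym (negPf lk) scale0r.
(* Both terms of this homotopy contain a differential of F, which vanishes modulo the variables;
   hence [f *m g] reduces to the identity. *)
have [||s [sE0 sE]] := @null_homotopy _ _ _ _ _ _ _ _ _ F_complex F_exact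
    (fun i => f i *m g i - 1%:M).
- by move=> j; rewrite mulmxBl mulmxBr mul1mx mulmx1 -mulmxA gc !mulmxA fc.
- move=> k; under eq_bigr do rewrite mxE scalerDl.
  rewrite big_split /= aug_comp.
  rewrite (eq_bigr (fun j => f 0%N k j *: aG j)); last by move=> j _; rewrite -ga.
  rewrite -fa; apply/eqP; rewrite addr_eq0 -sumrN; apply/eqP.
  rewrite -[LHS](aug_id _ aF k); apply: eq_bigr => l _.
  by rewrite [fun_of_matrix (- _) k l]mxE scaleNr opprK.
(* On G the homotopy does not vanish modulo the variables: on a cycle one of its terms dies and the
   other is a boundary. *)
have [||t [tE0 tE]] := @null_homotopy _ _ _ _ _ _ _ _ _ G_complex G_exact
    (fun i => g i *m f i - 1%:M).
- by move=> j; rewrite mulmxBl mulmxBr mul1mx mulmx1 -mulmxA fc !mulmxA gc.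
- move=> k; under eq_bigr do rewrite mxE scalerDl.
  rewrite big_split /= aug_comp.
  rewrite (eq_bigr (fun j => g 0%N k j *: aF j)); last by move=> j _; rewrite -fa.
  rewrite -ga; apply/eqP; rewrite addr_eq0 -sumrN; apply/eqP.
  rewrite -[LHS](aug_id _ aG k); apply: eq_bigr => l _.
  by rewrite [fun_of_matrix (- _) k l]mxE scaleNr opprK.
exists (map_mx c0 (f i)), (map_mx c0 (g i)); split.
- apply/eqP; rewrite -subr_eq0 -(map_mx1 c0) -map_mxM -map_mxB.
  case: i => [|i]; first by rewrite sE0 map_mxM F_min mulmx0.
  by rewrite sE map_mxD !map_mxM !F_min mulmx0 mul0mx addr0.
- move=> k l; rewrite mxE -mcoeff_msupp => /fhom.
  by rewrite wdeg0 add0r.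
- case: i => //= i; rewrite /d0 -map_mxM fc map_mxM F_min mul0mx //.
- by rewrite /d0 -map_mxM -gc map_mxM F_min mulmx0.
move=> m x cx.
have -> : map_mx c0 (g i) *m map_mx c0 (f i) = map_mx c0 (g i *m f i - 1%:M) + 1%:M.
  by rewrite map_mxB map_mxM map_mx1 subrK.
rewrite mulmxDr mulmx1 addrC.
case: i x cx => [|i] x cx.
  by exists (x *m map_mx c0 (t 0%N)); rewrite tE0 map_mxM mulmxA.
exists (x *m map_mx c0 (t i.+1)); rewrite tE map_mxD !map_mxM mulmxDr !mulmxA.
by rewrite (_ : x *m map_mx c0 (dG i) = 0) // mul0mx addr0.
Qed.

End Compare.

(** * Hilbert basis theorem *)

Section IdealFacts.
Variable A : comPzRingType.
Implicit Types (E I : A -> Prop).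

Lemma ideal_gen_ideal E : is_ideal (ideal_gen E).
Proof.
by split; [apply: ideal_gen0 | move=> x y; apply: ideal_genD | move=> a x; apply: ideal_genMl].
Qed.

Lemma ideal_gen_sub E I : is_ideal I -> (forall x, E x -> I x) ->
  forall x, ideal_gen E x -> I x.
Proof. by move=> [I0 ID IM] EI; apply: ideal_gen_ind => // a e /EI; apply: IM. Qed.

Lemma ideal_gen_mono E E' : (forall x, E x -> E' x) ->
  forall x, ideal_gen E x -> ideal_gen E' x.
Proof.
by move=> h; apply: ideal_gen_sub (ideal_gen_ideal _) _ => x /h; apply: ideal_gen_mem.
Qed.

Lemma idealN I x : is_ideal I -> I x -> I (- x).
Proof. by move=> [_ _ IM] Ix; rewrite -mulN1r; apply: IM. Qed.

Lemma idealB I x y : is_ideal I -> I x -> I y -> I (x - y).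
Proof. by move=> hI Ix Iy; case: (hI) => _ ID _; apply: ID => //; apply: idealN. Qed.

Lemma ideal_sum I (T : Type) (r : seq T) (P : pred T) (F : T -> A) :
  is_ideal I -> (forall i, P i -> I (F i)) -> I (\sum_(i <- r | P i) F i).
Proof. by move=> [I0 ID _] hF; apply: (big_ind I). Qed.

End IdealFacts.

Section IdealMorphisms.
Variables (A B : comPzRingType) (f : {rmorphism A -> B}).

Lemma preim_ideal (I : B -> Prop) : is_ideal I -> is_ideal (fun x => I (f x)).
Proof.
move=> [I0 ID IM]; split; first by rewrite rmorph0.
  by move=> x y; rewrite rmorphD; apply: ID.
by move=> a x; rewrite rmorphM; apply: IM.
Qed.

Lemma noetherian_surj : (forall y, exists x, y = f x) -> noetherian A -> noetherian B.
Proof.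
move=> fs nA I hI; have [xs hxs] := nA _ (preim_ideal hI).
exists [seq f x | x <- xs] => y; split; last first.
  apply: ideal_gen_sub => // _ /mapP[x xxs ->].
  by apply/hxs; apply: ideal_gen_mem.
have [x ->] := fs y => /hxs; move: x.
apply: ideal_gen_ind => [|x z hx hz|a e ein]; rewrite ?rmorph0 ?rmorphD ?rmorphM.
- exact: ideal_gen0.
- exact: ideal_genD.
by apply: ideal_genMl; apply: ideal_gen_mem; apply: map_f.
Qed.

End IdealMorphisms.

Section HilbertBasis.
Variable A : comNzRingType.
Hypothesis nA : noetherian A.

Let lc_ideal (I : {poly A} -> Prop) d (c : A) :=
  exists p, [/\ I p, (size p <= d.+1)%N & p`_d = c].

Let lc_ideal_is_ideal I d : is_ideal I -> is_ideal (lc_ideal I d).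
Proof.
move=> [I0 ID IM]; split.
- by exists 0; rewrite size_poly0 coef0.
- move=> x y [p [Ip sp <-]] [q [Iq sq <-]]; exists (p + q); rewrite coefD; split=> //.
    exact: ID.
  by rewrite (leq_trans (size_polyD _ _)) // geq_max sp sq.
move=> a x [p [Ip sp <-]]; exists (a%:P * p); rewrite coefCM; split=> //.
  exact: IM.
by rewrite mul_polyC (leq_trans (size_scale_leq _ _)).
Qed.

Let lc_idealS I d d' c : is_ideal I -> (d <= d')%N -> lc_ideal I d c -> lc_ideal I d' c.
Proof.
move=> [_ _ IM] dd' [p [Ip sp <-]]; exists ('X^(d' - d) * p); split.
- exact: IM.
- by rewrite (leq_trans (size_polyMleq _ _)) // size_polyXn; lia.
by rewrite coefXnM ltnNge leq_subr /= subKn.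
Qed.

Lemma noetherian_poly : noetherian {poly A}.
Proof.
move=> I hI; have [I0 ID IM] := hI.
(* Finitely many members of [I] realise, in degree [d], generators of the ideal of leading
   coefficients. *)
have /choice[ps psP] d : exists ps : seq {poly A}, (forall p, p \in ps -> I p) /\
    forall c, lc_ideal I d c -> exists g,
      [/\ ideal_gen (fun y => y \in ps) g, (size g <= d.+1)%N & g`_d = c].
  have [cs csP] := nA (lc_ideal_is_ideal d hI).
  have [ps [psI psc]] : exists ps : seq {poly A}, (forall p, p \in ps -> I p) /\
      forall c, c \in cs -> exists2 p, p \in ps & (size p <= d.+1)%N /\ p`_d = c.
    have : forall c, c \in cs -> lc_ideal I d c.
      by move=> c cin; apply/csP; apply: ideal_gen_mem.
    elim: cs {csP} => [_|c cs IH h]; first by exists [::]; split.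
    have [|ps [psI psc]] := IH; first by move=> e ein; apply: h; rewrite inE ein orbT.
    have [p [Ip sp pc]] := h c (mem_head _ _).
    exists (p :: ps); split=> q; rewrite inE.
      by move=> /orP[/eqP -> //|]; apply: psI.
    move=> /orP[/eqP ->|/psc[q' q'in q'P]]; first by exists p; rewrite ?mem_head.
    by exists q' => //; rewrite inE q'in orbT.
  exists ps; split=> // c /csP; move: c; apply: ideal_gen_ind.
  - by exists 0; split; [apply: ideal_gen0 | rewrite size_poly0 | rewrite coef0].
  - move=> x y [g [hg sg <-]] [g' [hg' sg' <-]]; exists (g + g'); split.
    + exact: ideal_genD.
    + by rewrite (leq_trans (size_polyD _ _)) // geq_max sg sg'.
    by rewrite coefD.
  move=> a e /psc[p pin [sp <-]]; exists (a%:P * p); rewrite coefCM; split=> //.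
    by apply: ideal_genMl; apply: ideal_gen_mem.
  by rewrite mul_polyC (leq_trans (size_scale_leq _ _)).
(* The ideals of leading coefficients increase with d; their union is finitely generated, so it is
   reached at some [D]. *)
have [D DP] : exists D, forall d c, lc_ideal I d c -> lc_ideal I D c.
  have [|cs csP] := nA (I := fun c => exists d, lc_ideal I d c).
    split; first by exists 0%N; case: (lc_ideal_is_ideal 0 hI).
      move=> x y [d hx] [e hy]; exists (maxn d e).
      case: (lc_ideal_is_ideal (maxn d e) hI) => _ + _; apply.
        by apply: lc_idealS hx => //; rewrite leq_maxl.
      by apply: lc_idealS hy => //; rewrite leq_maxr.
    move=> a x [d hx]; exists d; case: (lc_ideal_is_ideal d hI) => _ _; exact.
  have [D DP] : exists D, forall c, c \in cs -> lc_ideal I D c.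
    have : forall c, c \in cs -> exists d, lc_ideal I d c.
      by move=> c cin; apply/csP; apply: ideal_gen_mem.
    elim: cs {csP} => [_|c cs IH h]; first by exists 0%N.
    have [|D DP] := IH; first by move=> e ein; apply: h; rewrite inE ein orbT.
    have [d hd] := h c (mem_head _ _).
    exists (maxn d D) => e; rewrite inE => /orP[/eqP ->|/DP he].
      by apply: lc_idealS hd => //; rewrite leq_maxl.
    by apply: lc_idealS he => //; rewrite leq_maxr.
  exists D => d c hc; have /csP : exists d, lc_ideal I d c by exists d.
  by apply: ideal_gen_sub => //; apply: lc_ideal_is_ideal.
exists (flatten [seq ps d | d <- iota 0 D.+1]) => p; split; last first.
  apply: ideal_gen_sub => // q /flatten_mapP[d _]; exact: (psP d).1.
have [s] := ubnP (size p); elim: s p => // s IH p sps Ip.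
have [->|p0] := eqVneq p 0; first exact: ideal_gen0.
have szp : size p = (size p).-1.+1 by rewrite prednK // lt0n size_poly_eq0.
set d := (size p).-1 in szp.
have hc : lc_ideal I d p`_d by exists p; rewrite szp.
have {hc} hc : lc_ideal I (minn d D) p`_d.
  by rewrite /minn; case: ifP => // _; apply: DP hc.
have [g [hg sg gc]] := (psP (minn d D)).2 _ hc.
(* Above [D] no new generators exist, so a combination of degree at most [D] is shifted up to cancel
   the leading term of [p]. *)
pose q := 'X^(d - minn d D) * g.
have hq : ideal_gen (fun y => y \in flatten [seq ps d | d <- iota 0 D.+1]) q.
  apply: ideal_genMl; apply: ideal_gen_mono hg => y yin.
  by apply/flatten_mapP; exists (minn d D) => //; rewrite mem_iota add0n leq0n ltnS geq_minr.
have Iq : I q.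
  by apply: IM; apply: ideal_gen_sub hg => //; exact: (psP _).1.
have qd : q`_d = p`_d by rewrite coefXnM ltnNge leq_subr /= subKn ?geq_minl.
have sq : (size q <= d.+1)%N.
  rewrite (leq_trans (size_polyMleq _ _)) // size_polyXn.
  by have := geq_minl d D; lia.
rewrite -(subrK q p); apply: ideal_genD => //; apply: IH; last exact: idealB.
have : (size (p - q)%R <= d)%N.
  apply/leq_sizeP => j; rewrite leq_eqVlt => /orP[/eqP <-|dj].
    by rewrite coefB qd subrr.
  by rewrite coefB !nth_default ?subrr //; [apply: leq_trans sq dj | rewrite szp].
by move/leq_ltn_trans; apply; rewrite -ltnS -szp.
Qed.

End HilbertBasis.

Lemma noetherian_field (K : fieldType) : noetherian K.
Proof.
move=> I hI; have [I0 ID IM] := hI.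
have [[x Ix x0]|h] := pselect (exists2 x, I x & x != 0).
  exists [:: x] => y; split=> [Iy|].
    rewrite -(divfK x0 y); apply: ideal_genMl; apply: ideal_gen_mem.
    by rewrite mem_head.
  by apply: ideal_gen_sub => // z; rewrite inE => /eqP ->.
exists [::] => y; split=> [Iy|]; last by apply: ideal_gen_sub.
have -> : y = 0 by apply: contrapT => /eqP y0; apply: h; exists y.
exact: ideal_gen0.
Qed.

Lemma noetherian_mpoly (K : fieldType) n : noetherian {mpoly K[n]}.
Proof.
elim: n => [|n IH].
  apply: (noetherian_surj (f := @mpolyC 0 K)); last exact: noetherian_field.
  by move=> p; exists p@_0%MM; exact: nvar0_mpolyC.
(* The polynomial variable goes to the last variable; only surjectivity of this map is used. *)
pose f : {rmorphism {poly {mpoly K[n]}} -> {mpoly K[n.+1]}} :=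
  horner_eval ('X_ord_max : {mpoly K[n.+1]}) \o map_poly (@mwiden n K).
apply: (noetherian_surj (f := f)); last exact: noetherian_poly.
have fM p q : (exists x, p = f x) -> (exists x, q = f x) -> exists x, p * q = f x.
  by move=> [x ->] [y ->]; exists (x * y); rewrite rmorphM.
have fX i : exists x, 'X_i = f x.
  have [->|ni] := eqVneq i ord_max.
    by exists 'X; rewrite /f /= map_polyX /horner_eval hornerX.
  have ilt : (i < n)%N by rewrite ltn_neqAle -ltnS ltn_ord andbT; apply: contraNneq ni => e; apply/eqP/val_inj.
  exists ('X_(Ordinal ilt))%:P; rewrite /f /= map_polyC /= /horner_eval hornerC mwidenX mnmwiden1.
  by congr 'X_[U_(_)]; apply: val_inj.
move=> p; rewrite (mpolyE p); elim: (msupp p) => [|m s [x hx]].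
  by exists 0; rewrite big_nil rmorph0.
rewrite big_cons hx.
have [y ->] : exists y, p@_m *: 'X_[m] = f y.
  rewrite -mul_mpolyC; apply: (fM).
    by exists (p@_m)%:MP%:P; rewrite /f /= map_polyC /= /horner_eval hornerC mwidenC.
  rewrite mpolyXE_id; apply: (big_ind (fun q => exists x, q = f x)) => [||i _].
  - by exists 1; rewrite rmorph1.
  - exact: (fM).
  elim: (m i) => [|e IHe]; first by exists 1; rewrite expr0 rmorph1.
  by rewrite exprS; apply: (fM).
by exists (y + x); rewrite rmorphD.
Qed.

Definition is_submod (A : comNzRingType) r (N : 'rV[A]_r -> Prop) :=
  [/\ N 0, (forall u v, N u -> N v -> N (u + v)) & forall a u, N u -> N (a *: u)].

Lemma submod_mulmx (A : comNzRingType) r (N : 'rV[A]_r -> Prop) s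
    (G : 'M[A]_(s, r)) v :
  is_submod N -> (forall i, N (row i G)) -> N (v *m G).
Proof.
move=> [N0 ND NZ] hG; rewrite mulmx_sum_row.
by apply: (big_ind N) => // i _; apply: NZ.
Qed.

Definition submod_noetherian (A : comNzRingType) r :=
  forall N : 'rV[A]_r -> Prop, is_submod N ->
  exists s (G : 'M[A]_(s, r)), (forall i, N (row i G)) /\
    forall u, N u -> exists v, u = v *m G.

(** The first coordinates of [N] form a finitely generated ideal, and the elements with first
    coordinate 0 form a submodule in rank r. *)
Lemma submod_noetherian_step (A : comNzRingType) r :
  noetherian A -> submod_noetherian A r -> submod_noetherian A (1 + r).
Proof.
move=> nA IH N hN; have [N0 ND NZ] := hN.
have [|xs xsP] := nA (fun c => exists u : 'rV_(1 + r), N u /\ u 0 0 = c).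
  split; first by exists 0; rewrite mxE.
    by move=> x y [u [Nu <-]] [v [Nv <-]]; exists (u + v); rewrite mxE; split=> //; apply: ND.
  by move=> a x [u [Nu <-]]; exists (a *: u); rewrite mxE; split=> //; apply: NZ.
have /choice[g gP] (i : 'I_(size xs)) : exists u : 'rV_(1 + r), N u /\ u 0 0 = xs`_i.
  by apply/xsP; apply: ideal_gen_mem; apply: mem_nth.
have [|s [G' [G'N G'P]]] := IH (fun u => N (row_mx 0 u)).
  split; first by rewrite row_mx0.
    by move=> u v Nu Nv; rewrite -[0]addr0 -add_row_mx; apply: ND.
  by move=> a u Nu; rewrite -[0](scaler0 _ a) -scale_row_mx; apply: NZ.
pose G1 : 'M_(size xs, 1 + r) := \matrix_i g i.
have G1N i : N (row i G1) by rewrite rowK; exact: (gP i).1.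
exists (size xs + s)%N, (col_mx G1 (row_mx 0 G')); split.
  move=> i; rewrite -[i]splitK; case: (split i) => j /=.
    by rewrite rowKu.
  rewrite rowKd; have -> : row j (row_mx 0 G' : 'M_(s, 1 + r)) = row_mx 0 (row j G').
    by apply/rowP => k; rewrite !mxE; case: (split k) => l; rewrite !mxE.
  exact: G'N.
move=> u Nu.
have [v vE] : exists v : 'rV_(size xs), (v *m G1) 0 0 = u 0 0.
  have : ideal_gen (fun y => y \in xs) (u 0 0) by apply/xsP; exists u.
  move: (u 0 0); apply: ideal_gen_ind.
  - by exists 0; rewrite mul0mx mxE.
  - by move=> x y [v <-] [v' <-]; exists (v + v'); rewrite mulmxDl mxE.
  move=> a e ein; have ie : (index e xs < size xs)%N by rewrite index_mem.
  exists (a *: delta_mx 0 (Ordinal ie)); rewrite -scalemxAl -rowE mxE rowK.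
  by rewrite (gP _).2 /= nth_index.
pose u1 := u - v *m G1.
have Nu1 : N u1.
  apply: ND => //; rewrite -scaleN1r; apply: NZ; exact: submod_mulmx.
have u1E : u1 = row_mx 0 (rsubmx u1).
  rewrite -[LHS]hsubmxK; congr row_mx; apply/rowP => i.
  by rewrite ord1 [LHS]mxE lshift0 [LHS]mxE [X in _ + X]mxE vE subrr mxE.
have [|v' v'E] := G'P (rsubmx u1); first by rewrite -u1E.
exists (row_mx v v'); rewrite mul_row_col mul_mx_row mulmx0 -v'E -u1E.
by rewrite addrC subrK.
Qed.

Lemma submod_fg (A : comNzRingType) r : noetherian A -> submod_noetherian A r.
Proof.
move=> nA; elim: r => [|r IH]; last exact: submod_noetherian_step.
move=> N hN; exists 0%N, 0; split=> [[]//|u _]; exists 0; apply/matrixP => i [] //.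
Qed.

(** * Existence of minimal graded resolutions *)

Lemma mulmx_row' (A : comNzRingType) s r (D : 'M[A]_(s.+1, r)) k (v : 'rV_s.+1) :
  v *m D = v 0 k *: row k D + (\row_l v 0 (lift k l)) *m row' k D.
Proof.
rewrite mulmx_sum_row (bigD1_ord k) //=; congr (_ + _).
rewrite mulmx_sum_row; apply: eq_bigr => l _; rewrite mxE; congr (_ *: _).
by apply/rowP => j; rewrite !mxE.
Qed.

Section MinimalResolution.
Variables (K : fieldType) (n : nat) (Gr : nmodType) (w : 'I_n -> Gr).
Hypothesis Gr_cancel : forall a b c : Gr, a + c = b + c -> a = b.
Hypothesis w_pos : forall m, wdeg w m = 0 -> m = 0%MM.
Local Notation R := {mpoly K[n]}.

Definition graded_submod r (sh : 'I_r -> Gr) (N : 'rV[R]_r -> Prop) :=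
  is_submod N /\ forall t u, N u -> N (hrow w sh t u).

Definition row_degs r (sh : 'I_r -> Gr) (u : 'rV[R]_r) : seq Gr :=
  undup [seq wdeg w m + sh k | k <- enum 'I_r, m <- msupp (u 0 k)].

Lemma hrow_decomp r (sh : 'I_r -> Gr) (u : 'rV[R]_r) :
  u = \sum_(t <- row_degs sh u) hrow w sh t u.
Proof.
apply/rowP => k; apply/mpolyP => m; rewrite summxE raddf_sum /=.
under eq_bigr do rewrite mxE mcoeff_mpart.
have [c0|c0] := eqVneq (u 0 k)@_m 0.
  by rewrite big1 // => t _; rewrite c0 if_same.
have tin : wdeg w m + sh k \in row_degs sh u.
  rewrite mem_undup; apply/allpairsPdep; exists k, m; split=> //.
    by rewrite mem_enum.
  by rewrite mcoeff_msupp.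
rewrite (bigD1_seq _ tin) ?undup_uniq //= eqxx big1 ?addr0 // => t.
by rewrite eq_sym => /negPf ->.
Qed.

Definition hom_gens r (sh : 'I_r -> Gr) (N : 'rV[R]_r -> Prop) s :=
  exists (sh' : 'I_s -> Gr) (D : 'M[R]_(s, r)),
    mhom w sh' sh D /\ forall u, N u <-> exists v, u = v *m D.

(** The homogeneous components of finitely many generators belong to [N] and still generate it. *)
Lemma hom_gens_exists r (sh : 'I_r -> Gr) N : graded_submod sh N ->
  exists s, hom_gens sh N s.
Proof.
move=> [hN Nh]; have [s [G [GN NG]]] := submod_fg (@noetherian_mpoly K n) hN.
pose L := flatten [seq [seq (t, hrow w sh t (row i G)) | t <- row_degs sh (row i G)]
  | i <- enum 'I_s].
pose D : 'M[R]_(size L, r) := \matrix_j (nth (0, 0) L j).2.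
have LP x : x \in L -> exists i, x.2 = hrow w sh x.1 (row i G).
  by move=> /flatten_mapP[i _ /mapP[t _ ->]]; exists i.
have DN j : N (row j D).
  rewrite rowK; have [|i ->] := LP (nth (0, 0) L j); first exact: mem_nth.
  exact: Nh.
exists (size L), (fun j => (nth (0, 0) L j).1), D; split.
  move=> j k; rewrite mxE; have [|i ->] := LP (nth (0, 0) L j); first exact: mem_nth.
  exact: mhom_hrow.
move=> u; split=> [/NG[v ->]|[v ->]]; last exact: submod_mulmx.
have hS : is_submod (fun u => exists v, u = v *m D).
  split; first by exists 0; rewrite mul0mx.
    by move=> _ _ [v1 ->] [v2 ->]; exists (v1 + v2); rewrite mulmxDl.
  by move=> a _ [v1 ->]; exists (a *: v1); rewrite scalemxAl.
apply: (submod_mulmx v hS) => i; have [S0 SD SZ] := hS.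
rewrite (hrow_decomp sh (row i G)) big_seq; apply: (big_ind (fun u => exists v, u = v *m D)) => // t tin.
have hin : (t, hrow w sh t (row i G)) \in L.
  by apply/flatten_mapP; exists i; rewrite ?mem_enum //; apply: map_f.
have ilt : (index (t, hrow w sh t (row i G)) L < size L)%N by rewrite index_mem.
exists (delta_mx 0 (Ordinal ilt)); rewrite -rowE rowK /=.
by rewrite nth_index.
Qed.

(** In the component of degree [sh' k] of the relation, coordinate [k] is a nonzero constant,
    because by [w_pos] only the monomial 1 has degree 0. The relation then expresses generator [k]
    by the others. *)
Lemma hom_gens_drop r (sh : 'I_r -> Gr) N s (sh' : 'I_s.+1 -> Gr) (D : 'M[R]_(s.+1, r))
    (v : 'rV_s.+1) k :
  mhom w sh' sh D -> (forall u, N u <-> exists v, u = v *m D) ->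
  v *m D = 0 -> (v 0 k)@_0%MM != 0 -> hom_gens sh N s.
Proof.
move=> hD NP vD v0; pose v' := hrow w sh' (sh' k) v.
have v'D : v' *m D = 0.
  rewrite -(hrowM _ _ hD) vD; apply/rowP => j; rewrite !mxE /hpart raddf0 //.
have v'k : v' 0 k = ((v 0 k)@_0%MM)%:MP.
  apply/mpolyP => m; rewrite mxE mcoeff_mpart mcoeffC.
  case: eqP => [e|ne].
    have -> : m = 0%MM by apply: w_pos; apply: (Gr_cancel (c := sh' k)); rewrite e add0r.
    by rewrite eqxx mulr1.
  case: eqP => [m0|]; last by rewrite mulr0.
  by case: ne; rewrite m0 wdeg0 add0r.
have [y yE] : exists y, row k D = y *m row' k D.
  have := mulmx_row' D k v'; rewrite v'D v'k => /eqP; rewrite eq_sym addr_eq0 => /eqP e.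
  exists (- (((v 0 k)@_0%MM)^-1)%:MP *: (\row_l v' 0 (lift k l))).
  rewrite -scalemxAl scaleNr -scalerN -e scalerA -mpolyCM mulVf //.
  by rewrite mpolyC1 scale1r.
exists (fun l => sh' (lift k l)), (row' k D); split.
  by move=> l j; rewrite mxE; apply: hD.
move=> u; rewrite NP; split=> [[x ->]|[x ->]].
  exists (x 0 k *: y + \row_l x 0 (lift k l)).
  by rewrite (mulmx_row' D k) yE mulmxDl scalemxAl.
exists (\row_l (if unlift k l is Some l' then x 0 l' else 0)).
rewrite (mulmx_row' D k) mxE unlift_none scale0r add0r; congr (_ *m _).
by apply/rowP => l; rewrite !mxE liftK.
Qed.

(** Choosing the smallest number of homogeneous generators takes the place of the graded Nakayama
    lemma. *)
Lemma minimal_gens r (sh : 'I_r -> Gr) N : graded_submod sh N ->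
  exists s (sh' : 'I_s -> Gr) (D : 'M[R]_(s, r)),
  [/\ mhom w sh' sh D, (forall u, N u <-> exists v, u = v *m D)
    & forall v : 'rV_s, v *m D = 0 -> forall k, (v 0 k)@_0%MM = 0].
Proof.
move=> /hom_gens_exists[s0 hs0].
have ex : exists s, `[< hom_gens sh N s >] by exists s0; apply/asboolP.
have [s /asboolP[sh' [D [hD NP]]] smin] := ex_minnP ex.
exists s, sh', D; split=> // v vD k; apply: contrapT => /eqP v0.
case: s sh' D hD NP smin v vD k v0 => [|s] sh' D hD NP smin v vD k v0; first by case: k v0.
have : (s.+1 <= s)%N by apply: smin; apply/asboolP; apply: hom_gens_drop v0.
by rewrite ltnn.
Qed.

(** The state of the construction of a resolution: the last free module together with the kernel
    that remains to be covered. The field [sz_min] becomes minimality of the next differential. *)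
Record syzygy_stage := SyzygyStage {
  sz_rank : nat;
  sz_shift : 'I_sz_rank -> Gr;
  sz_set : 'rV[R]_sz_rank -> Prop;
  sz_graded : graded_submod sz_shift sz_set;
  sz_min : forall u, sz_set u -> forall k, (u 0 k)@_0%MM = 0
}.

Lemma syzygy_step (N : syzygy_stage) :
  exists (N' : syzygy_stage) (D : 'M[R]_(sz_rank N', sz_rank N)),
  [/\ mhom w (@sz_shift N') (@sz_shift N) D,
      (forall u, sz_set u <-> exists v, u = v *m D)
    & (forall v, @sz_set N' v <-> v *m D = 0)].
Proof.
have [s [sh' [D [hD NP Dmin]]]] := minimal_gens (sz_graded N).
have gr : graded_submod sh' (fun v => v *m D = 0).
  split; last first.
    move=> t u uD; rewrite -(hrowM _ _ hD) uD.
    by apply/rowP => j; rewrite !mxE /hpart raddf0.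
  split; first by rewrite mul0mx.
    by move=> u v hu hv; rewrite mulmxDl hu hv addr0.
  by move=> a u hu; rewrite -scalemxAl hu scaler0.
by exists (SyzygyStage gr Dmin), D.
Qed.

Variables (M : lmodType R) (comp : Gr -> M -> Prop) (e : M).
Hypothesis e_comp : comp 0 e.
Hypothesis e_gen : forall x, exists p : R, x = p *: e.
Hypothesis e_ann : forall (p : R) t, p *: e = 0 -> hpart w 0 t p *: e = 0.
Hypothesis e_min : forall (p : R), p *: e = 0 -> p@_0%MM = 0.

Lemma min_graded_res_exists : inhabited (min_graded_res w comp).
Proof.
(* The module is cyclic on [e], so the resolution starts with rank 1 in degree 0, and the first
   kernel is the annihilator of [e]. *)
have gr0 : graded_submod (fun _ : 'I_1 => 0) (fun u : 'rV[R]_1 => u 0 0 *: e = 0).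
  split; last by move=> t u hu; rewrite mxE e_ann.
  split; first by rewrite mxE scale0r.
    by move=> u v hu hv; rewrite mxE scalerDl hu hv addr0.
  by move=> a u hu; rewrite mxE -scalerA hu scaler0.
have min0 (u : 'rV[R]_1) : u 0 0 *: e = 0 -> forall k, (u 0 k)@_0%MM = 0.
  by move=> hu k; rewrite ord1 e_min.
pose N0 := SyzygyStage gr0 min0.
pose next (N : syzygy_stage) := projT1 (cid (syzygy_step N)).
pose dif (N : syzygy_stage) : 'M[R]_(sz_rank (next N), sz_rank N) :=
  projT1 (cid (projT2 (cid (syzygy_step N)))).
have difP N : [/\ mhom w (@sz_shift (next N)) (@sz_shift N) (dif N),
      (forall u, sz_set u <-> exists v, u = v *m dif N)
    & (forall v, @sz_set (next N) v <-> v *m dif N = 0)].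
  exact: (projT2 (cid (projT2 (cid (syzygy_step N))))).
pose st := fix st i := match i with 0%N => N0 | j.+1 => next (st j) end.
have d_set i k : sz_set (row k (dif (st i))).
  by case: (difP (st i)) => _ h _; apply/h; exists (delta_mx 0 k); rewrite -rowE.
split; apply: (@MinGradedRes _ _ _ w M comp (fun i => sz_rank (st i))
  (fun i => @sz_shift (st i)) (fun _ : 'I_(sz_rank (st 0%N)) => e)
  (fun i => dif (st i))) => //=.
- by move=> i k l; case: (difP (st i)) => h _ _; apply: h.
- move=> x; have [p ->] := e_gen x; exists (\row__ p).
  by rewrite big_ord1 mxE.
- move=> u; rewrite big_ord1; case: (difP N0) => _ h _; exact: h.
- move=> i u; case: (difP (st i)) => _ _ <-.
  by case: (difP (next (st i))) => _ h _; apply: h.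
move=> i k l; rewrite -[RHS](sz_min (d_set i k) l); by rewrite mxE.
Qed.

End MinimalResolution.

(** * Kernels of the presentations *)

Section Msum.
Variables (K : fieldType) (n : nat).
Implicit Types (p q : {mpoly K[n]}) (P : pred 'X_{1..n}).

(** The sum of the coefficients of [p] over the monomials in [P]. These linear functionals describe
    the kernels of both presentations. *)
Definition msum P p : K := (mpart P p).@[fun=> 1].

Lemma msum_is_zmod P : zmod_morphism (msum P).
Proof. by move=> p q; rewrite /msum raddfB /= mevalB. Qed.

HB.instance Definition _ P :=
  GRing.isZmodMorphism.Build {mpoly K[n]} K (msum P) (msum_is_zmod P).

Lemma msumZX P c m : msum P (c *: 'X_[m]) = if P m then c else 0.
Proof.
have -> : msum P (c *: 'X_[m]) = (if P m then c *: 'X_[m] else 0).@[fun=> 1].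
  congr (_.@[_]); apply/mpolyP => m'; rewrite mcoeff_mpart (fun_if (mcoeff m')).
  rewrite mcoeff0 mcoeffZ mcoeffX; case: eqP => [->//|_].
  by rewrite mulr0 !if_same.
case: ifP => _; last by rewrite meval0.
rewrite mevalZ mevalX big1 ?mulr1 // => i _; exact: expr1n.
Qed.

Lemma mpoly_additive_ext (V : zmodType) (f g : {mpoly K[n]} -> V) :
  {morph f : p q / p + q} -> {morph g : p q / p + q} ->
  (forall c m, f (c *: 'X_[m]) = g (c *: 'X_[m])) -> f =1 g.
Proof.
move=> fD gD h p.
have f0 : f 0 = 0 by apply: (addrI (f 0)); rewrite -fD !addr0.
have g0 : g 0 = 0 by apply: (addrI (g 0)); rewrite -gD !addr0.
rewrite (mpolyE p); elim: (msupp p) => [|m s IH]; first by rewrite !big_nil f0 g0.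
by rewrite !big_cons fD gD IH h.
Qed.

Lemma msumZ P c p : msum P (c *: p) = c * msum P p.
Proof.
apply: (@mpoly_additive_ext _ (fun p => msum P (c *: p)) (fun p => c * msum P p)) => [q r|q r|a m].
- by rewrite scalerDr raddfD.
- by rewrite raddfD mulrDr.
by rewrite scalerA !msumZX; case: ifP => // _; rewrite mulr0.
Qed.

Lemma eq_msum P Q p : {in msupp p, P =1 Q} -> msum P p = msum Q p.
Proof.
move=> h; congr (_.@[_]); apply/mpolyP => m; rewrite !mcoeff_mpart.
case: (boolP (m \in msupp p)) => [/h ->//|/memN_msupp_eq0 ->].
by rewrite !if_same.
Qed.

Lemma msum_pred0 P p : {in msupp p, forall m, P m = false} -> msum P p = 0.
Proof.
move=> h; rewrite (@eq_msum _ pred0) //; rewrite /msum.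
have -> : mpart pred0 p = 0 by apply/mpolyP => m; rewrite mcoeff_mpart mcoeff0.
exact: meval0.
Qed.

Lemma msum_pred1 m p : msum (pred1 m) p = p@_m.
Proof.
apply: (mpoly_additive_ext (f := msum (pred1 m)) (g := mcoeff m)) => [||c m'].
- exact: raddfD.
- exact: raddfD.
rewrite /= msumZX /= mcoeffZ mcoeffX; by case: eqP => _; rewrite ?mulr1 ?mulr0.
Qed.

End Msum.

Section Presentations.
Variables (K : fieldType) (k n : nat) (S : n.-tuple 'X_{1..k}).
Local Notation R := {mpoly K[n]}.
Local Notation gam := (wdeg (tnth S)).
Local Notation I := (@sgring_max K k n S).

Lemma mpolyX_wdeg (m : 'X_{1..n}) :
  'X_[gam m] = \prod_(i < n) 'X_[tnth S i] ^+ m i :> {mpoly K[k]}.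
Proof.
rewrite /wdeg; apply: (big_ind2 (fun (a : 'X_{1..k}) (p : {mpoly K[k]}) => 'X_[a] = p)).
- exact: mpolyX0.
- by move=> a p b q <- <-; rewrite -mpolyXD.
move=> i _; elim: (m i) => [|e IH]; first by rewrite mulr0n expr0 mpolyX0.
by rewrite mulrS exprS -IH -mpolyXD.
Qed.

Lemma val_sgring_presZX c m :
  val (@sgring_pres K k n S (c *: 'X_[m])) = c *: 'X_[gam m].
Proof.
rewrite /sgring_pres mmapZ mmapX /mmap1 mpolyX_wdeg.
rewrite -mul_mpolyC -alg_mpolyC rmorphM rmorph_prod /=; congr (_ * _).
by apply: eq_bigr => i _; exact: (rmorphXn \val).
Qed.

Lemma val_sgring_pres_coef p g :
  (val (@sgring_pres K k n S p))@_g = msum (fun m => gam m == g) p.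
Proof.
apply: (mpoly_additive_ext (f := fun p => (val (@sgring_pres K k n S p))@_g)
  (g := msum _)) => [p1 p2||c m].
- by rewrite (raddfD (@sgring_pres K k n S)) (raddfD \val) mcoeffD.
- exact: raddfD.
rewrite /= val_sgring_presZX msumZX mcoeffZ mcoeffX.
by case: eqP => _; rewrite ?mulr1 ?mulr0.
Qed.

(** All monomials in a fibre of [gam] have the same image, and different fibres have linearly
    independent images. *)
Lemma sgring_pres_eq0 p : @sgring_pres K k n S p = 0 <->
  forall g, msum (fun m => gam m == g) p = 0.
Proof.
split=> [e g|h]; first by rewrite -val_sgring_pres_coef e mcoeff0.
by apply: val_inj; apply/mpolyP => g; rewrite val_sgring_pres_coef h mcoeff0.
Qed.

Lemma semigroupP g : semigroup S g <-> exists m, gam m = g.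
Proof.
split=> [|[m <-]].
  elim=> [|a b /tnthP[j ->] _ [m <-]]; first by exists 0%MM; rewrite wdeg0.
  by exists (U_(j) + m)%MM; rewrite wdegD wdegU.
rewrite /wdeg; apply: (big_ind (semigroup S)); first by left.
  exact: semigroupD.
move=> i _; elim: (m i) => [|e IH]; first by rewrite mulr0n; left.
by rewrite mulrS; apply: semigroupD => //; apply: semigroup_mem; apply: mem_tnth.
Qed.

Lemma sgring_pres_surj x : exists p, x = @sgring_pres K k n S p.
Proof.
have /choice[f fP] g : exists m, g \in msupp (val x) -> gam m = g.
  have [gin|_] := boolP (g \in msupp (val x)); last by exists 0%MM.
  have /semigroupP[m mE] : semigroup S g.
    by have /sgring_predP := valP x; apply.
  by exists m.
exists (\sum_(g <- msupp (val x)) (val x)@_g *: 'X_[f g]).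
apply: val_inj; rewrite (raddf_sum (@sgring_pres K k n S)) (raddf_sum \val) /= [LHS]mpolyE.
by rewrite !big_seq; apply: eq_bigr => g gin; rewrite val_sgring_presZX fP.
Qed.

(** The condition for t^g to lie in the i-th power of the maximal ideal: g is a sum of at least i
    generators. *)
Definition in_power i g := exists m, gam m = g /\ (i <= mdeg m)%N.

Lemma ideal_powS (A : comPzRingType) (J : A -> Prop) i x :
  ideal_pow J i.+1 x -> ideal_pow J i x.
Proof.
elim: i x => // i IH x; apply: ideal_gen_mono => _ [y [z [Jy Jz ->]]].
by exists y, z; split=> //; apply: IH.
Qed.

Lemma ideal_pow_le (A : comPzRingType) (J : A -> Prop) i j x :
  (i <= j)%N -> ideal_pow J j x -> ideal_pow J i x.
Proof.
by move=> /subnKC <-; elim: (j - i)%N => [|e IH]; rewrite ?addn0 // addnS => /ideal_powS.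
Qed.

Lemma ideal_pow_sgring_presX m :
  ideal_pow I (mdeg m) (@sgring_pres K k n S 'X_[m]).
Proof.
have [d] := ubnP (mdeg m); elim: d m => // d IH m md.
have [m0|/eqP] := eqVneq m 0%MM; first by rewrite m0 mdeg0.
have [/existsP[i mi] _|/existsPn h m0] := boolP [exists i, m i != 0%N]; last first.
  by case: m0; apply/mnmP => i; have := h i; rewrite mnm0E negbK => /eqP.
have mE : m = (U_(i) + (m - U_(i)))%MM.
  by rewrite addmC submK // lep1mP.
have dE : mdeg m = (1 + mdeg (m - U_(i))%MM)%N by rewrite {1}mE mdegD mdeg1.
rewrite dE {2}mE mpolyXD rmorphM; apply: ideal_powM.
  apply: ideal_pow1; suff e : @sgring_pres K k n S 'X_i = sgring_gen K S i.
    by have := sgring_max_gen K S i; rewrite -e.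
  apply: val_inj; rewrite -['X_i]scale1r val_sgring_presZX.
  by rewrite scale1r wdegU.
by apply: IH; rewrite dE in md.
Qed.

Lemma sgring_powP i x : ideal_pow I i x <->
  forall g, g \in msupp (val x) -> in_power i g.
Proof.
have V0 (y : sgring K S) g : g \in msupp (val y) -> in_power 0 g.
  move=> gin; have /semigroupP[m mE] : semigroup S g.
    by have /sgring_predP := valP y; apply.
  by exists m.
have VM a b (y z : sgring K S) : (forall g, g \in msupp (val y) -> in_power a g) ->
    (forall g, g \in msupp (val z) -> in_power b g) ->
    forall g, g \in msupp (val (y * z)) -> in_power (a + b) g.
  move=> hy hz g /msuppM_le/allpairsP[[u v] /= [/hy[m [<- am]] /hz[m' [<- bm']] ->]].
  by exists (m + m')%MM; rewrite wdegD mdegD leq_add.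
have VD a (y z : sgring K S) : (forall g, g \in msupp (val y) -> in_power a g) ->
    (forall g, g \in msupp (val z) -> in_power a g) ->
    forall g, g \in msupp (val (y + z)) -> in_power a g.
  by move=> hy hz g /msuppD_le; rewrite mem_cat => /orP[/hy|/hz].
have V00 a g : g \in msupp (val (0 : sgring K S)) -> in_power a g by rewrite msupp0.
split.
  elim: i x => [x _|i IH x]; first exact: (V0).
  move: x; apply: ideal_gen_ind => [|y z|a _ [y [z [Iy Iz ->]]]]; first exact: (V00).
    exact: (VD).
  rewrite -[i.+1]add0n; apply: (VM); first exact: (V0).
  rewrite -add1n; apply: (VM); last exact: IH.
  move: y Iy; apply: ideal_gen_ind => [|y y'|b _ [j ->]]; first exact: (V00).
    exact: (VD).
  rewrite -[1%N]add0n; apply: (VM); first exact: (V0).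
  move=> g /=; rewrite msuppX inE => /eqP ->.
  by exists U_(j)%MM; rewrite wdegU mdeg1.
move=> hx; have /choice[f fP] g : exists m, g \in msupp (val x) -> gam m = g /\ (i <= mdeg m)%N.
  have [gin|_] := boolP (g \in msupp (val x)); last by exists 0%MM.
  by have [m mP] := hx g gin; exists m.
have -> : x = \sum_(g <- msupp (val x)) @sgring_pres K k n S ((val x)@_g *: 'X_[f g]).
  apply: val_inj; rewrite raddf_sum /= [LHS]mpolyE.
  by rewrite !big_seq; apply: eq_bigr => g gin; rewrite val_sgring_presZX; case: (fP g gin) => ->.
rewrite big_seq; apply: big_ind => [||g gin]; first exact: ideal_pow0.
  exact: ideal_powD.
rewrite -mul_mpolyC rmorphM; apply: ideal_powMl.
by apply: ideal_pow_le (ideal_pow_sgring_presX _); case: (fP g gin).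
Qed.

Lemma rees_pres_coef p i g :
  (val (rees_val (@rees_pres K k n S p))`_i)@_g =
  msum (fun m => (gam m == g) && (mdeg m == i)) p.
Proof.
have key c m : rees_val (@rees_pres K k n S (c *: 'X_[m])) =
    @sgring_pres K k n S (c *: 'X_[m]) *: 'X^(mdeg m).
  rewrite /rees_pres mmapZ mmapX /mmap1 /sgring_pres mmapZ mmapX /mmap1.
  have vprod : rees_val (\prod_(i < n) rees_gen (sgring_max_gen K S i) ^+ m i) =
      \prod_(i < n) sgring_gen K S i ^+ m i *: 'X^(mdeg m).
    rewrite [LHS](rmorph_prod \val) /= mdegE.
    apply: (big_ind3 (fun (x : {poly sgring K S}) y (z : nat) => x = y *: 'X^z)).
    - by rewrite scale1r.
    - by move=> x1 x2 x3 y1 y2 y3 -> ->; rewrite -scalerAl -scalerAr scalerA exprD.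
    by move=> j _; rewrite [LHS](rmorphXn \val) /= exprZn.
  rewrite [LHS](rmorphM \val) /= vprod.
  by rewrite mulr_algl scalerA.
apply: (mpoly_additive_ext (f := fun p => (val (rees_val (@rees_pres K k n S p))`_i)@_g)
  (g := msum _)) => [p1 p2||c m].
- rewrite (raddfD (@rees_pres K k n S)) -[rees_val _]/(val _) (raddfD \val) coefD.
  by rewrite (raddfD \val) mcoeffD.
- exact: raddfD.
rewrite msumZX /= key coefZ coefXn.
case: (eqVneq i (mdeg m)) => [_|ne].
  rewrite mulr1 val_sgring_presZX mcoeffZ mcoeffX andbT.
  by case: eqP => _; rewrite ?mulr1 ?mulr0.
by rewrite mulr0 mcoeff0 andbF.
Qed.

(** In degree i the coefficient of t^g counts only modulo m^(i+1), so only those g that are not sums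
    of more than i generators impose a condition. *)
Lemma gr_pres_eq0 p : @gr_pres K k n S p = 0 <->
  forall i g, ~ in_power i.+1 g -> msum (fun m => (gam m == g) && (mdeg m == i)) p = 0.
Proof.
have -> : (@gr_pres K k n S p = 0) <-> @rees_pres K k n S p \in @gr_pred _ I.
  rewrite /gr_pres /= -[X in _ = X <-> _](rmorph0 (@gr_class _ I)).
  by rewrite gr_classP subr0.
split=> [/gr_predP h i g ng|h].
  rewrite -rees_pres_coef; apply/eqP; rewrite mcoeff_eq0; apply/negP => gin.
  by case: ng; move/sgring_powP: (h i); apply.
apply/gr_predP => i; apply/sgring_powP => g.
rewrite mcoeff_msupp rees_pres_coef => ne.
by apply: contrapT => /h e; rewrite e eqxx in ne.
Qed.

End Presentations.

(** * Modules that are free over some of the variables *)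

Lemma big_kgrade (V : nmodType) T (hd : 'I_T -> nat) i (F : 'I_T -> V) :
  (forall t, hd t != i -> F t = 0) ->
  \sum_t F t = \sum_(s < #|[pred t | hd t == i]|) F (enum_val s).
Proof.
move=> hF; rewrite -big_enum_val [LHS](bigID [pred t | hd t == i]) /=.
by rewrite [X in _ + X]big1 ?addr0 // => t /hF.
Qed.

Section Model.
Variables (K : fieldType) (n r : nat) (M : lmodType {mpoly K[n]}).
Local Notation R := {mpoly K[n]}.
Variables (X : seq 'I_n) (b : 'I_r -> M) (xi : 'I_n -> 'M[R]_r).
Hypothesis X_uniq : uniq X.
Hypothesis xi_out : forall x, x \notin X -> xi x = 0.
Hypothesis xi_free : forall x y, y \in X -> mxdeg_lt y 1 (xi x).
Hypothesis b_rel : forall x l, x \in X -> 'X_x *: b l = \sum_m xi x l m *: b m.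
Hypothesis b_inj : forall u : 'rV[R]_r, (forall x, x \in X -> mxdeg_lt x 1 u) ->
  \sum_l u 0 l *: b l = 0 -> u = 0.

(** Both products express the action of X_x X_y on the basis by entries free of [X], and such
    expressions are unique by [b_inj]. Outside [X] the matrices are 0. *)
Lemma model_xi_comm x y : comm_mx (xi x) (xi y).
Proof.
have [xX|/xi_out ->] := boolP (x \in X); last by rewrite /comm_mx mul0mx mulmx0.
have [yX|/xi_out ->] := boolP (y \in X); last by rewrite /comm_mx mul0mx mulmx0.
have act z z' l : z \in X -> z' \in X ->
    \sum_m (xi z *m xi z') l m *: b m = ('X_z * 'X_z') *: b l.
  move=> zX z'X; rewrite mulrC -scalerA b_rel // scaler_sumr.
  transitivity (\sum_j xi z l j *: (\sum_m xi z' j m *: b m)).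
    under eq_bigr do rewrite mxE scaler_suml.
    rewrite exchange_big; apply: eq_bigr => j _; rewrite scaler_sumr.
    by apply: eq_bigr => m _; rewrite scalerA.
  by apply: eq_bigr => j _; rewrite -b_rel // !scalerA mulrC.
apply/eqP; rewrite -subr_eq0; apply/eqP/row_matrixP => l; rewrite row0.
apply: b_inj => [z zX i j|].
  rewrite mxE; apply: mxdeg_ltB; apply: (@mxdeg_ltM _ _ _ _ _ _ 1 1);
  exact: xi_free.
under eq_bigr do rewrite mxE mxE scalerDl.
rewrite big_split /= act //.
under [X in _ + X]eq_bigr do rewrite mxE scaleNr.
by rewrite sumrN act // mulrC subrr.
Qed.

Local Notation phi := (kphi xi).
Local Notation D := (kdiff xi X).
Local Notation hd := (@khd n r X).

Lemma model_phi_comm x y : comm_mx (phi x) (phi y).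
Proof.
rewrite /kphi; apply: comm_mxB; last apply: comm_mx_sym.
  by apply: comm_mx_scalar.
by apply: comm_mxB; [apply: comm_mx_scalar | apply: model_xi_comm].
Qed.

Lemma model_phi_aug x l : x \in X -> \sum_m phi x l m *: b m = 0.
Proof.
move=> xX; under eq_bigr do rewrite mxE mxE scalerDl.
rewrite big_split /=; under [X in _ + X]eq_bigr do rewrite mxE scaleNr.
rewrite sumrN -b_rel // (bigD1 l) //= eqxx mulr1n big1 ?addr0 ?subrr // => m ml.
by rewrite eq_sym (negPf ml) mulr0n scale0r.
Qed.

Lemma model_aug_diff i : \sum_j D i j *: kaug b j = 0.
Proof. by apply: kaug_kdiff => x l; apply: model_phi_aug. Qed.

Lemma model_aug_mulmx (v : 'rV_(ksize r X)) : \sum_j (v *m D) 0 j *: kaug b j = 0.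
Proof.
under eq_bigr do rewrite mxE scaler_suml.
rewrite exchange_big big1 // => i _.
under eq_bigr do rewrite -scalerA.
by rewrite -scaler_sumr model_aug_diff scaler0.
Qed.

(** The normal form of [kcycle] leaves a vector [w] free of [X]; the augmentation kills the
    boundary, so [w] is a relation on [b] and vanishes. *)
Lemma model_exact (u : 'rV_(ksize r X)) :
  u *m D = 0 -> \sum_j u 0 j *: kaug b j = 0 -> exists v, u = v *m D.
Proof.
move=> uD ua.
have [v [w [uE wX _]]] := @kcycle K n r xi (fun x => x \in X) X u xi_free model_xi_comm
  (introT allP (fun _ => id)) X_uniq uD.
exists v; suff w0 : w = 0.
  rewrite uE w0; suff -> : kinj X (0 : 'rV[R]_r) = 0 by rewrite addr0.
  by elim: (X) => //= x X' ->; rewrite row_mx0.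
apply: b_inj => //; rewrite -(kaug_kinj b X) -[RHS]ua uE.
under [RHS]eq_bigr do rewrite mxE scalerDl.
by rewrite big_split /= model_aug_mulmx add0r.
Qed.

(** Vectors in homological degree 0 are cycles, so [kcycle] also serves to eliminate the variables
    of [X] from coordinates. *)
Lemma model_free_gen (u : 'rV[R]_r) : exists w : 'rV[R]_r,
  (forall x, x \in X -> mxdeg_lt x 1 w) /\
  \sum_l u 0 l *: b l = \sum_l w 0 l *: b l.
Proof.
have uD : kinj X u *m D = 0.
  elim: (X) => [|x X' IH] /=; first by rewrite mulmx0.
  by rewrite mul_row_block IH !mul0mx mulmx0 !addr0 row_mx0.
have [v [w [uE wX _]]] := @kcycle K n r xi (fun x => x \in X) X _ xi_free model_xi_comm
  (introT allP (fun _ => id)) X_uniq uD.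
exists w; split=> //; rewrite -!(kaug_kinj b X) uE.
under eq_bigr do rewrite mxE scalerDl.
by rewrite big_split /= model_aug_mulmx add0r.
Qed.

(** The recursion on [X] yields one matrix for all homological degrees; here it is cut into the
    sequence of differentials that the comparison needs. *)
Definition kc_rank i := #|[pred t | hd t == i]|.
Definition kc_diff i : 'M[R]_(kc_rank i.+1, kc_rank i) :=
  mxsub enum_val enum_val D.
Definition kc_aug (s : 'I_(kc_rank 0)) : M := kaug b (enum_val s).

Lemma hd_enum_val i (s : 'I_(kc_rank i)) : hd (enum_val s) = i.
Proof. by have := enum_valP s => /eqP. Qed.

Lemma kc_complex : is_complex kc_diff kc_aug.
Proof.
case=> [|i] /=.
  move=> k; rewrite -[RHS](model_aug_diff (enum_val k)).
  rewrite (@big_kgrade _ _ hd 0%N); last first.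
    by move=> t ht; rewrite kaug_hd ?scaler0.
  by apply: eq_bigr => l _; rewrite mxE.
apply/matrixP => a c; rewrite mxE.
have DD := @kdiff_sqr _ _ _ xi X (fun x y _ _ => model_phi_comm x y).
transitivity ((D *m D) (enum_val a) (enum_val c)); last by rewrite DD !mxE.
rewrite mxE (@big_kgrade _ _ hd i.+1) => [|t ht].
  by apply: eq_bigr => s _; rewrite !mxE.
by rewrite kdiff_hd ?mul0r // hd_enum_val eqSS eq_sym.
Qed.

Lemma kc_exact : exact_complex kc_diff kc_aug.
Proof.
(* [U] is [u] extended by 0 to the other homological degrees. *)
move=> i u hu; pose U : 'rV_(ksize r X) := u *m rowsub enum_val 1%:M.
have Uev s : U 0 (enum_val s) = u 0 s.
  rewrite mxE (bigD1 s) //= !mxE eqxx mulr1 big1 ?addr0 // => s' s's.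
  by rewrite !mxE (inj_eq enum_val_inj) (negPf s's) mulr0.
have Uout t : hd t != i -> U 0 t = 0.
  move=> ht; rewrite mxE big1 // => s _; rewrite !mxE.
  case: (eqVneq (enum_val s) t) => [e|_]; last by rewrite mulr0.
  by move: ht; rewrite -e => /negP[]; apply/eqP/hd_enum_val.
have UD : U *m D = 0.
  apply/rowP => t; rewrite !mxE (@big_kgrade _ _ hd i); last first.
    by move=> t' /Uout ->; rewrite mul0r.
  under eq_bigr do rewrite Uev.
  case: i u hu {U Uev Uout} => [|i] u hu.
    by rewrite big1 // => s _; rewrite kdiff_hd ?mulr0 // hd_enum_val.
  have [ht|ht] := eqVneq (hd t) i; last first.
    by rewrite big1 // => s _; rewrite kdiff_hd ?mulr0 // hd_enum_val eqSS eq_sym.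
  have tin : t \in [pred t | hd t == i] by rewrite inE ht.
  transitivity ((u *m kc_diff i) 0 (enum_rank_in tin t)); last by rewrite hu mxE.
  by rewrite mxE; apply: eq_bigr => s _; rewrite !mxE enum_rankK_in.
have Ua : \sum_j U 0 j *: kaug b j = 0.
  case: i u hu U Uev Uout UD => [|i] u hu U Uev Uout UD; last first.
    rewrite big1 // => t _; have [ht|/Uout ->] := eqVneq (hd t) i.+1.
      by rewrite kaug_hd ?scaler0 // ht.
    by rewrite scale0r.
  rewrite (@big_kgrade _ _ hd 0%N) => [|t /Uout ->]; last by rewrite scale0r.
  by rewrite -[RHS](hu 0); apply: eq_bigr => s _; rewrite Uev.
have [V VE] := model_exact UD Ua.
exists (\row_s V 0 (enum_val s)); apply/rowP => s.
rewrite -Uev VE !mxE (@big_kgrade _ _ hd i.+1) => [|t ht].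
  by apply: eq_bigr => s' _; rewrite !mxE.
by rewrite kdiff_hd ?mulr0 // hd_enum_val.
Qed.

Section Graded.
Variables (Gr : nmodType) (w : 'I_n -> Gr) (sh : 'I_r -> Gr).
Hypothesis xi_hom : forall x l m, x \in X -> whomog w (xi x l m) (sh m) (w x + sh l).

Fixpoint kshift (Y : seq 'I_n) : 'I_(ksize r Y) -> Gr :=
  match Y with
  | [::] => sh
  | x :: Y' => fun i =>
      match split i with inl j => kshift j | inr j => w x + kshift j end
  end.

Lemma kshift_lshift x Y (j : 'I_(ksize r Y)) :
  @kshift (x :: Y) (lshift (ksize r Y) j) = kshift j.
Proof. by rewrite /= (unsplitK (inl j)). Qed.

Lemma kshift_rshift x Y (j : 'I_(ksize r Y)) :
  @kshift (x :: Y) (rshift (ksize r Y) j) = w x + kshift j.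
Proof. by rewrite /= (unsplitK (inr j)). Qed.

Lemma whomog0 g h : whomog w (0 : R) g h.
Proof. by move=> m; rewrite msupp0. Qed.

Lemma kdiag_hom Y (A : 'M[R]_r) t : (forall l m, whomog w (A l m) (sh m) (t + sh l)) ->
  forall i j : 'I_(ksize r Y), whomog w (kdiag Y A i j) (kshift j) (t + kshift i).
Proof.
move=> hA; elim: Y => [|x Y IH]; first exact: hA.
apply: ksplitP => i; apply: ksplitP => j; rewrite ?kshift_lshift ?kshift_rshift /=.
- by rewrite block_mxEul.
- by rewrite block_mxEur mxE; apply: whomog0.
- by rewrite block_mxEdl mxE; apply: whomog0.
rewrite block_mxEdr => m /IH.
by rewrite addrCA => ->; rewrite addrCA.
Qed.

Lemma kphi_hom x l m : x \in X -> whomog w (phi x l m) (sh m) (w x + sh l).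
Proof.
move=> xX m'; rewrite mxE => /msuppD_le; rewrite mem_cat => /orP[|]; last first.
  by rewrite mxE => h; apply: (whomogN (xi_hom (x := x) (l := l) (m := m) xX)).
rewrite mxE; case: eqP => [->|_]; last by rewrite mulr0n msupp0.
by rewrite mulr1n msuppX inE => /eqP ->; rewrite wdegU.
Qed.

Lemma kdiff_hom Y : {subset Y <= X} ->
  forall i j : 'I_(ksize r Y), whomog w (kdiff xi Y i j) (kshift j) (kshift i).
Proof.
elim: Y => [_ i j|x Y IH hY]; first by rewrite mxE; apply: whomog0.
have {}IH : forall i j : 'I_(ksize r Y), whomog w (kdiff xi Y i j) (kshift j) (kshift i).
  by apply: IH => y yY; apply: hY; rewrite inE yY orbT.
apply: ksplitP => i; apply: ksplitP => j; rewrite ?kshift_lshift ?kshift_rshift /=.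
- by rewrite block_mxEul.
- by rewrite block_mxEur mxE; apply: whomog0.
- rewrite block_mxEdl; apply: kdiag_hom => l m; apply: kphi_hom.
  by apply: hY; rewrite mem_head.
rewrite block_mxEdr mxE => m /(whomogN (IH _ _)) e.
by rewrite addrCA e.
Qed.

Definition kc_shift i (s : 'I_(kc_rank i)) : Gr := kshift (enum_val s).

Lemma kc_diff_hom i : mhom w (@kc_shift i.+1) (@kc_shift i) (kc_diff i).
Proof. by move=> k l; rewrite mxE; apply: kdiff_hom. Qed.

Lemma kshift_ktop Y l : kshift (ktop Y l) = \sum_(x <- Y) w x + sh l.
Proof.
elim: Y => [|x Y IH]; first by rewrite big_nil add0r.
by rewrite kshift_rshift IH big_cons addrA.
Qed.

End Graded.
End Model.

Lemma wdeg_one n (m : 'X_{1..n}) : wdeg (fun=> 1%N) m = mdeg m.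
Proof.
rewrite /wdeg mdegE; apply: eq_bigr => j _.
by elim: (m j) => [|e IH]; rewrite ?mulr0n // mulrS IH.
Qed.

Lemma msum_mpart (K : fieldType) n P Q (p : {mpoly K[n]}) :
  msum P (mpart Q p) = msum (fun m => P m && Q m) p.
Proof.
congr (_.@[_]); apply/mpolyP => m; rewrite !mcoeff_mpart.
by case: (P m); case: (Q m).
Qed.

Section PresentationsGraded.
Variables (K : fieldType) (k n : nat) (S : n.-tuple 'X_{1..k}).
Local Notation R := {mpoly K[n]}.
Local Notation gam := (wdeg (tnth S)).
Local Notation I := (@sgring_max K k n S).
Local Notation pdeg i := (mpart (fun m : 'X_{1..n} => mdeg m == i)).

Lemma rees_pres_coefE p i :
  (rees_val (@rees_pres K k n S p))`_i = @sgring_pres K k n S (pdeg i p).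
Proof.
apply: val_inj; apply/mpolyP => g.
by rewrite rees_pres_coef val_sgring_pres_coef msum_mpart.
Qed.

(** Each t^g in [x] is a product of at least i generators; those given as products of exactly i of
    them make up [q], and the others lie in m^(i+1). *)
Lemma sgring_pow_lift i x : ideal_pow I i x -> exists q : R,
  (forall m, m \in msupp q -> mdeg m = i) /\ ideal_pow I i.+1 (x - @sgring_pres K k n S q).
Proof.
move=> /sgring_powP hx; have /choice[f fP] g : exists m, g \in msupp (val x) -> gam m = g /\ (i <= mdeg m)%N.
  have [gin|_] := boolP (g \in msupp (val x)); last by exists 0%MM.
  by have [m mP] := hx g gin; exists m.
have xE : x = \sum_(g <- msupp (val x)) @sgring_pres K k n S ((val x)@_g *: 'X_[f g]).
  apply: val_inj; rewrite (raddf_sum \val) /= [LHS]mpolyE.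
  by rewrite !big_seq; apply: eq_bigr => g gin; rewrite val_sgring_presZX; case: (fP g gin) => ->.
exists (\sum_(g <- msupp (val x) | mdeg (f g) == i) (val x)@_g *: 'X_[f g]); split.
  move=> m /msupp_sum_le /flattenP[s /mapP[g]]; rewrite mem_filter => /andP[/eqP <- _] ->.
  by move=> /msuppZ_le; rewrite msuppX inE => /eqP ->.
rewrite (raddf_sum (@sgring_pres K k n S)) {1}xE (bigID (fun g => mdeg (f g) == i)) /=.
rewrite [X in X - _]addrC addrK big_seq_cond.
apply: big_ind => [||g /andP[gin ne]]; first exact: ideal_pow0.
  exact: ideal_powD.
rewrite -mul_mpolyC rmorphM; apply: ideal_powMl.
apply: (@ideal_pow_le _ _ _ (mdeg (f g))); last exact: ideal_pow_sgring_presX.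
by case: (fP g gin) => _; rewrite leq_eqVlt eq_sym (negPf ne).
Qed.

Lemma gr_class_eq_pres (p : rees I) q :
  (forall i, ideal_pow I i.+1 ((val p)`_i - @sgring_pres K k n S (pdeg i q))) ->
  gr_class p = @gr_pres K k n S q.
Proof.
move=> h; apply/gr_classP/gr_predP => i.
by rewrite -[rees_val _]/(val _) (raddfB \val) coefB /= rees_pres_coefE; apply: h.
Qed.

Lemma pdeg_id i (q : R) : (forall m, m \in msupp q -> mdeg m = i) ->
  forall j, pdeg j q = if j == i then q else 0.
Proof.
move=> hq j; apply/mpolyP => m; rewrite mcoeff_mpart.
case: (boolP (m \in msupp q)) => [/hq mi|/memN_msupp_eq0 m0].
  by rewrite mi eq_sym; case: ifP => _; rewrite ?mcoeff0.
by rewrite m0 if_same; case: ifP => _; rewrite ?mcoeff0.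
Qed.

Lemma gr_pres_surj x : exists q, x = @gr_pres K k n S q.
Proof.
rewrite -[x]gr_reprK; set p := gr_repr x.
have /reesP hp := valP p.
have /choice[q qP] i := sgring_pow_lift (hp i).
exists (\sum_(i < size (val p)) q i); apply: gr_class_eq_pres => i.
suff -> : pdeg i (\sum_(j < size (val p)) q j) = if (i < size (val p))%N then q i else 0.
  case: ltnP => [_|hi]; first exact: (qP i).2.
  by rewrite nth_default // (raddf0 (@sgring_pres K k n S)) subr0; apply: ideal_pow0.
rewrite raddf_sum /=; under eq_bigr => j _ do rewrite (pdeg_id (qP j).1).
case: ltnP => hi.
  rewrite (bigD1 (Ordinal hi)) //= eqxx big1 ?addr0 // => j ji.
  by case: eqP => // e; case/eqP: ji; apply: val_inj.
by rewrite big1 // => j _; case: eqP => // e; move: hi; rewrite e leqNgt ltn_ord.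
Qed.

Lemma gr_comp_lift i x : gr_comp i x -> exists q : R,
  (forall m, m \in msupp q -> mdeg m = i) /\ x = @gr_pres K k n S q.
Proof.
move=> [p [[c cE] ->]]; have /reesP/(_ i) := valP p.
rewrite cE coefZ coefXn eqxx mulr1 => /sgring_pow_lift[q [qi qc]].
exists q; split=> //; apply: gr_class_eq_pres => j.
rewrite cE coefZ coefXn (pdeg_id qi); case: eqP => [->|_]; first by rewrite mulr1.
by rewrite mulr0 (raddf0 (@sgring_pres K k n S)) subr0; apply: ideal_pow0.
Qed.

Lemma gr_comp_one : gr_comp 0 (@gr_pres K k n S 1).
Proof.
exists 1; split; last by rewrite rmorph1 -[RHS](rmorph1 (@gr_class _ I)).
by exists 1; rewrite scale1r expr0.
Qed.

Lemma gr_pres_hpart (p : R) i :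
  @gr_pres K k n S p = 0 -> @gr_pres K k n S (hpart (fun=> 1%N) 0%N i p) = 0.
Proof.
move/gr_pres_eq0 => h; apply/gr_pres_eq0 => j g ng.
rewrite msum_mpart; have [ij|ij] := eqVneq i j.
  rewrite -[RHS](h j g ng); apply: eq_msum => m _ /=.
  by rewrite addr0 wdeg_one ij; case: (mdeg m == j); rewrite ?andbF ?andbT.
apply: msum_pred0 => m _; rewrite addr0 wdeg_one.
by apply/negP => /andP[/andP[_ /eqP ->]]; rewrite eq_sym (negPf ij).
Qed.

Lemma sgring_pres_hpart (p : R) g :
  @sgring_pres K k n S p = 0 -> @sgring_pres K k n S (hpart (tnth S) 0 g p) = 0.
Proof.
move/sgring_pres_eq0 => h; apply/sgring_pres_eq0 => g'.
rewrite msum_mpart; have [gg|gg] := eqVneq g' g.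
  rewrite -[RHS](h g'); apply: eq_msum => m _ /=.
  by rewrite addr0 gg andbb.
apply: msum_pred0 => m _; rewrite addr0.
by apply/negP => /andP[/eqP -> ]; rewrite (negPf gg).
Qed.

End PresentationsGraded.

(** * The join of two arithmetic sequences *)

Section Wsum.
Variables (N n : nat) (v : 'I_n.+1 -> 'I_N).
Implicit Types (f : nat -> nat) (m : 'X_{1..N}).

Definition wsum f m : nat := (\sum_(i < n.+1) f i * m (v i))%N.

Lemma wsumD f m m' : wsum f (m + m')%MM = (wsum f m + wsum f m')%N.
Proof. by rewrite /wsum -big_split; apply: eq_bigr => i _; rewrite mnmDE mulnDr. Qed.

Lemma wsumMn f m e : wsum f (m *+ e)%MM = (wsum f m * e)%N.
Proof. by rewrite /wsum big_distrl; apply: eq_bigr => i _; rewrite mulmnE mulnA. Qed.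

Lemma wsumU f i : injective v -> wsum f U_(v i)%MM = f i.
Proof.
move=> vinj; rewrite /wsum (bigD1 i) //= mnm1E eqxx muln1 big1 ?addn0 // => j ji.
by rewrite mnm1E (inj_eq vinj) eq_sym (negPf ji) muln0.
Qed.

Lemma wsumU0 f j : (forall i, v i != j) -> wsum f U_(j)%MM = 0%N.
Proof.
by move=> vj; rewrite /wsum big1 // => i _; rewrite mnm1E eq_sym (negPf (vj i)) muln0.
Qed.

(* The element h a + i d of an arithmetic sequence (a itself for i = 0) has
   coordinates [wA h i] and [i] along a and d. *)
Definition wA h i := if i == 0%N then 1%N else h.
(** As weights, [wE] counts the factors equal to a and [wC] the other ones; the degree is the sum of
    the two counts, whereas the coordinate along a weights the second by h. *)
Definition wC i : nat := (0 < i)%N.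
Definition wE i : nat := (i == 0)%N.

Lemma wsumA h m : wsum (wA h) m = (wsum wE m + h * wsum wC m)%N.
Proof.
rewrite /wsum big_distrr -big_split; apply: eq_bigr => i _.
by rewrite /wA /wE /wC; case: (val i) => [|j] /=; lia.
Qed.

Lemma wsum_leC m : (wsum id m <= n * wsum wC m)%N.
Proof.
rewrite /wsum big_distrr; apply: leq_sum => i _.
rewrite /wC; have := ltn_ord i; case: (val i) => [|j] jn //=.
by rewrite mul1n leq_mul2r -ltnS jn orbT.
Qed.

Lemma wsum_deg m : (wsum (fun=> 1%N) m = wsum wE m + wsum wC m)%N.
Proof.
by rewrite /wsum -big_split; apply: eq_bigr => i _; rewrite /wE /wC; case: (val i) => [|j] /=; lia.
Qed.

(** Standard form in one factor: the inner variables occur exactly as in e_k, while the exponents of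
    the two outer variables are arbitrary. *)
Definition fstd (k : nat) m :=
  forall i : 'I_n.+1, (0 < i < n)%N -> m (v i) = ((0 < k) && (i == k :> nat))%N.

Lemma wsum_fstd f k m : (k < n)%N -> f 0%N = 0%N -> fstd k m ->
  wsum f m = (f n * m (v ord_max) + f k)%N.
Proof.
move=> kn f0 hm; rewrite /wsum (bigD1 ord_max) //=; congr (_ + _)%N.
have [k0|k0] := posnP k.
  rewrite k0 f0 big1 // => i ni; have [->|i0] := posnP i; first by rewrite f0.
  rewrite hm ?k0 ?muln0 // i0 /= ltn_neqAle -ltnS ltn_ord andbT.
  by apply: contraNneq ni => e; apply/eqP/val_inj.
have kn' : (k < n.+1)%N by apply: ltnW.
rewrite (bigD1 (Ordinal kn')) /=; last first.
  by apply/eqP => /(congr1 val) /= e; move: kn; rewrite e ltnn.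
rewrite hm /= ?k0 ?kn // eqxx muln1 big1 ?addn0 // => i /andP[ni ki].
have [->|i0] := posnP i; first by rewrite f0.
rewrite hm; last first.
  rewrite i0 /= ltn_neqAle -ltnS ltn_ord andbT.
  by apply: contraNneq ni => e; apply/eqP/val_inj.
have -> : (i == k :> nat) = false by apply: contraNF ki => /eqP e; apply/eqP/val_inj.
by rewrite andbF muln0.
Qed.

Lemma wsumE0 m : wsum wE m = m (v ord0).
Proof.
rewrite /wsum (bigD1 ord0) //= mul1n big1 ?addn0 // => i i0.
by rewrite /wE (_ : (i == 0 :> nat) = false) //; apply: contraNF i0 => /eqP e; apply/eqP/val_inj.
Qed.

(** The coordinate along d is n times the exponent of the last variable plus k, so division by n
    recovers both; the coordinate along a then gives the first exponent. *)
Lemma fstd_unique h k k' m m' : (k < n)%N -> (k' < n)%N -> fstd k m -> fstd k' m' ->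
  wsum (wA h) m = wsum (wA h) m' -> wsum id m = wsum id m' ->
  k = k' /\ forall i, m (v i) = m' (v i).
Proof.
move=> kn kn' hm hm' eA eD.
move: eD; rewrite (wsum_fstd kn _ hm) // (wsum_fstd kn' _ hm') // ![(n * _)%N]mulnC => eD.
have n0 : (0 < n)%N by lia.
have ek : k = k' by have := congr1 (modn^~ n) eD; rewrite !modnMDl !modn_small.
have em : m (v ord_max) = m' (v ord_max).
  have := congr1 (divn^~ n) eD; rewrite !divnMDl // !divn_small // !addn0 //.
split=> // i.
have [i0|i0] := posnP i; last first.
  have [iN|ni] := ltnP i n; first by rewrite hm ?hm' ?ek // i0 iN.
  have -> : i = ord_max by apply: val_inj; apply/eqP; rewrite eqn_leq ni -ltnS ltn_ord.
  exact: em.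
move: eA; rewrite (wsumA h m) (wsumA h m') (wsum_fstd (f := wC) kn _ hm) // (wsum_fstd (f := wC) kn' _ hm') // em ek.
rewrite !wsumE0 => /eqP; rewrite eqn_add2r => /eqP.
by have -> : i = ord0 by apply: val_inj.
Qed.

(** With E + h C fixed and h positive, the degree E + C is largest when C is smallest. The
    coordinate along d is at most n C, and a standard monomial attains the resulting lower bound on
    C. *)
Lemma fstd_max h k m m' : (0 < h)%N -> (k < n)%N -> fstd k m ->
  wsum (wA h) m' = wsum (wA h) m -> wsum id m' = wsum id m ->
  (wsum wE m' + wsum wC m' <= wsum wE m + wsum wC m)%N.
Proof.
move=> h0 kn hm; rewrite (wsumA h m) (wsumA h m') => eA eD.
have : (wsum wC m <= wsum wC m')%N.
  have := wsum_leC m'; rewrite eD !(wsum_fstd kn _ hm) //= /wC.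
  have -> : (0 < n)%N by lia.
  rewrite mul1n; case: k kn {hm eD} => [|k] kn /=.
    by rewrite !addn0 leq_mul2l => /orP[/eqP|//]; lia.
  move=> le; rewrite addn1 -(ltn_pmul2l (m := n)); last by lia.
  by apply: leq_trans le; rewrite addnS ltnS leq_addr.
nia.
Qed.

End Wsum.

Lemma tnth_arith_gens k h n (a d : 'X_{1..k}) (i : 'I_n.+1) :
  tnth (arith_gens h n a d) i = a *+ wA h i + d *+ i.
Proof.
have [j ->|->] := unliftP ord0 i; last by rewrite tnth0 /wA /= mulr1n mulr0n addr0.
by rewrite tnthS tnth_mktuple.
Qed.

Lemma mnm_natmulE k (a : 'X_{1..k}) e t : (a *+ e) t = (a t * e)%N.
Proof.
elim: e => [|e IH]; first by rewrite mulr0n muln0; exact: mnm0E.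
by rewrite mulrS mulnS -IH; exact: mnmDE.
Qed.

Section Join.
Variables (k h n1 n2 : nat) (a1 d1 a2 d2 : 'X_{1..k}).
Hypotheses (hh : (0 < h)%N) (hn1 : (1 < n1)%N) (hn2 : (1 < n2)%N).
Hypothesis hind : lin_indep_Q [tuple a1; d1; a2; d2].

Local Notation N := (n1.+1 + n2.+1)%N.
Local Notation S := (join_gens h n1 n2 a1 d1 a2 d2).
Local Notation gam := (wdeg (tnth S)).
Local Notation v1 := (@lshift n1.+1 n2.+1).
Local Notation v2 := (@rshift n1.+1 n2.+1).
Implicit Types (m : 'X_{1..N}).

Lemma join_wdeg m : gam m = a1 *+ wsum v1 (wA h) m + d1 *+ wsum v1 id m
  + (a2 *+ wsum v2 (wA h) m + d2 *+ wsum v2 id m).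
Proof.
have fac n (a d : 'X_{1..k}) (v : 'I_n.+1 -> 'I_N) :
    \sum_(i < n.+1) (a *+ wA h i + d *+ i) *+ m (v i)
    = a *+ wsum v (wA h) m + d *+ wsum v id m.
  rewrite /wsum -!sumrMnr -big_split /=; apply: eq_bigr => i _.
  by rewrite mulrnDl -!mulrnA.
rewrite /wdeg big_split_ord -!fac /=; congr (_ + _); apply: eq_bigr => i _.
  by rewrite tnth_lshift tnth_arith_gens.
by rewrite tnth_rshift tnth_arith_gens.
Qed.

Definition same_key m m' :=
  [/\ wsum v1 (wA h) m = wsum v1 (wA h) m', wsum v1 id m = wsum v1 id m',
      wsum v2 (wA h) m = wsum v2 (wA h) m' & wsum v2 id m = wsum v2 id m'].

(** The four weighted sums are the coordinates along a1, d1, a2, d2, which linear independence over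
    the rationals makes unique. *)
Lemma gam_key m m' : gam m = gam m' <-> same_key m m'.
Proof.
split=> [|[e1 e2 e3 e4]]; last by rewrite !join_wdeg e1 e2 e3 e4.
rewrite !join_wdeg => e.
pose A := \matrix_(i < 4, j < k) (tnth [tuple a1; d1; a2; d2] i j)%:R : 'M[rat]_(4, k).
pose c m : 4.-tuple nat := [tuple wsum v1 (wA h) m; wsum v1 id m;
  wsum v2 (wA h) m; wsum v2 id m].
pose x m : 'rV[rat]_4 := \row_i (tnth (c m) i)%:R.
have xA m0 : x m0 *m A = \row_j (fun_of_multinom (a1 *+ wsum v1 (wA h) m0 + d1 *+ wsum v1 id m0
    + (a2 *+ wsum v2 (wA h) m0 + d2 *+ wsum v2 id m0)) j)%:R.
  apply/rowP => j; rewrite !mxE !big_ord_recl big_ord0 !mxE /= !(tnth_nth 0) /=.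
  have -> : fun_of_multinom (a1 *+ wsum v1 (wA h) m0 + d1 *+ wsum v1 id m0
      + (a2 *+ wsum v2 (wA h) m0 + d2 *+ wsum v2 id m0)) j
      = (a1 j * wsum v1 (wA h) m0 + d1 j * wsum v1 id m0
      + (a2 j * wsum v2 (wA h) m0 + d2 j * wsum v2 id m0))%N.
    by rewrite -!mnm_natmulE -!mnmDE.
  by rewrite !natrD !natrM; ring.
have : (x m - x m') *m A == 0.
  rewrite mulmxBl subr_eq0 !xA; apply/eqP/rowP => j; rewrite !mxE.
  by congr (_%:R); exact: (congr1 (fun a : 'X_{1..k} => a j) e).
rewrite (mulmx_free_eq0 _ hind) subr_eq0 => /eqP ex.
have ei i : tnth (c m) i = tnth (c m') i.
  have := congr1 (fun A : 'rV[rat]_4 => A 0 i) ex; rewrite !mxE => /eqP.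
  by rewrite Num.Theory.eqr_nat => /eqP.
split.
- exact: (ei ord0).
- exact: (ei (lift ord0 ord0)).
- exact: (ei (lift ord0 (lift ord0 ord0))).
exact: (ei ord_max).
Qed.

Lemma mdeg_join m : mdeg m =
  ((wsum v1 wE m + wsum v1 wC m) + (wsum v2 wE m + wsum v2 wC m))%N.
Proof.
rewrite mdegE big_split_ord -!wsum_deg; congr (_ + _)%N;
by apply: eq_bigr => i _; rewrite mul1n.
Qed.

Definition join_basis : finType := ('I_n1 * 'I_n2)%type.
Implicit Types (b : join_basis).

(** The exponent of e_i; the multiplicity [(0 < i)] makes index 0 stand for 1 and not for the
    variable of a. *)
Definition fmon n (v : 'I_n.+1 -> 'I_N) (i : 'I_n) : 'X_{1..N} :=
  (U_(v (widen_ord (leqnSn n) i)) *+ (0 < i))%MM.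

Definition bmon b : 'X_{1..N} := (fmon v1 b.1 + fmon v2 b.2)%MM.

Definition join_X : seq 'I_N :=
  [seq v1 i | i : 'I_n1.+1 <- enum 'I_n1.+1 & (0 < i < n1)%N] ++
  [seq v2 i | i : 'I_n2.+1 <- enum 'I_n2.+1 & (0 < i < n2)%N].

Lemma v1_inj : injective v1. Proof. exact: lshift_inj. Qed.
Lemma v2_inj : injective v2. Proof. exact: rshift_inj. Qed.
Lemma v12 i j : v1 i != v2 j. Proof. by rewrite eq_lrshift. Qed.
Lemma v21 i j : v2 i != v1 j. Proof. by rewrite eq_rlshift. Qed.

Lemma mem_join_X1 i : (v1 i \in join_X) = (0 < i < n1)%N.
Proof.
rewrite mem_cat (mem_map v1_inj) mem_filter mem_enum andbT.
case: (X in _ || X) / mapP => [[j _ /eqP]|_]; last by rewrite orbF.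
by rewrite (negPf (v12 _ _)).
Qed.

Lemma mem_join_X2 i : (v2 i \in join_X) = (0 < i < n2)%N.
Proof.
rewrite mem_cat (mem_map v2_inj) mem_filter mem_enum andbT.
case: (X in X || _) / mapP => [[j _ /eqP]|_] //.
by rewrite (negPf (v21 _ _)).
Qed.

Lemma join_X_uniq : uniq join_X.
Proof.
rewrite cat_uniq; apply/and3P; split.
- by rewrite (map_inj_uniq v1_inj) filter_uniq ?enum_uniq.
- apply/hasPn => x /mapP[i _ ->]; apply/mapP => [[j _ /eqP]].
  by rewrite (negPf (v21 _ _)).
by rewrite (map_inj_uniq v2_inj) filter_uniq ?enum_uniq.
Qed.

Definition Zmon m := forall x, x \in join_X -> m x = 0%N.

Lemma fstd1 z b : Zmon z -> fstd v1 b.1 (z + bmon b)%MM.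
Proof.
move=> hz i hi; rewrite !mnmDE hz ?mem_join_X1 // add0n !mulmnE !mnm1E.
rewrite (negPf (v21 _ _)) mul0n addn0 (inj_eq v1_inj) -val_eqE /= eq_sym.
by rewrite mulnC; case: (0 < _)%N; case: eqP.
Qed.

Lemma fstd2 z b : Zmon z -> fstd v2 b.2 (z + bmon b)%MM.
Proof.
move=> hz i hi; rewrite !mnmDE hz ?mem_join_X2 // add0n !mulmnE !mnm1E.
rewrite (negPf (v12 _ _)) mul0n add0n (inj_eq v2_inj) -val_eqE /= eq_sym.
by rewrite mulnC; case: (0 < _)%N; case: eqP.
Qed.

Lemma join_unique z z' b b' : Zmon z -> Zmon z' ->
  gam (z + bmon b)%MM = gam (z' + bmon b')%MM -> z = z' /\ b = b'.
Proof.
move=> hz hz' /gam_key[e1 e2 e3 e4].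
have [eb1 em1] := fstd_unique (ltn_ord _) (ltn_ord _) (fstd1 b hz) (fstd1 b' hz') e1 e2.
have [eb2 em2] := fstd_unique (ltn_ord _) (ltn_ord _) (fstd2 b hz) (fstd2 b' hz') e3 e4.
have bb : b = b'.
  by case: (b) (b') eb1 eb2 => [x y] [x' y'] /= ex ey; congr pair; apply: val_inj.
split=> //; move: em1 em2; rewrite bb => em1 em2.
apply/mnmP => i; rewrite -[i]splitK; case: (split i) => j /=.
  by have := em1 j; rewrite !mnmDE => /eqP; rewrite eqn_add2r => /eqP.
by have := em2 j; rewrite !mnmDE => /eqP; rewrite eqn_add2r => /eqP.
Qed.

(** This keeps the classes of standard monomials nonzero in the associated graded ring and makes
    [pr_ker] applicable to their fibres. *)
Lemma join_max z b m : Zmon z -> gam m = gam (z + bmon b)%MM ->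
  (mdeg m <= mdeg (z + bmon b)%MM)%N.
Proof.
move=> hz /gam_key[e1 e2 e3 e4]; rewrite !mdeg_join leq_add //.
  exact: fstd_max (fstd1 b hz) e1 e2.
exact: fstd_max (fstd2 b hz) e3 e4.
Qed.

(* With e_0 = 1 and e_l = x_l for 0 < l < n, the multiplication by x_i, 0 < i < n,
   is given on one factor by x_i e_0 = e_i and, for l > 0, by
   x_i e_l = x_0^h e_(i+l) if i + l < n, x_0^h x_n e_0 if i + l = n, and
   x_n e_(i+l-n) if i + l > n. The factor x_0^h raises the degree if h > 1, so that
   in the associated graded ring these products vanish. *)
Definition fdead n i (l : 'I_n) := (0 < l)%N && (i + l <= n)%N.

Definition fmu n (v : 'I_n.+1 -> 'I_N) i (l : 'I_n) : 'X_{1..N} :=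
  (U_(v ord0) *+ (h * fdead i l) + U_(v ord_max) *+ (n <= i + l))%MM.

Definition fnext n i (l : 'I_n) : 'I_n :=
  Ordinal (ltn_pmod (i + l) (leq_ltn_trans (leq0n l) (ltn_ord l))).

Lemma fact_wsum n (v : 'I_n.+1 -> 'I_N) f (i : 'I_n.+1) (l : 'I_n) :
  injective v ->
  wsum v f (U_(v i) + fmon v l)%MM = (f i + f l * (0 < l))%N /\
  wsum v f (fmu v i l + fmon v (fnext i l))%MM =
    (f 0 * (h * fdead i l) + f n * (n <= i + l) +
     f ((i + l) %% n) * (0 < (i + l) %% n))%N.
Proof. by move=> vi; rewrite !wsumD !wsumMn !wsumU. Qed.

Lemma modn_lt2 n i j : (i < n)%N -> (j < n)%N ->
  ((i + j) %% n = if (i + j < n)%N then i + j else i + j - n)%N.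
Proof.
move=> hi hj; case: ltnP => hij; first by rewrite modn_small.
by rewrite -{1}(subnK hij) modnDr modn_small //; lia.
Qed.

Lemma fact_key n (v : 'I_n.+1 -> 'I_N) (i : 'I_n.+1) (l : 'I_n) :
  injective v -> (0 < i < n)%N ->
  wsum v (wA h) (U_(v i) + fmon v l)%MM
    = wsum v (wA h) (fmu v i l + fmon v (fnext i l))%MM /\
  wsum v id (U_(v i) + fmon v l)%MM = wsum v id (fmu v i l + fmon v (fnext i l))%MM.
Proof.
move=> vi /andP[i0 iN]; have [-> ->] := fact_wsum (wA h) i l vi.
have [-> ->] := fact_wsum id i l vi; rewrite /wA /fdead (modn_lt2 iN (ltn_ord l)).
have ln := ltn_ord l; case: (val l) ln => [|l'] ln /=; case: (val i) i0 iN => [|i'] //= _ iN.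
  by rewrite !addn0 iN /= leqNgt iN /= !muln0 !muln1; split; lia.
case: n v i l vi ln iN => [|n'] // v i l vi ln iN.
case: (ltngtP (i'.+1 + l'.+1) n'.+1) => hc /=.
- by split; lia.
- have -> : (i'.+1 + l'.+1 - n'.+1 = (i' + l' - n').+1)%N by lia.
  by rewrite /=; split; lia.
by rewrite hc subnn /=; split; lia.
Qed.

Lemma fact_deg n (v : 'I_n.+1 -> 'I_N) (i : 'I_n.+1) (l : 'I_n) :
  injective v -> (0 < i < n)%N ->
  let d1 := wsum v (fun=> 1%N) (U_(v i) + fmon v l)%MM in
  let d2 := wsum v (fun=> 1%N) (fmu v i l + fmon v (fnext i l))%MM in
  if (1 < h)%N && fdead i l then (d1 < d2)%N else d1 == d2.
Proof.
move=> vi /andP[i0 iN]; have [-> ->] := fact_wsum (fun=> 1%N) i l vi.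
rewrite /fdead (modn_lt2 iN (ltn_ord l)) !mul1n.
have ln := ltn_ord l; case: (val l) ln => [|l'] ln /=; case: (val i) i0 iN => [|i'] //= _ iN.
  by rewrite andbF !addn0 iN /= leqNgt iN /= !muln0; lia.
case: (ltngtP (i'.+1 + l'.+1) n) => hc /=.
- by rewrite andbT muln1; case: ltnP => h1 /=; lia.
- rewrite andbF; have -> : (0 < i'.+1 + l'.+1 - n)%N by lia.
  by lia.
by rewrite andbT muln1; rewrite hc subnn /=; case: ltnP => h1 /=; lia.
Qed.


Definition jmu x b := match @split n1.+1 n2.+1 x with
  | inl i => fmu v1 i b.1 | inr j => fmu v2 j b.2 end.
Definition jnext x b : join_basis := match @split n1.+1 n2.+1 x with
  | inl i => (fnext i b.1, b.2) | inr j => (b.1, fnext j b.2) end.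
Definition jdead x b := match @split n1.+1 n2.+1 x with
  | inl i => fdead i b.1 | inr j => fdead j b.2 end.

Lemma jsplitP (P : 'I_N -> Prop) :
  (forall i, P (v1 i)) -> (forall j, P (v2 j)) -> forall x, P x.
Proof. by move=> h1 h2 x; rewrite -[x]splitK; case: (split x). Qed.

Lemma wsum12 f i (l : 'I_n1) :
  [/\ wsum v2 f U_(v1 i)%MM = 0%N, wsum v2 f (fmu v1 i l) = 0%N
    & wsum v2 f (fmon v1 l) = 0%N].
Proof.
have h0 j : wsum v2 f U_(v1 j)%MM = 0%N by apply: wsumU0 => ?; apply: v21.
by rewrite /fmu /fmon wsumD !wsumMn !h0.
Qed.

Lemma wsum21 f i (l : 'I_n2) :
  [/\ wsum v1 f U_(v2 i)%MM = 0%N, wsum v1 f (fmu v2 i l) = 0%N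
    & wsum v1 f (fmon v2 l) = 0%N].
Proof.
have h0 j : wsum v1 f U_(v2 j)%MM = 0%N by apply: wsumU0 => ?; apply: v12.
by rewrite /fmu /fmon wsumD !wsumMn !h0.
Qed.

Lemma wsumDl n (v : 'I_n.+1 -> 'I_N) f m m' m'' :
  wsum v f (m + (m' + m''))%MM = (wsum v f (m + m')%MM + wsum v f m'')%N.
Proof. by rewrite (wsumD v f m) (wsumD v f m') (wsumD v f m) addnA. Qed.

Lemma wsumDr n (v : 'I_n.+1 -> 'I_N) f m m' m'' :
  wsum v f (m + (m' + m''))%MM = (wsum v f (m + m'')%MM + wsum v f m')%N.
Proof. by rewrite (wsumD v f m) (wsumD v f m') (wsumD v f m) addnCA addnC. Qed.

Lemma jact_key x b : x \in join_X ->
  gam (U_(x) + bmon b)%MM = gam (jmu x b + bmon (jnext x b))%MM.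
Proof.
move: x; apply: jsplitP => i; rewrite ?mem_join_X1 ?mem_join_X2 => hi; apply/gam_key.
  have [eA eD] := fact_key b.1 v1_inj hi.
  rewrite /jmu /jnext (unsplitK (inl i)) /bmon /=.
  have h0 f : wsum v2 f (U_(v1 i) + (fmon v1 b.1 + fmon v2 b.2))%MM =
      wsum v2 f (fmu v1 i b.1 + (fmon v1 (fnext i b.1) + fmon v2 b.2))%MM.
    rewrite !wsumDl; congr (_ + _)%N; rewrite (wsumD _ _ U_(_)%MM) (wsumD _ _ (fmu _ _ _)).
    have [-> -> ->] := wsum12 f i b.1.
    by have [_ _ ->] := wsum12 f i (fnext i b.1).
  by split; [rewrite !wsumDl eA | rewrite !wsumDl eD | exact: h0 | exact: h0].
have [eA eD] := fact_key b.2 v2_inj hi.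
rewrite /jmu /jnext (unsplitK (inr i)) /bmon /=.
have h0 f : wsum v1 f (U_(v2 i) + (fmon v1 b.1 + fmon v2 b.2))%MM =
    wsum v1 f (fmu v2 i b.2 + (fmon v1 b.1 + fmon v2 (fnext i b.2)))%MM.
  rewrite !wsumDr; congr (_ + _)%N; rewrite (wsumD _ _ U_(_)%MM) (wsumD _ _ (fmu _ _ _)).
  have [-> -> ->] := wsum21 f i b.2.
  by have [_ _ ->] := wsum21 f i (fnext i b.2).
by split; [exact: h0 | exact: h0 | rewrite !wsumDr eA | rewrite !wsumDr eD].
Qed.

Lemma mdeg_join1 m : mdeg m = (wsum v1 (fun=> 1%N) m + wsum v2 (fun=> 1%N) m)%N.
Proof. by rewrite mdeg_join !wsum_deg. Qed.

Lemma jact_deg x b : x \in join_X ->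
  if (1 < h)%N && jdead x b
  then (mdeg (U_(x) + bmon b)%MM < mdeg (jmu x b + bmon (jnext x b))%MM)%N
  else mdeg (U_(x) + bmon b)%MM == mdeg (jmu x b + bmon (jnext x b))%MM.
Proof.
move: x; apply: jsplitP => i; rewrite ?mem_join_X1 ?mem_join_X2 => hi; rewrite !mdeg_join1.
  have := fact_deg b.1 v1_inj hi.
  rewrite /jdead /jmu /jnext (unsplitK (inl i)) /bmon /= !wsumDl.
  rewrite !(wsumD v2 _ U_(_)%MM) !(wsumD v2 _ (fmu _ _ _)).
  have [-> -> ->] := wsum12 (fun=> 1%N) i b.1.
  have [_ _ ->] := wsum12 (fun=> 1%N) i (fnext i b.1).
  case: ifP => _ e; last by rewrite (eqP e).
  by rewrite !ltn_add2r.
have := fact_deg b.2 v2_inj hi.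
rewrite /jdead /jmu /jnext (unsplitK (inr i)) /bmon /= !wsumDr.
rewrite !(wsumD v1 _ U_(_)%MM) !(wsumD v1 _ (fmu _ _ _)).
have [-> -> ->] := wsum21 (fun=> 1%N) i b.2.
have [_ _ ->] := wsum21 (fun=> 1%N) i (fnext i b.2).
case: ifP => _ e; last by rewrite (eqP e).
by rewrite ltn_add2l ltn_add2r.
Qed.

Lemma Zmon_jmu x b : Zmon (jmu x b).
Proof.
move: x; move=> x; apply: jsplitP => j; rewrite ?mem_join_X1 ?mem_join_X2 => hj;
move: x; apply: jsplitP => i; rewrite /jmu ?(unsplitK (inl i)) ?(unsplitK (inr i)) /fmu;
rewrite mnmDE !mulmnE !mnm1E ?(negPf (v12 _ _)) ?(negPf (v21 _ _)) //
  ?(inj_eq v1_inj) ?(inj_eq v2_inj) -!val_eqE /=; case/andP: hj => j0 jn.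
  by rewrite [0%N == _]eq_sym (gtn_eqF j0) (gtn_eqF jn).
by rewrite [0%N == _]eq_sym (gtn_eqF j0) (gtn_eqF jn).
Qed.

Section JoinModel.
Variable K : fieldType.
Local Notation R := {mpoly K[N]}.
Local Notation r := #|join_basis|.
Local Notation jb := (@enum_val join_basis predT).

(* [strict] selects the associated graded ring rather than the semigroup ring *)
Definition jcoef (strict : bool) x b : R :=
  if [&& strict, (1 < h)%N & jdead x b] then 0 else 'X_[jmu x b].

Definition jxi (strict : bool) (x : 'I_N) : 'M[R]_r :=
  \matrix_(l, l') if (x \in join_X) && (jb l' == jnext x (jb l))
                  then jcoef strict x (jb l) else 0.

Lemma jxi_out strict x : x \notin join_X -> jxi strict x = 0.
Proof. by move=> /negPf xX; apply/matrixP => i j; rewrite !mxE xX. Qed.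

Lemma xdeg_lt_Zmon m x : Zmon m -> x \in join_X -> xdeg_lt x 1 ('X_[m] : R).
Proof. by move=> hm xX; apply: xdeg_ltX; rewrite hm. Qed.

Lemma jxi_free strict x y : y \in join_X -> mxdeg_lt y 1 (jxi strict x).
Proof.
move=> yX i j; rewrite mxE; case: ifP => _; last exact: xdeg_lt0.
rewrite /jcoef; case: ifP => _; first exact: xdeg_lt0.
by apply: xdeg_lt_Zmon => //; apply: Zmon_jmu.
Qed.

Lemma jxi_hom x l l' : x \in join_X ->
  whomog (fun=> 1%N) (jxi true x l l') (mdeg (bmon (jb l')))
    (1%N + mdeg (bmon (jb l)))%R.
Proof.
move=> xX; rewrite mxE xX /=; case: eqP => [->|_]; last exact: whomog0.
have := jact_deg (jb l) xX; rewrite /jcoef /=.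
case: ifP => _ e; first exact: whomog0.
by move/eqP in e; move=> m; rewrite msuppX inE => /eqP ->; rewrite wdeg_one; move: e; rewrite !mdegD mdeg1.
Qed.

(** A dead product carries x_0^h with h positive, so replacing it by 0 in the graded ring changes
    nothing modulo the variables. *)
Lemma jmu_dead0 x b : jdead x b -> jmu x b != 0%MM.
Proof.
move: x; apply: jsplitP => i; rewrite /jdead /jmu ?(unsplitK (inl i)) ?(unsplitK (inr i)) => hd;
rewrite /fmu hd muln1; apply/eqP.
  move=> /(congr1 (fun m : 'X_{1..N} => m (v1 ord0))).
  by rewrite mnmDE !mulmnE !mnm1E eqxx mnm0E; lia.
move=> /(congr1 (fun m : 'X_{1..N} => m (v2 ord0))).
by rewrite mnmDE !mulmnE !mnm1E eqxx mnm0E; lia.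
Qed.

Lemma jxi0 x : map_mx (mcoeff 0%MM) (jxi true x) = map_mx (mcoeff 0%MM) (jxi false x).
Proof.
apply/matrixP => i j; rewrite !mxE; case: ifP => // _; rewrite /jcoef /=.
case: ifP => // /andP[_ /jmu_dead0 /negPf h0].
by rewrite mcoeff0 mcoeffX h0.
Qed.

Lemma fmu_top n (v : 'I_n.+1 -> 'I_N) i (l : 'I_n) : injective v -> (0 < n)%N ->
  (0 < l)%N -> fmu v i l != 0%MM.
Proof.
move=> vi n0 l0; apply/eqP => e.
have := congr1 (fun m : 'X_{1..N} => m (v ord0)) e.
have := congr1 (fun m : 'X_{1..N} => m (v ord_max)) e.
rewrite /= !mnmDE !mulmnE !mnm1E !mnm0E !(inj_eq vi) !eqxx -!val_eqE /=.
by rewrite (gtn_eqF n0) (ltn_eqF n0) /fdead l0 /= !mul0n !mul1n addn0 add0n; lia.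
Qed.

(** The basis element e_1 e'_1, which exists because both factors have an inner variable. Its degree
    2 is the origin of the regularity. *)
Definition jtop_pair : join_basis := (Ordinal hn1, Ordinal hn2).
Definition jtop : 'I_r := enum_rank jtop_pair.

(** Since both indices of e_1 e'_1 are positive, every product with an inner variable is 0 or
    carries an outer variable as a factor. *)
Lemma jxi_top x : row jtop (map_mx (mcoeff 0%MM) (jxi true x)) = 0.
Proof.
apply/rowP => j; rewrite !mxE enum_rankK; case: ifP => // [/andP[xX _]|]; last first.
  by rewrite mcoeff0.
rewrite /jcoef; case: ifP => _; first by rewrite mcoeff0.
rewrite mcoeffX; suff /negPf -> : jmu x jtop_pair != 0%MM by [].
move: x xX; apply: jsplitP => i _; rewrite /jmu ?(unsplitK (inl i)) ?(unsplitK (inr i)).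
  by apply: fmu_top => //; [exact: v1_inj | exact: ltnW].
by apply: fmu_top => //; [exact: v2_inj | exact: ltnW].
Qed.

Lemma mdeg_bmon b : mdeg (bmon b) = ((0 < b.1) + (0 < b.2))%N.
Proof. by rewrite mdegD !mdegMn !mdeg1 !mul1n. Qed.

Definition jzero : join_basis := (Ordinal (ltnW hn1), Ordinal (ltnW hn2)).

Lemma bmon_jzero : bmon jzero = 0%MM.
Proof. by apply/eqP; rewrite -mdeg_eq0 mdeg_bmon. Qed.

(** The hypotheses below are common to both presentations: the semigroup ring identifies all
    monomials of a fibre, the graded ring only those of equal degree, and it kills those that are
    not of maximal degree. *)
Variables (strict : bool) (A : comPzRingType) (pr : {rmorphism R -> A}).
Hypothesis pr_rel : forall m m', gam m = gam m' -> (strict -> mdeg m = mdeg m') ->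
  pr 'X_[m] = pr 'X_[m'].
Hypothesis pr_dead : strict -> forall m m', gam m = gam m' -> (mdeg m < mdeg m')%N ->
  pr 'X_[m] = 0.
Hypothesis pr_ker : forall p m0,
  (forall m, gam m = gam m0 -> (mdeg m <= mdeg m0)%N) -> pr p = 0 ->
  msum (fun m => (gam m == gam m0) && (strict ==> (mdeg m == mdeg m0))) p = 0.

Definition jgen (l : 'I_r) : restrict pr := pr 'X_[bmon (jb l)].

Lemma scale_restrict (p q : R) : p *: (pr q : restrict pr) = pr (p * q).
Proof. by rewrite rmorphM. Qed.

Lemma sum_jgen (u : 'rV[R]_r) :
  \sum_l u 0 l *: jgen l = pr (\sum_l u 0 l * 'X_[bmon (jb l)]).
Proof.
by rewrite [RHS](rmorph_sum pr); apply: eq_bigr => l _; rewrite scale_restrict.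
Qed.

Lemma jgen_rel x l : x \in join_X -> 'X_x *: jgen l = \sum_m jxi strict x l m *: jgen m.
Proof.
move=> xX; rewrite scale_restrict -mpolyXD.
rewrite (bigD1 (enum_rank (jnext x (jb l)))) //= mxE xX enum_rankK eqxx /=.
rewrite big1 ?addr0 => [|l' ne]; last first.
  rewrite mxE; case: eqP => [e|_]; last by rewrite andbF scale0r.
  by case/eqP: ne; rewrite -e enum_valK.
rewrite scale_restrict enum_rankK /jcoef.
have := jact_key (jb l) xX; have := jact_deg (jb l) xX.
case: (boolP strict) => [st|/negPf st] /=.
  case: ifP => _ ed ek; last by move/eqP in ed; rewrite -mpolyXD; apply: pr_rel.
  by rewrite mul0r rmorph0; apply: pr_dead ed.
by move=> _ ek; rewrite -mpolyXD; apply: pr_rel => //; rewrite st.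
Qed.

Lemma jgen_inj (u : 'rV[R]_r) : (forall x, x \in join_X -> mxdeg_lt x 1 u) ->
  \sum_l u 0 l *: jgen l = 0 -> u = 0.
Proof.
move=> hu; rewrite sum_jgen => pu; apply/rowP => l0; rewrite [RHS]mxE.
have uZ l m : m \in msupp (u 0 l) -> Zmon m.
  by move=> hm x xX; have := hu x xX 0 l m hm; case: (m x).
apply/mpolyP => m0; rewrite mcoeff0; apply/eqP/contraT => m0u.
rewrite -mcoeff_msupp in m0u; have hm0 := uZ _ _ m0u.
(* By [join_unique], [M] is the only monomial of the combination in its fibre, and by [join_max] it
   has maximal degree there; the kernel condition thus reduces to one coefficient. *)
set M := (m0 + bmon (jb l0))%MM.
have := pr_ker (m0 := M) (fun m => join_max hm0) pu.
set p := \sum_l _.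
have -> : msum (fun m => (gam m == gam M) && (strict ==> (mdeg m == mdeg M))) p = msum (pred1 M) p.
  apply: eq_msum => m /msupp_sum_le /flattenP[s /mapP[l _ ->]].
  rewrite (perm_mem (msuppMX _ _)) => /mapP[z zu ->] /=.
  apply/idP/eqP => [/andP[/eqP e _]|->]; last by rewrite !eqxx implybT.
  rewrite addmC in e; have [ez eb] := join_unique (uZ _ _ zu) hm0 e.
  by rewrite addmC ez eb.
rewrite msum_pred1 raddf_sum (bigD1 l0) //= big1 ?addr0 => [|l ll0].
  by rewrite /M addmC mcoeffMX => e; move: m0u; rewrite mcoeff_msupp e eqxx.
apply/memN_msupp_eq0/negP; rewrite (perm_mem (msuppMX _ _)) => /mapP[z zu eM].
have [_ eb] : m0 = z /\ jb l0 = jb l.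
  by apply: join_unique hm0 (uZ _ _ zu) _; rewrite -/M eM addmC.
by case/eqP: ll0; apply: enum_val_inj.
Qed.

End JoinModel.
End Join.

(** * Betti numbers and regularity *)

Lemma the_natE (P : nat -> Prop) b : (forall b', P b' <-> b' = b) -> the_nat P = b.
Proof.
move=> hP; rewrite /the_nat; case: pselect => [e|]; last by case; exists b; apply/hP.
by case: cid => b' /= /hP.
Qed.

Lemma the_nat_neq0 (P : nat -> Prop) : the_nat P <> 0%N -> exists2 b, P b & b <> 0%N.
Proof. by rewrite /the_nat; case: pselect => // e; case: cid => b Pb /= b0; exists b. Qed.

Section MinResFacts.
Variables (K : fieldType) (n : nat) (Gr : nmodType) (w : 'I_n -> Gr).
Variables (M : lmodType {mpoly K[n]}) (comp : Gr -> M -> Prop).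
Variable F : min_graded_res w comp.

Lemma mgr_complex : is_complex (@mgr_diff _ _ _ _ _ _ F) (@mgr_aug _ _ _ _ _ _ F).
Proof.
case=> [|i] /=.
  move=> k; have [_ h] := mgr_aug_exact (row k (mgr_diff F 0%N)).
  transitivity (\sum_l row k (mgr_diff F 0%N) 0 l *: mgr_aug l).
    by apply: eq_bigr => l _; rewrite mxE.
  by apply: h; exists (delta_mx 0 k); rewrite -rowE.
apply/row_matrixP => k; rewrite row_mul row0.
by apply/mgr_diff_exact; exists (delta_mx 0 k); rewrite -rowE.
Qed.

Lemma mgr_exact : exact_complex (@mgr_diff _ _ _ _ _ _ F) (@mgr_aug _ _ _ _ _ _ F).
Proof.
case=> [|i] u /=; last by move/mgr_diff_exact.
by move=> h; apply/mgr_aug_exact.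
Qed.

Lemma mgr_diff0 i : map_mx (mcoeff 0%MM) (mgr_diff F i) = 0.
Proof. by apply/matrixP => k l; rewrite !mxE mgr_minimal. Qed.

Variables (rG : nat -> nat) (dG : forall i, 'M[{mpoly K[n]}]_(rG i.+1, rG i)).
Variables (aG : 'I_(rG 0) -> M) (Gr' : nmodType) (w' : 'I_n -> Gr').
Variables (shF : forall i, 'I_(mgr_rank F i) -> Gr') (shG : forall i, 'I_(rG i) -> Gr').
Variable d0 : forall i, 'M[K]_(rG i.+1, rG i).
Hypothesis d0E : forall i, map_mx (mcoeff 0%MM) (dG i) = d0 i.
Hypothesis dF_hom : forall i, mhom w' (@shF i.+1) (@shF i) (mgr_diff F i).
Hypothesis dG_hom : forall i, mhom w' (@shG i.+1) (@shG i) (dG i).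
Hypotheses (G_complex : is_complex dG aG) (G_exact : exact_complex dG aG).
Hypothesis aF_lift : forall k : 'I_(mgr_rank F 0), exists u : 'rV_(rG 0),
  mgr_aug k = \sum_l u 0 l *: aG l /\ mhom w' (fun=> shF k) (@shG 0%N) u.

Lemma compare_min_res i :
  exists (f : 'M[K]_(mgr_rank F i, rG i)) (g : 'M_(rG i, mgr_rank F i)),
  [/\ f *m g = 1%:M,
      (forall k l, f k l != 0 -> shF k = shG l),
      cycle0 d0 f, d0 i *m g = 0
    & forall m (x : 'M_(m, rG i)), cycle0 d0 x ->
        exists y, x *m (g *m f) = x + y *m d0 i].
Proof.
have -> : d0 = fun i => map_mx (mcoeff 0%MM) (dG i).
  by apply: functional_extensionality_dep => j; rewrite d0E.
exact: (compare_minimal dF_hom dG_hom mgr_complex mgr_exact G_complex G_exact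
  aF_lift (@mgr_aug_surj _ _ _ _ _ _ F) mgr_diff0).
Qed.

End MinResFacts.

(** The identity of rank a factors through rank a': on the cycle [f] the composite of [g'] and [f']
    is the identity up to a boundary, which [g] kills. *)
Lemma retract_rank_eq (K : fieldType) (rG : nat -> nat)
    (d0 : forall i, 'M[K]_(rG i.+1, rG i)) i a a'
    (f : 'M_(a, rG i)) (g : 'M_(rG i, a)) (f' : 'M_(a', rG i)) (g' : 'M_(rG i, a')) :
  f *m g = 1%:M -> cycle0 d0 f -> d0 i *m g = 0 ->
  (forall m (x : 'M_(m, rG i)), cycle0 d0 x -> exists y, x *m (g' *m f') = x + y *m d0 i) ->
  (a <= a')%N.
Proof.
move=> fg cf dg h'; apply: (@mulmx1_min _ _ _ (f *m g') (f' *m g)).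
have [y yE] := h' _ _ cf.
by rewrite !mulmxA -[f *m g' *m f']mulmxA yE mulmxDl fg -mulmxA dg mulmx0 addr0.
Qed.

Lemma row_ktop_kdiag (K : comNzRingType) (n r : nat) (R' : nzRingType)
    (f : {rmorphism {mpoly K[n]} -> R'}) (X : seq 'I_n) (A : 'M_r) l :
  row l (map_mx f A) = 0 -> row (ktop X l) (map_mx f (kdiag X A)) = 0.
Proof.
move=> hA; elim: X => //= x X IH.
by rewrite map_block_mx block_mxEv rowKd row_row_mx IH map_mx0 row0 row_mx0.
Qed.

Lemma row_ktop_kdiff (K : comNzRingType) (n r : nat) (R' : nzRingType)
    (f : {rmorphism {mpoly K[n]} -> R'}) (X : seq 'I_n) (xi : 'I_n -> 'M_r) l :
  (forall x, x \in X -> row l (map_mx f (kphi xi x)) = 0) ->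
  row (ktop X l) (map_mx f (kdiff xi X)) = 0.
Proof.
elim: X => [_|x X IH hX] /=; first by rewrite map_mx0 row0.
have {}IH : row (ktop X l) (map_mx f (kdiff xi X)) = 0.
  by apply: IH => y yX; apply: hX; rewrite inE yX orbT.
rewrite map_block_mx block_mxEv rowKd row_row_mx row_ktop_kdiag ?hX ?mem_head //.
by rewrite map_mxN linearN /= IH oppr0 row_mx0.
Qed.

Lemma khd_le n r (X : seq 'I_n) (t : 'I_(ksize r X)) : (khd t <= size X)%N.
Proof.
elim: X t => // x X IH; apply: ksplitP => t; rewrite ?khd_lshift ?khd_rshift /=.
  exact: leqW (IH t).
exact: (IH t).
Qed.

Lemma kshift_le n r (sh : 'I_r -> nat) e (X : seq 'I_n) (t : 'I_(ksize r X)) :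
  (forall l, (sh l <= e)%N) -> (kshift (fun=> 1%N) sh t <= khd t + e)%N.
Proof.
move=> hsh; elim: X t => [t|x X IH]; first exact: hsh.
apply: ksplitP => t; rewrite ?kshift_lshift ?kshift_rshift ?khd_lshift ?khd_rshift //.
by rewrite addSn ltnS; apply: IH.
Qed.

Section JoinResults.
Variables (K : fieldType) (k h n1 n2 : nat) (a1 d1 a2 d2 : 'X_{1..k}).
Hypotheses (hh : (0 < h)%N) (hn1 : (1 < n1)%N) (hn2 : (1 < n2)%N).
Hypothesis hind : lin_indep_Q [tuple a1; d1; a2; d2].

Local Notation N := (n1.+1 + n2.+1)%N.
Local Notation S := (join_gens h n1 n2 a1 d1 a2 d2).
Local Notation gam := (wdeg (tnth S)).
Local Notation R := {mpoly K[N]}.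
Local Notation X := (join_X n1 n2).
Local Notation r := #|join_basis n1 n2|.
Local Notation jb := (@enum_val (join_basis n1 n2) predT).
Local Notation gpr := (@gr_pres K k N S).
Local Notation spr := (@sgring_pres K k N S).

Lemma msumX (P : pred 'X_{1..N}) m : msum P ('X_[m] : R) = (P m)%:R.
Proof. by rewrite -['X_[m]]scale1r msumZX; case: (P m). Qed.

Lemma gr_pr_rel m m' : gam m = gam m' -> (true -> mdeg m = mdeg m') ->
  gpr 'X_[m] = gpr 'X_[m'].
Proof.
move=> eg /(_ isT) ed; apply/eqP; rewrite -subr_eq0 -rmorphB; apply/eqP/gr_pres_eq0.
by move=> i g _; rewrite raddfB /= !msumX eg ed subrr.
Qed.

Lemma gr_pr_dead m m' : gam m = gam m' -> (mdeg m < mdeg m')%N -> gpr 'X_[m] = 0.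
Proof.
move=> eg lt; apply/gr_pres_eq0 => i g ng; rewrite msumX.
case: eqP => //= e1; case: eqP => //= e2; case: ng.
by exists m'; rewrite -eg e1 -e2.
Qed.

Lemma gr_pr_ker p m0 : (forall m, gam m = gam m0 -> (mdeg m <= mdeg m0)%N) ->
  gpr p = 0 ->
  msum (fun m => (gam m == gam m0) && (true ==> (mdeg m == mdeg m0))) p = 0.
Proof.
move=> mx /gr_pres_eq0; apply => [[m [e lt]]].
by have := mx m e; rewrite leqNgt lt.
Qed.

Lemma sg_pr_rel m m' : gam m = gam m' -> (false -> mdeg m = mdeg m') ->
  spr 'X_[m] = spr 'X_[m'].
Proof.
move=> eg _; apply/eqP; rewrite -subr_eq0 -rmorphB; apply/eqP/sgring_pres_eq0.
by move=> g; rewrite raddfB /= !msumX eg subrr.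
Qed.

Lemma sg_pr_ker p m0 : (forall m, gam m = gam m0 -> (mdeg m <= mdeg m0)%N) ->
  spr p = 0 ->
  msum (fun m => (gam m == gam m0) && (false ==> (mdeg m == mdeg m0))) p = 0.
Proof.
move=> _ /sgring_pres_eq0 e; rewrite -[RHS](e (gam m0)); apply: eq_msum => m _.
by rewrite /= andbT.
Qed.

Local Notation gG := (@jgen n1 n2 K _ gpr).
Local Notation gS := (@jgen n1 n2 K _ spr).

Local Notation rG := (@kc_rank N r X).
Local Notation dG s := (@kc_diff K N r X (jxi h K s)).
Local Notation d0 := (fun i => map_mx (mcoeff 0%MM) (dG true i)).
Local Notation shb := (fun l => mdeg (bmon (jb l))).

Lemma gr_complex : is_complex (dG true) (kc_aug (X := X) gG).
Proof.
apply: kc_complex.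
- exact: jxi_out.
- by move=> x y; apply: jxi_free.
- exact: (jgen_rel hh hn1 hn2 hind gr_pr_rel (fun _ => gr_pr_dead)).
exact: (jgen_inj hh hind gr_pr_ker).
Qed.

Lemma gr_exact : exact_complex (dG true) (kc_aug (X := X) gG).
Proof.
apply: kc_exact.
- exact: join_X_uniq.
- exact: jxi_out.
- by move=> x y; apply: jxi_free.
- exact: (jgen_rel hh hn1 hn2 hind gr_pr_rel (fun _ => gr_pr_dead)).
exact: (jgen_inj hh hind gr_pr_ker).
Qed.

Let sg_rel := jgen_rel (strict := false) hh hn1 hn2 hind sg_pr_rel
  (fun H => False_ind _ (Bool.diff_false_true H)).

Lemma sg_complex : is_complex (dG false) (kc_aug (X := X) gS).
Proof.
apply: kc_complex.
- exact: jxi_out.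
- by move=> x y; apply: jxi_free.
- exact: sg_rel.
exact: (jgen_inj hh hind sg_pr_ker).
Qed.

Lemma sg_exact : exact_complex (dG false) (kc_aug (X := X) gS).
Proof.
apply: kc_exact.
- exact: join_X_uniq.
- exact: jxi_out.
- by move=> x y; apply: jxi_free.
- exact: sg_rel.
exact: (jgen_inj hh hind sg_pr_ker).
Qed.

Lemma dG0E i : map_mx (mcoeff 0%MM) (dG false i) = d0 i.
Proof.
rewrite /kc_diff !map_mxsub; congr mxsub.
by apply: map_kdiff => x _; rewrite jxi0.
Qed.

(** As e_0 e'_0 = 1 is a basis element of degree 0, the image of [p] lifts to [p] times that
    element, in the same degree. *)
Lemma gen_unit (A : comPzRingType) (pr : {rmorphism R -> A}) (p : R) :
  exists u : 'rV[R]_(rG 0),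
    (pr p : restrict pr) = \sum_l u 0 l *: kc_aug (X := X) (@jgen n1 n2 K _ pr) l /\
    forall t, whomog (fun=> 1%N) p 0%N t ->
      mhom (fun=> 1%N) (fun=> t) (@kc_shift N r X _ (fun=> 1%N) shb 0%N) u.
Proof.
pose l0 := enum_rank (jzero hn1 hn2).
pose u0 : 'rV[R]_r := p *: delta_mx 0 l0.
exists (\row_s kinj X u0 0 (enum_val s)); split.
  transitivity (\sum_l u0 0 l *: jgen pr l).
    rewrite (bigD1 l0) //= !mxE !eqxx mulr1 big1 ?addr0 => [|l ll0]; last first.
      by rewrite !mxE (negPf ll0) andbF mulr0 scale0r.
    by rewrite scale_restrict enum_rankK bmon_jzero mpolyX0 mulr1.
  rewrite -(kaug_kinj _ X) (@big_kgrade _ _ (@khd N r X) 0%N) => [|s hs].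
    by apply: eq_bigr => s _; rewrite mxE.
  by rewrite kaug_hd ?scaler0.
move=> t pt a s; rewrite mxE /kc_shift.
elim: (X) (enum_val s) => [l|x X' IH].
  rewrite /= !mxE; case: eqP => [_|_] /=.
    case: eqP => [->|_]; last by rewrite mulr0; apply: whomog0.
    by rewrite mulr1 enum_rankK bmon_jzero mdeg0.
  by rewrite mulr0; apply: whomog0.
apply: ksplitP => i; rewrite ?kshift_lshift ?kshift_rshift /=.
  by rewrite row_mxEl.
by rewrite row_mxEr mxE; apply: whomog0.
Qed.

Lemma gr_compare (F : min_graded_res (M := restrict gpr) (fun=> 1%N)
    (@gr_comp _ (@sgring_max K k N S))) i :
  exists (f : 'M[K]_(mgr_rank F i, rG i)) (g : 'M_(rG i, mgr_rank F i)),
  [/\ f *m g = 1%:M,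
      (forall a l, f a l != 0 -> mgr_shift a = kc_shift (fun=> 1%N) shb l),
      cycle0 d0 f, d0 i *m g = 0
    & forall m (x : 'M_(m, rG i)), cycle0 d0 x ->
        exists y, x *m (g *m f) = x + y *m d0 i].
Proof.
apply: (compare_min_res (w' := fun=> 1%N) (dG := dG true) (aG := kc_aug gG)) => //.
- by move=> j a l; apply: mgr_diff_homog.
- by move=> j; apply: kc_diff_hom => x l m; apply: jxi_hom.
- exact: gr_complex.
- exact: gr_exact.
move=> a; have [q [qh qE]] := gr_comp_lift (mgr_aug_homog a).
have [u [uE uh]] := gen_unit gpr q; exists u; split; first by rewrite -uE.
by apply: uh => m /qh; rewrite wdeg_one => ->; rewrite addr0.
Qed.

Lemma sg_compare (F : min_graded_res (M := restrict spr) (tnth S) (@sgring_comp K k N S)) i :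
  exists (f : 'M[K]_(mgr_rank F i, rG i)) (g : 'M_(rG i, mgr_rank F i)),
  [/\ f *m g = 1%:M, cycle0 d0 f, d0 i *m g = 0
    & forall m (x : 'M_(m, rG i)), cycle0 d0 x ->
        exists y, x *m (g *m f) = x + y *m d0 i].
Proof.
(* Only ranks are compared here, so all degrees are set to 0; by [dG0E] the reduced differentials
   can be taken from the graded ring. *)
have triv_hom a b (A : 'M[R]_(a, b)) :
    mhom (fun _ : 'I_N => 0%N) (fun=> 0%N) (fun=> 0%N) A.
  by move=> x y m _; rewrite /wdeg big1 // => j _; rewrite mul0rn.
have [|||||f [g [h1 _ h2 h3 h4]]] := @compare_min_res K N _ _ _ _ F rG (dG false)
  (kc_aug gS) nat (fun=> 0%N) (fun _ _ => 0%N) (fun _ _ => 0%N) d0 dG0E _ _ _ _ _ i.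
- by move=> j; apply: triv_hom.
- by move=> j; apply: triv_hom.
- exact: sg_complex.
- exact: sg_exact.
- move=> a; have [q qE] := sgring_pres_surj (mgr_aug a).
  have [u [uE _]] := gen_unit spr q; exists u; split; last exact: triv_hom.
  by rewrite -uE.
by exists f, g.
Qed.

(** The monomial 1 is standard, hence of maximal degree in its fibre, so every monomial of that
    fibre has degree 0. *)
Lemma gam_eq0 m : gam m = 0 -> m = 0%MM.
Proof.
move=> e; have Z0 : Zmon (n1 := n1) (n2 := n2) 0%MM by move=> x _; rewrite mnm0E.
have := join_max (b := jzero hn1 hn2) (m := m) hh hind Z0.
rewrite bmon_jzero add0m wdeg0 mdeg0 => /(_ e).
by rewrite leqn0 mdeg_eq0 => /eqP.
Qed.

Lemma gr_min_res_exists : inhabited (min_graded_res (M := restrict gpr) (fun=> 1%N)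
    (@gr_comp _ (@sgring_max K k N S))).
Proof.
have hz (p : R) : p *: (gpr 1 : restrict gpr) = gpr p by rewrite scale_restrict mulr1.
apply: (@min_graded_res_exists _ _ _ _ _ _ _ _ (gpr 1 : restrict gpr)).
- by move=> a b c /eqP; rewrite eqn_add2r => /eqP.
- by move=> m; rewrite wdeg_one => /eqP; rewrite mdeg_eq0 => /eqP.
- exact: gr_comp_one.
- by move=> x; have [q ->] := gr_pres_surj x; exists q; rewrite hz.
- by move=> p t; rewrite !hz; apply: gr_pres_hpart.
move=> p; rewrite hz => /gr_pres_eq0 e.
rewrite -msum_pred1 -[RHS](e 0%N 0).
  apply: eq_msum => m _ /=; rewrite mdeg_eq0.
  by case: eqP => [->|]; rewrite ?wdeg0 ?eqxx ?andbF.
by move=> [m [/gam_eq0 ->]]; rewrite mdeg0.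
Qed.

Lemma sg_min_res_exists :
  inhabited (min_graded_res (M := restrict spr) (tnth S) (@sgring_comp K k N S)).
Proof.
have hz (p : R) : p *: (spr 1 : restrict spr) = spr p by rewrite scale_restrict mulr1.
apply: (@min_graded_res_exists _ _ _ _ _ _ _ _ (spr 1 : restrict spr)).
- by move=> a b c; apply: addIm.
- exact: gam_eq0.
- by exists 1; rewrite rmorph1 scale1r mpolyX0.
- by move=> x; have [q ->] := sgring_pres_surj x; exists q; rewrite hz.
- by move=> p t; rewrite !hz; apply: sgring_pres_hpart.
move=> p; rewrite hz => /sgring_pres_eq0 e.
rewrite -msum_pred1 -[RHS](e 0); apply: eq_msum => m _ /=.
by apply/eqP/eqP => [->|/gam_eq0 //]; rewrite wdeg0.
Qed.

Lemma betti_gr_sgring i : betti_gr K S i = betti_sgring K S i.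
Proof.
have [F] := gr_min_res_exists; have [F'] := sg_min_res_exists.
(* Proved for arbitrary pairs, so that it also shows that neither Betti number depends on the
   selected resolution. *)
have rk (F1 : min_graded_res (M := restrict gpr) (fun=> 1%N)
      (@gr_comp _ (@sgring_max K k N S)))
    (F2 : min_graded_res (M := restrict spr) (tnth S) (@sgring_comp K k N S)) :
    mgr_rank F1 i = mgr_rank F2 i.
  have [f [g [fg _ cf dg hr]]] := gr_compare F1 i.
  have [f' [g' [fg' cf' dg' h']]] := sg_compare F2 i.
  apply/eqP; rewrite eqn_leq (retract_rank_eq fg cf dg h').
  exact: (retract_rank_eq fg' cf' dg' hr).
rewrite /betti_gr /betti_sgring /betti.
transitivity (mgr_rank F' i); [|symmetry]; apply: the_natE => b.
  by split=> [[F1 ->]|->]; [rewrite (rk F1 F') | exists F; rewrite (rk F F')].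
by split=> [[F1 ->]|->]; [rewrite -(rk F F1) (rk F F') | exists F'].
Qed.

Lemma gr_graded_betti_le i j :
  graded_betti (M := restrict gpr) (fun _ : 'I_N => 1%N)
    (@gr_comp _ (@sgring_max K k N S)) i j <> 0%N -> (j <= i + 2)%N.
Proof.
move=> /the_nat_neq0[b [F ->] /eqP]; rewrite -lt0n => /card_gt0P[a].
rewrite inE => /eqP <-; have [f [g [fg fs _ _ _]]] := gr_compare F i.
(* As [f] has a right inverse, row [a] is nonzero, and a nonzero entry equates the shift of [a] with
   that of a Koszul basis element. *)
have [l fl] : exists l, f a l != 0.
  apply: contrapT => nl; have := congr1 (fun A : 'M_(mgr_rank F i) => A a a) fg.
  rewrite !mxE eqxx big1 => [/esym/eqP|l _]; first by rewrite oner_eq0.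
  have [->|fl] := eqVneq (f a l) 0; first by rewrite mul0r.
  by case: nl; exists l.
rewrite (fs _ _ fl) -[in X in (_ <= X)%N](hd_enum_val l).
by apply: kshift_le => l'; rewrite mdeg_bmon; case: (0 < _)%N; case: (0 < _)%N.
Qed.

Lemma gr_graded_betti_top :
  graded_betti (M := restrict gpr) (fun _ : 'I_N => 1%N)
    (@gr_comp _ (@sgring_max K k N S)) (size X) (size X + 2) <> 0%N.
Proof.
have [F0] := gr_min_res_exists.
rewrite /graded_betti /the_nat; case: pselect => [e|ne]; last first.
  by case: ne; exists #|[pred a | @mgr_shift _ _ _ _ _ _ F0 (size X) a == (size X + 2)%N]|, F0.
case: cid => b /= [F ->]; apply/eqP; rewrite -lt0n; apply/card_gt0P.
have [f [g [fg fs _ _ h']]] := gr_compare F (size X).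
(* The class of e_1 e'_1 in the top homological degree |X|; its shift is |X| + 2. *)
pose t := ktop X (jtop hn1 hn2).
have tin : t \in [pred t | @khd N r X t == size X] by rewrite inE khd_ktop.
pose s0 : 'I_(rG (size X)) := enum_rank_in tin t.
pose v : 'rV[K]_(rG (size X)) := delta_mx 0 s0.
have cv : cycle0 d0 v.
  suff cyc i (s : 'I_(rG i)) : enum_val s = t -> cycle0 d0 (delta_mx 0 s : 'rV[K]_(rG i)).
    by apply: cyc; rewrite enum_rankK_in.
  case: i s => [|i] s es //=.
  rewrite -rowE; apply/rowP => j; rewrite !mxE es.
  have := @row_ktop_kdiff K N r _ (mcoeff 0%MM) X (jxi h K true) (jtop hn1 hn2).
  rewrite -/t => /(_ _)/rowP/(_ (enum_val j)); rewrite !mxE; apply => x _.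
  rewrite /kphi map_mxB linearB /= jxi_top // subr0.
  apply/rowP => l; rewrite !mxE; case: eqP => _; last by rewrite mulr0n mcoeff0.
  by rewrite mulr1n mcoeffX mnm1_eq0.
have [y] := h' _ _ cv.
(* There is nothing in homological degree |X| + 1, so the top cycle is not a boundary and factors
   through the minimal resolution. *)
have -> : d0 (size X) = 0.
  apply/matrixP => s; have := hd_enum_val s; have := khd_le (enum_val s).
  by move=> + eh; rewrite eh ltnn.
rewrite mulmx0 addr0 mulmxA => e'.
have [a fa] : exists a, f a s0 != 0.
  apply: contrapT => na; have := congr1 (fun A : 'rV_(rG (size X)) => A 0 s0) e'.
  rewrite !mxE !eqxx big1 => [/esym/eqP|a _]; first by rewrite oner_eq0.
  have [->|fa] := eqVneq (f a s0) 0; first by rewrite mulr0.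
  by case: na; exists a.
exists a; rewrite inE (fs _ _ fa) /kc_shift enum_rankK_in // kshift_ktop enum_rankK.
rewrite mdeg_bmon; apply/eqP; congr (_ + _)%R.
by elim: (X) => [|x X' IH]; rewrite ?big_nil // big_cons IH.
Qed.

Lemma gr_regularity : gr_has_regularity K S 2.
Proof.
by split; [exists (size X); apply: gr_graded_betti_top | apply: gr_graded_betti_le].
Qed.

End JoinResults.

(** * Zariski's lemma *)

Local Open Scope quotient_scope.

Section Integral.
Variables (D : comNzRingType) (L : fieldType) (f : {rmorphism D -> L}).
Local Notation int := (integralOver f).

Lemma integral_exp x k : int x -> int (x ^+ k).
Proof.
move=> hx; elim: k => [|k IH]; first by rewrite expr0; apply: integral1.
by rewrite exprS; apply: integral_mul.
Qed.

Lemma integral_sum (I : Type) (r : seq I) (P : pred I) (F : I -> L) :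
  (forall i, P i -> int (F i)) -> int (\sum_(i <- r | P i) F i).
Proof.
by move=> hF; apply: big_ind => //; [exact: integral0 | exact: integral_add].
Qed.

Lemma integral_lead_coef (q : {poly L}) u : q != 0 -> root q u ->
  (forall i, int q`_i) -> int (lead_coef q * u).
Proof.
move=> q0 qu qi; set c := lead_coef q; set d := (size q).-1.
have sq : size q = d.+1 by rewrite prednK // lt0n size_poly_eq0.
have c0 : c != 0 by rewrite lead_coef_eq0.
case d0 : d => [|e].
  have /size_poly1P[b b0 qE] : size q == 1%N by rewrite sq d0.
  by move: qu; rewrite qE /root hornerC (negPf b0).
(* This is c^e q(X / c), which is monic with integral coefficients and has the root c u. *)
pose P := 'X^(e.+1) + \poly_(i < e.+1) (q`_i * c ^+ (e - i)).
have sP : (size (\poly_(i < e.+1) (q`_i * c ^+ (e - i)))%R < size ('X^(e.+1) : {poly L})%R)%N.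
  by rewrite size_polyXn ltnS size_poly.
apply: (@integral_root_monic _ _ f _ P).
- by rewrite monicE lead_coefDl // lead_coefXn.
- apply/rootP; rewrite hornerD hornerXn horner_poly.
  transitivity (c ^+ e * q.[u]); last by rewrite (rootP qu) mulr0.
  rewrite horner_coef sq d0 [in RHS]big_ord_recr /= mulrDr.
  rewrite addrC; congr (_ + _).
    rewrite mulr_sumr; apply: eq_bigr => i _.
    have -> : c ^+ e = c ^+ (e - i) * c ^+ i by rewrite -exprD subnK // -ltnS.
    by rewrite exprMn; ring.
  rewrite exprMn /c lead_coefE sq d0 /= exprSr; ring.
apply/integral_poly => i; rewrite coefD coefXn coef_poly.
apply: integral_add; first exact: integral_nat.
by case: ifP => _; [apply: integral_mul => //; apply: integral_exp; rewrite /c lead_coefE | apply: integral0].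
Qed.

(** After removing a power of X from the integral equation of [v], its constant term r is nonzero
    and r / v is minus a polynomial in [v]. *)
Lemma integral_inv_scaled v : v != 0 -> int v ->
  exists r, f r != 0 /\ int (f r / v).
Proof.
move=> v0 [Q monQ Qv]; pose q := map_poly f Q.
have q0 : q != 0 by apply/monic_neq0/monic_map.
have ex : exists i, q`_i != 0 by exists (size q).-1; rewrite -lead_coefE lead_coef_eq0.
pose m := ex_minn ex; have qm : q`_m != 0 by rewrite /m; case: ex_minnP.
have qlt i : (i < m)%N -> q`_i = 0.
  rewrite /m; case: ex_minnP => j _ jm ij; apply/eqP; apply: contraTT ij => /jm.
  by rewrite -leqNgt.
pose q1 := drop_poly m q.
have qE : q = q1 * 'X^m.
  rewrite -[LHS](poly_take_drop m) (_ : take_poly m q = 0) ?add0r //.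
  by apply/polyP => i; rewrite coef_take_poly coef0; case: ifP => // /qlt.
have q1v : q1.[v] = 0.
  move/rootP: Qv; rewrite -/q qE hornerM hornerXn => /eqP.
  by rewrite mulf_eq0 expf_eq0 (negPf v0) andbF orbF => /eqP.
exists Q`_m; rewrite -coef_map -/q; split=> //.
have -> : q`_m / v = - (drop_poly 1 q1).[v].
  apply: (mulIf v0); rewrite divfK // mulNr; apply/eqP; rewrite -addr_eq0; apply/eqP.
  rewrite -[RHS]q1v -[in RHS](poly_take_drop 1 q1) hornerD hornerM hornerXn expr1.
  congr (_ + _); rewrite [X in X.[v]](_ : _ = (q`_m)%:P) ?hornerC //.
  apply/polyP => i; rewrite coef_take_poly coefC coef_drop_poly.
  by case: i => [|i] //; rewrite add0n.
apply: integral_opp; apply: integral_horner; last by exists Q.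
apply/integral_poly => i; rewrite !coef_drop_poly coef_map.
exact: integral_id.
Qed.

Lemma monic_clear_denominator (F : {poly D}) y a : F \is monic -> f a != 0 ->
  root (map_poly f F) (f y / f a) ->
  f (y ^+ (size F).-1 +
     a * \sum_(i < (size F).-1) F`_i * y ^+ i * a ^+ ((size F).-1 - i.+1)) = 0.
Proof.
move=> monF a0 /rootP Fx; have sF : size F = (size F).-1.+1.
  by rewrite prednK // lt0n size_poly_eq0 monic_neq0.
set N := (size F).-1 in sF *.
transitivity (f a ^+ N * (map_poly f F).[f y / f a]); last by rewrite Fx mulr0.
have sgF : size (map_poly f F) = N.+1.
  by rewrite size_map_poly_id0 ?sF // (monicP monF) rmorph1 oner_neq0.
rewrite horner_coef sgF big_ord_recr /= mulrDr coef_map /= rmorphD rmorphM.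
have -> : F`_N = 1 by rewrite -(monicP monF) lead_coefE.
rewrite rmorph1 mul1r addrC; congr (_ + _); last first.
  by rewrite exprMn exprVn mulrCA mulfV ?expf_neq0 // mulr1 rmorphXn.
rewrite rmorph_sum !mulr_sumr; apply: eq_bigr => i _.
rewrite !rmorphM !rmorphXn coef_map exprMn exprVn.
have -> : f a ^+ N = f a * (f a ^+ (N - i.+1) * f a ^+ i).
  by rewrite -exprD -exprS; congr (_ ^+ _); have := ltn_ord i; lia.
by field; apply: expf_neq0.
Qed.

End Integral.

Section Adjoin.
Variables (D : comNzRingType) (L : fieldType) (f : {rmorphism D -> L}) (u : L).

Definition adjoin_map : {rmorphism {poly D} -> L} := horner_eval u \o map_poly f.

Lemma adjoin_mapE p : adjoin_map p = (map_poly f p).[u].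
Proof. by []. Qed.

Lemma adjoin_mapC d : adjoin_map d%:P = f d.
Proof. by rewrite adjoin_mapE map_polyC hornerC. Qed.

Lemma adjoin_mapX : adjoin_map 'X = u.
Proof. by rewrite adjoin_mapE map_polyX hornerX. Qed.

End Adjoin.

(* the elements of L that are polynomials in us with coefficients in the image
   of f *)
Fixpoint generated (L : fieldType) (us : seq L) (D : comNzRingType)
    (f : {rmorphism D -> L}) (x : L) {struct us} : Prop :=
  if us is u :: us' then generated us' (adjoin_map f u) x else exists d, x = f d.

Section Generated.
Variable L : fieldType.
Implicit Types (us : seq L) (D : comNzRingType).

Lemma generatedC us D (f : {rmorphism D -> L}) d : generated us f (f d).
Proof.
by elim: us D f d => [|u us IH] D f d /=; [exists d | rewrite -(adjoin_mapC f u)].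
Qed.

Lemma generated_mem us D (f : {rmorphism D -> L}) u : u \in us -> generated us f u.
Proof.
elim: us D f => // v us IH D f; rewrite inE => /orP[/eqP ->|/IH h] /=; last exact: h.
by rewrite -[X in generated _ _ X](adjoin_mapX f v); apply: generatedC.
Qed.

Lemma generatedD us D (f : {rmorphism D -> L}) x y :
  generated us f x -> generated us f y -> generated us f (x + y).
Proof.
elim: us D f => [|u us IH] D f /=; last exact: IH.
by move=> [d ->] [e ->]; exists (d + e); rewrite rmorphD.
Qed.

Lemma generatedM us D (f : {rmorphism D -> L}) x y :
  generated us f x -> generated us f y -> generated us f (x * y).
Proof.
elim: us D f => [|u us IH] D f /=; last exact: IH.
by move=> [d ->] [e ->]; exists (d * e); rewrite rmorphM.
Qed.

End Generated.

(* the inductive form of Zariski's lemma: a field finitely generated as a ring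
   over D becomes integral over D after inverting one element of D *)
Lemma zariski_localized (L : fieldType) (us : seq L) (D : comNzRingType)
    (f : {rmorphism D -> L}) :
  (forall x, generated us f x) ->
  exists s, f s != 0 /\ forall x, exists k, integralOver f (f s ^+ k * x).
Proof.
elim: us D f => [|u us IH] D f /= hgen.
  exists 1; rewrite rmorph1 oner_neq0; split=> // x; exists 0%N.
  by rewrite mul1r; have [d ->] := hgen x; apply: integral_id.
have [p [p0 hp]] := IH _ _ hgen.
set g := adjoin_map f u in hgen p0 hp.
(* Either u is algebraic over the image of D, or g vanishes only where [map_poly f] does; the second
   case will be contradictory. *)
have [[q [cq qu]]|nq] := pselect (exists q, f (lead_coef q) != 0 /\ g q = 0).
  set c := f (lead_coef q) in cq.
  have int_f d : integralOver f (f d) by apply: integral_id.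
  have qL : lead_coef (map_poly f q) = c by rewrite lead_coef_map_eq.
  have int_cu : integralOver f (c * u).
    rewrite -qL; apply: integral_lead_coef; last by move=> i; rewrite coef_map; apply: int_f.
      by rewrite -lead_coef_eq0 qL.
    by apply/rootP; rewrite -adjoin_mapE.
  have int_g (a : {poly D}) J : (size a <= J)%N -> integralOver f (c ^+ J * g a).
    move=> sa; rewrite /g adjoin_mapE horner_coef mulr_sumr.
    apply: integral_sum => i _; rewrite coef_map.
    have iJ : (i <= J)%N.
      apply: leq_trans sa; apply: leq_trans (ltnW (ltn_ord i)) _.
      exact: size_poly.
    have -> : c ^+ J = c ^+ (J - i) * c ^+ i by rewrite -exprD subnK.
    have -> : c ^+ (J - i) * c ^+ i * (f a`_i * u ^+ i) = f a`_i * c ^+ (J - i) * (c * u) ^+ i.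
      by rewrite exprMn; ring.
    apply: integral_mul; last exact: integral_exp.
    by apply: integral_mul; [exact: int_f | apply: integral_exp; exact: int_f].
  (* A power of c turns the coefficients of an equation over D[u] into integral ones; it becomes the
     leading coefficient, to which [integral_lead_coef] applies. *)
  have int_trans x : integralOver g x -> exists e, integralOver f (c ^+ e * x).
    move=> [F monF Fx].
    pose J := \max_(i < size F) size (F`_i)%R.
    have FJ i : (size (F`_i)%R <= J)%N.
      have [iF|iF] := ltnP i (size F); last by rewrite nth_default ?size_poly0.
      exact: (leq_bigmax (Ordinal iF)).
    exists J; pose h := c ^+ J *: map_poly g F.
    have cJ : c ^+ J != 0 by rewrite expf_neq0.
    have lh : lead_coef h = c ^+ J.
      by rewrite lead_coefZ (monicP (monic_map _ monF)) mulr1.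
    rewrite -lh; apply: integral_lead_coef; first by rewrite -lead_coef_eq0 lh.
      by rewrite /root hornerZ (rootP Fx) mulr0.
    by move=> i; rewrite coefZ coef_map; apply: int_g.
  pose J := size p; pose v := c ^+ J * g p.
  have v0 : v != 0 by rewrite mulf_neq0 // expf_neq0.
  (* The element [p] to be inverted lies in D[X]; [r] clears its inverse, so that only elements of D
     remain inverted. *)
  have [r [r0 hr]] := integral_inv_scaled v0 (int_g p J (leqnn _)).
  exists (r * lead_coef q); rewrite rmorphM mulf_neq0 //; split=> // x.
  have [k hk] := hp x; have [e he] := int_trans _ hk.
  exists (k + e)%N.
  have -> : (f r * c) ^+ (k + e) * x =
      (f r / v) ^+ k * (c ^+ e * (g p ^+ k * x)) * (f r ^+ e * (c ^+ (J * k) * c ^+ k)).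
    rewrite exprMn !exprD exprM expr_div_n /v exprMn; field.
    by rewrite !expf_neq0 // expf_neq0.
  apply: integral_mul; first by apply: integral_mul => //; apply: integral_exp.
  by apply: integral_mul; [|apply: integral_mul]; apply: integral_exp; exact: int_f.
have inj a : g a = 0 -> map_poly f a = 0.
  move=> ga; apply/eqP/contraT => a0; case: nq.
  set s := size (map_poly f a).
  have aE : map_poly f (take_poly s a) = map_poly f a.
    apply/polyP => i; rewrite !coef_map coef_take_poly; case: ltnP => // si.
    by rewrite -[in RHS]coef_map [RHS]nth_default // raddf0.
  (* Leading coefficients of [a] may be killed by [f]; the truncation ends at the last one that
     survives. *)
  exists (take_poly s a); split; last by rewrite /g adjoin_mapE aE -adjoin_mapE.
  have fl : f (take_poly s a)`_s.-1 != 0.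
    by rewrite -coef_map aE -lead_coefE lead_coef_eq0.
  have st : size (take_poly s a) = s.
    apply/eqP; rewrite eqn_leq size_take_poly /=.
    rewrite -[X in (X <= _)%N]prednK; last by rewrite lt0n size_poly_eq0.
    rewrite ltnNge; apply: contraNN fl => h.
    by rewrite nth_default ?rmorph0.
  by rewrite lead_coefE st.
have pL0 : map_poly f p != 0.
  by apply: contraNneq p0 => e; rewrite /g adjoin_mapE e horner0.
(* As in Euclid's argument, [a] is coprime to [p] over L. Its inverse becomes integral after
   multiplication by a power of [p], so [a] divides a power of [p] and is a unit, although its
   degree over L is positive. *)
pose a : {poly D} := 1 + 'X * p.
have aL : map_poly f a = 1 + 'X * map_poly f p.
  by rewrite rmorphD rmorph1 rmorphM /= map_polyX.
have ga0 : g a != 0.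
  apply/eqP => /inj; rewrite aL => /(congr1 (fun q : {poly L} => q`_0)).
  by rewrite coefD coef1 coefXM /= addr0 coef0 => /eqP; rewrite oner_eq0.
have [k [F monF Fx]] := hp (g a)^-1.
rewrite -rmorphXn in Fx.
set y := p ^+ k in Fx; set N := (size F).-1.
pose G := \sum_(i < N) F`_i * y ^+ i * a ^+ (N - i.+1).
have eG : map_poly f (y ^+ N + a * G) = 0 -> False.
  move=> e; have : map_poly f a %| map_poly f p ^+ (k * N).
    rewrite exprM -rmorphXn -/y.
    apply/dvdpP; exists (- map_poly f G); rewrite -rmorphXn mulNr -rmorphM [G * a]mulrC.
    by apply/eqP; rewrite -addr_eq0 -rmorphD; apply/eqP; exact: e.
  have cop : coprimep (map_poly f a) (map_poly f p ^+ (k * N)).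
    apply: coprimep_expr; apply/Bezout_coprimepP; exists (1, - 'X) => /=.
    by rewrite aL mul1r mulNr addrK eqpxx.
  rewrite -[_ ^+ _]mulr1 (Gauss_dvdpr _ cop) dvdp1 aL => /eqP.
  rewrite addrC mulrC size_polyDl; last by rewrite size_mulX ?size_poly1 // ltnS lt0n size_poly_eq0.
  by rewrite size_mulX // => -[/eqP]; rewrite size_poly_eq0 (negPf pL0).
by case: eG; apply: inj; apply: monic_clear_denominator.
Qed.

Section ResidueField.
Variables (A : comNzRingType) (P : A -> Prop) (hP : is_maximal P).

(** The [let] keeps the proof of maximality in the term, so that the ideal and field structures can
    be inferred. *)
Definition max_pred : {pred A} := let _ := hP in fun x => `[<P x>].

Lemma max_predP x : reflect (P x) (x \in max_pred).
Proof. exact: asboolP. Qed.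

Lemma max_pred_idealr : idealr_closed max_pred.
Proof.
have [[P0 PD PM] P1 _] := hP; split; first by apply/max_predP.
  by apply/negP => /max_predP.
by move=> a x y /max_predP Px /max_predP Py; apply/max_predP; apply: PD => //; apply: PM.
Qed.

HB.instance Definition _ := isIdealr.Build A max_pred max_pred_idealr.

Definition residue : Type := {ideal_quot max_pred}.
HB.instance Definition _ := GRing.ComNzRing.on residue.

Definition residue_class : A -> residue := \pi_{ideal_quot max_pred}.
HB.instance Definition _ := GRing.RMorphism.on residue_class.

Lemma residue_surj (y : residue) : exists x, y = residue_class x.
Proof. by exists (repr (y : {ideal_quot max_pred})); rewrite /residue_class reprK. Qed.

Lemma residue_eq0 x : residue_class x = 0 <-> P x.
Proof.
have h : (residue_class x == residue_class 0) = (x - 0 \in max_pred).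
  by rewrite Quotient.idealrBE.
rewrite subr0 in h; rewrite -(rmorph0 residue_class).
split=> [/eqP|/max_predP Px]; first by rewrite h => /max_predP.
by apply/eqP; rewrite h.
Qed.

(** For x outside P, the ideal generated by P and x contains 1, and the coefficient of x there is an
    inverse. The clause for 0 fixes the conventional value of the inverse. *)
Lemma residue_inv (y : residue) : exists z, (y = 0 -> z = 0) /\ (y != 0 -> z * y = 1).
Proof.
have [->|y0] := eqVneq y 0; first by exists 0; split.
have [x yE] := residue_surj y; have [hI P1 Pmax] := hP.
have [P0 PD PM] := hI.
suff [a [p [Pp e]]] : exists a p, P p /\ 1 = p + a * x.
  exists (residue_class a); split=> [/eqP|_]; first by rewrite (negPf y0).
  rewrite yE -rmorphM -(rmorph1 residue_class).
  apply/eqP; rewrite eq_sym -subr_eq0 -rmorphB; apply/eqP/residue_eq0.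
  by rewrite e addrK.
apply: contrapT => nJ.
case/eqP: y0; rewrite yE; apply/residue_eq0.
apply: (Pmax (fun z => exists a p, P p /\ z = p + a * x)).
- split; first by exists 0, 0; rewrite mul0r addr0.
    move=> _ _ [a [p [Pp ->]]] [b [q [Pq ->]]]; exists (a + b), (p + q).
    by split; [apply: PD | rewrite mulrDl addrACA].
  move=> c _ [a [p [Pp ->]]]; exists (c * a), (c * p).
  by split; [apply: PM | rewrite mulrDr mulrA].
- exact: nJ.
- by move=> z Pz; exists 0, z; rewrite mul0r addr0.
by exists 1, 0; rewrite mul1r add0r.
Qed.

Definition residue_invf (y : residue) : residue := projT1 (cid (residue_inv y)).

Lemma residue_mulVf (y : residue) : y != 0 -> residue_invf y * y = 1.
Proof. by rewrite /residue_invf; case: cid => z []. Qed.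

Lemma residue_invf0 : residue_invf 0 = 0.
Proof. by rewrite /residue_invf; case: cid => z hz; exact: hz.1. Qed.

HB.instance Definition _ :=
  GRing.ComNzRing_isField.Build residue residue_mulVf residue_invf0.

Lemma residue_field_exists : exists (L : fieldType) (pr : {rmorphism A -> L}),
  (forall y, exists x, y = pr x) /\ forall x, pr x = 0 <-> P x.
Proof.
by exists residue, residue_class; split; [exact: residue_surj | exact: residue_eq0].
Qed.

End ResidueField.

Lemma residue_integral (K : fieldType) (n : nat) (P : {mpoly K[n]} -> Prop) x :
  is_maximal P -> exists f : {poly K}, [/\ f \is monic, (1 < size f)%N
    & P (map_poly (@mpolyC n K) f).[x]].
Proof.
move=> /residue_field_exists[L [pr [pr_surj pr_eq0]]].
pose f : {rmorphism K -> L} := pr \o @mpolyC n K.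
pose us := [seq pr 'X_i | i <- enum 'I_n].
have gen y : generated us f y.
  have [p ->] := pr_surj y.
  rewrite (mpolyE p) rmorph_sum.
  apply: (big_ind (generated us f)).
  - by rewrite -(rmorph0 f); apply: generatedC.
  - exact: generatedD.
  move=> m _; rewrite -mul_mpolyC rmorphM; apply: generatedM; first exact: (generatedC us f).
  rewrite mpolyXE_id rmorph_prod; apply: (big_ind (generated us f)).
  - by rewrite -(rmorph1 f); apply: generatedC.
  - exact: generatedM.
  move=> i _; rewrite rmorphXn; elim: (m i) => [|e IH].
    by rewrite expr0 -(rmorph1 f); apply: generatedC.
  rewrite exprS; apply: generatedM => //; apply: generated_mem.
  by apply: map_f; rewrite mem_enum.
have [s [s0 hs]] := zariski_localized gen.
(* The element [s] lies in the field K, so its power can be divided out and [pr x] itself is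
   integral. *)
have [k hk] := hs (pr x).
have [p monp px] : integralOver f (pr x).
  have -> : pr x = f (s ^- k) * (f s ^+ k * pr x).
    rewrite mulrA -rmorphXn -rmorphM mulVf ?rmorph1 ?mul1r //.
    by apply: contraNneq s0 => e; apply/eqP; move/eqP: e; rewrite expf_eq0 => /andP[_ /eqP ->]; rewrite rmorph0.
  by apply: integral_mul; [exact: integral_id | exact: hk].
exists p; split=> //.
  rewrite ltnNge; apply/negP => /size1_polyC pE; move: monp px.
  rewrite pE monicE lead_coefC => /eqP ->.
  by rewrite rmorph1 /root hornerC oner_eq0.
apply/pr_eq0; rewrite -horner_map -map_poly_comp.
exact: (rootP px).
Qed.

(** * Chains of primes and regular sequences *)

Section PrimeChains.
Variable A : comPzRingType.
Implicit Types (I J P Q : A -> Prop) (x : A).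

Definition nzd_mod I x := forall y, I (x * y) -> I y.

Lemma maximal_prime P : is_maximal P -> is_prime P.
Proof.
move=> [hP P1 Pmax]; split=> // x y Pxy; have [P0 PD PM] := hP.
have [Px|nPx] := pselect (P x); [by left | right].
pose J z := exists p a, P p /\ z = p + a * x.
have hJ : is_ideal J.
  split; first by exists 0, 0; rewrite mul0r addr0.
    move=> _ _ [p [a [Pp ->]]] [q [b [Pq ->]]]; exists (p + q), (a + b).
    by split; [apply: PD | rewrite mulrDl addrACA].
  move=> c _ [p [a [Pp ->]]]; exists (c * p), (c * a).
  by split; [apply: PM | rewrite mulrDr mulrA].
have J1 : J 1.
  apply: contrapT => nJ; case: nPx; apply: (Pmax J hJ nJ).
    by move=> z Pz; exists z, 0; rewrite mul0r addr0.
  by exists 0, 1; rewrite mul1r add0r.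
have [p [a [Pp e]]] := J1.
rewrite -[y]mul1r e mulrDl -mulrA.
by apply: PD; [rewrite mulrC|]; apply: PM.
Qed.

(** Zorn's lemma for ideals disjoint from the products s x^k with s outside Q. The ideal [I]
    qualifies since x can be cancelled modulo it; k = 0 gives containment in Q, and s = 1 excludes
    x. *)
Lemma ideal_avoiding I Q x : is_ideal I -> is_prime Q -> (forall y, I y -> Q y) ->
  nzd_mod I x ->
  exists J, [/\ is_ideal J, (forall y, I y -> J y),
    (forall s k, J (s * x ^+ k) -> Q s) &
    forall J', is_ideal J' -> (forall y, J y -> J' y) ->
      (forall s k, J' (s * x ^+ k) -> Q s) -> forall y, J' y -> J y].
Proof.
move=> hI hQ IQ xI.
pose good J := [/\ is_ideal J, (forall y, I y -> J y) & forall s k, J (s * x ^+ k) -> Q s].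
have goodI : good I.
  split=> // s k; elim: k s => [|k IH] s; first by rewrite mulr1; apply: IQ.
  by rewrite exprS mulrCA => /xI; apply: IH.
pose T := {J | good J}.
pose R (s t : T) := `[< forall y, projT1 s y -> projT1 t y >].
have [|||[J gJ] Jmax] := @classical_sets.ZL_preorder T (exist _ I goodI) R.
- by move=> t; apply/asboolP.
- by move=> r s t /asboolP rs /asboolP st; apply/asboolP => y /rs /st.
- move=> C Ctot; have [[t0 Ct0]|nC] := pselect (exists t, C t); last first.
    by exists (exist _ I goodI) => s Cs; case: nC; exists s.
  have gU : good (fun y => exists2 t : T, C t & projT1 t y).
    split.
    - split; first by exists t0 => //; case: (projT2 t0) => -[].
        move=> y z [t Ct ty] [t' Ct' tz]; case: (Ctot t t' Ct Ct') => /asboolP h.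
          exists t' => //; case: (projT2 t') => -[_ D _] _ _.
          by apply: D => //; apply: h.
        exists t => //; case: (projT2 t) => -[_ D _] _ _.
        by apply: D => //; apply: h.
      move=> a y [t Ct ty]; exists t => //; case: (projT2 t) => -[_ _ M] _ _.
      exact: M.
    - by move=> y Iy; exists t0 => //; case: (projT2 t0) => _ h _; apply: h.
    by move=> s k [t Ct]; case: (projT2 t) => _ _; apply.
  by exists (exist _ _ gU) => s Cs; apply/asboolP => y sy; exists s.
case: (gJ) => hJ IJ Jav; exists J; split=> // J' hJ' JJ' J'av.
have gJ' : good J' by split=> // y /IJ /JJ'.
by have /asboolP := Jmax (exist _ J' gJ') (introT (asboolP _) JJ').
Qed.

(* the prime comes from an ideal maximal among those avoiding the products
   s x^k with s outside Q *)
Lemma prime_below I Q x : is_ideal I -> is_prime Q -> (forall y, I y -> Q y) ->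
  nzd_mod I x ->
  exists Q', [/\ is_prime Q', (forall y, I y -> Q' y), (forall y, Q' y -> Q y) & ~ Q' x].
Proof.
move=> hI hQ IQ xI; have [J [hJ IJ Jav Jmax]] := ideal_avoiding hI hQ IQ xI.
have [hQi Q1 Qp] := hQ; have [J0 JD JM] := hJ.
have JQ y : J y -> Q y by move=> Jy; apply: (Jav y 0%N); rewrite mulr1.
(* By maximality, enlarging [J] by [a] makes it meet the set of products. *)
have key a : ~ J a -> exists s k j r, [/\ ~ Q s, J j & s * x ^+ k = j + r * a].
  move=> nJa; apply: contrapT => h; apply: nJa.
  apply: (Jmax (fun z => exists j r, J j /\ z = j + r * a)).
  - split; first by exists 0, 0; rewrite mul0r addr0.
      move=> _ _ [p [c [Jp ->]]] [q [b [Jq ->]]]; exists (p + q), (c + b).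
      by split; [apply: JD | rewrite mulrDl addrACA].
    move=> c _ [p [b [Jp ->]]]; exists (c * p), (c * b).
    by split; [apply: JM | rewrite mulrDr mulrA].
  - by move=> y Jy; exists y, 0; rewrite mul0r addr0.
  - move=> s k [j [r [Jj e]]]; apply: contrapT => nQs.
    by apply: h; exists s, k, j, r.
  by exists 0, 1; rewrite mul1r add0r.
exists J; split=> //; last first.
  by move=> Jx; apply: Q1; apply: (Jav 1 1%N); rewrite mul1r expr1.
split=> //; first by move/JQ.
move=> a b Jab; apply: contrapT => /not_orP[/key[s [k [j [r [nQs Jj e]]]]]].
move=> /key[s' [k' [j' [r' [nQs' Jj' e']]]]].
have : J ((s * s') * x ^+ (k + k')).
  have -> : s * s' * x ^+ (k + k') = (s * x ^+ k) * (s' * x ^+ k').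
    by rewrite exprD mulrACA.
  rewrite e e' mulrDl !mulrDr; apply: (JD); apply: (JD).
  - by apply: JM.
  - by rewrite mulrC; apply: JM.
  - by apply: JM.
  by rewrite mulrACA; apply: JM.
by move/Jav/Qp => [].
Qed.

Lemma regular_prime_chain xs P : is_prime P -> regular_seq xs ->
  (forall x, x \in xs -> P x) -> prime_chain P (size xs).
Proof.
move=> hP [xsreg _] xsP; set d := size xs.
pose I i : A -> Prop := ideal_gen (fun z => z \in take i xs).
have hI i : is_ideal (I i) by apply: ideal_gen_ideal.
(* The chain grows downwards from [P]: its smallest prime contains the first d - j elements, and the
   new prime below it omits the last of these. *)
suff h j : (j <= d)%N -> exists Q : nat -> A -> Prop,
    [/\ (forall i, (i <= j)%N -> is_prime (Q i)),
        (forall i, (i < j)%N -> (forall x, Q i x -> Q i.+1 x) /\ exists x, Q i.+1 x /\ ~ Q i x),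
        (forall x, Q j x <-> P x) & forall x, I (d - j)%N x -> Q 0%N x].
  by have [//|Q [h1 h2 h3 _]] := h d; exists Q.
elim: j => [|j IH] jd.
  exists (fun=> P); split=> // x; rewrite subn0.
  by case: (hP) => hPi _ _; apply: ideal_gen_sub => // y /mem_take; apply: xsP.
have [|Q [h1 h2 h3 h4]] := IH; first exact: ltnW.
have dj : (d - j = (d - j.+1).+1)%N by lia.
have dl : (d - j.+1 < size xs)%N by rewrite -/d; lia.
have IS x : I (d - j.+1)%N x -> Q 0%N x.
  move=> Ix; apply: h4; rewrite dj; apply: ideal_gen_mono Ix => y.
  by rewrite (take_nth 0) // mem_rcons inE => ->; rewrite orbT.
have [Q' [hQ' IQ' QQ' nQ']] := prime_below (hI _) (h1 0%N (leq0n _)) IS (xsreg _ dl).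
exists (fun i => if i is i'.+1 then Q i' else Q'); split=> //.
- by case.
- case=> [|i] hi; last exact: h2.
  split=> //; exists xs`_(d - j.+1); split=> //; apply: h4; rewrite dj.
  by apply: ideal_gen_mem; rewrite (take_nth 0) // mem_rcons mem_head.
Qed.

Definition nzd_chain (I : nat -> A -> Prop) (y : nat -> A) d :=
  [/\ (forall i, (i <= d)%N -> is_ideal (I i)),
      (forall i, (i < d)%N -> [/\ (forall x, I i x -> I i.+1 x), I i.+1 (y i)
                              & nzd_mod (I i) (y i)])
    & ~ I d 1].

Lemma nzd_chain_take (I : nat -> A -> Prop) (y : nat -> A) d e : (e <= d)%N ->
  nzd_chain I y d -> nzd_chain I y e.
Proof.
move=> ed [h1 h2 h3]; split=> [i ie|i ie|]; first exact: h1 (leq_trans ie ed).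
  exact: h2 (leq_trans ie ed).
suff h j : (e + j <= d)%N -> I e 1 -> I (e + j)%N 1.
  by move=> e1; apply: h3; rewrite -(subnKC ed); apply: h e1; rewrite subnKC.
elim: j => [|j IH] jd; first by rewrite addn0.
rewrite addnS in jd *; move=> /(IH (ltnW jd)); by case: (h2 _ jd) => h _ _; apply: h.
Qed.

Lemma prime_chain_nzd P d : is_prime P -> prime_chain P d ->
  exists (I : nat -> A -> Prop) y, nzd_chain I y d.
Proof.
move=> [_ P1 _] [Q [h1 h2 h3]].
have /choice[y yP] i : exists x, (i < d)%N -> Q i.+1 x /\ ~ Q i x.
  have [id|id] := ltnP i d; last by exists 0.
  by have [_ [x hx]] := h2 i id; exists x.
exists Q, y; split=> [i /h1[]//|i id|]; last by move/h3.
have [Qy nQy] := yP i id; split=> //; first by case: (h2 i id).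
by have [_ _ hp] := h1 i (ltnW id); move=> z /hp[].
Qed.

Lemma regular_seq_nzd xs : regular_seq xs ->
  nzd_chain (fun i => ideal_gen (fun z => z \in take i xs)) (fun i => xs`_i) (size xs).
Proof.
move=> [xsreg xs1]; split=> [i _|i ilt|]; last by rewrite take_size.
  exact: ideal_gen_ideal.
split; last exact: xsreg.
  by move=> x; apply: ideal_gen_mono => z; rewrite (take_nth 0) // mem_rcons inE => ->; rewrite orbT.
by apply: ideal_gen_mem; rewrite (take_nth 0) // mem_rcons mem_head.
Qed.

End PrimeChains.

Section PullBack.
Variables (A B : comPzRingType) (f : {rmorphism A -> B}).
Hypothesis f_surj : forall y, exists x, y = f x.

Lemma nzd_chain_pullback (I : nat -> B -> Prop) y d : nzd_chain I y d ->
  exists y', nzd_chain (fun i x => I i (f x)) y' d.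
Proof.
move=> [h1 h2 h3]; have /choice[y' y'E] i := f_surj (y i).
exists y'; split=> [i id|i id|]; last by rewrite rmorph1.
  exact: preim_ideal (h1 i id).
have [Is Iy In] := h2 i id; split=> [x|/=|x /=]; first exact: Is.
  by rewrite -y'E.
by rewrite rmorphM -y'E; apply: In.
Qed.

Lemma maximal_pullback P : is_maximal P -> is_maximal (fun x => P (f x)).
Proof.
move=> [hP P1 Pmax]; have [P0 PD PM] := hP.
split; [exact: preim_ideal | by rewrite rmorph1 |].
move=> J hJ J1 PJ x Jx; have [J0 JD JM] := hJ.
apply: (Pmax (fun y => exists2 z, J z & y = f z)); last by exists x.
- split; first by exists 0; rewrite ?rmorph0.
    by move=> _ _ [a Ja ->] [b Jb ->]; exists (a + b); [apply: JD | rewrite rmorphD].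
  move=> c _ [a Ja ->]; have [c' ->] := f_surj c.
  by exists (c' * a); [apply: JM | rewrite rmorphM].
- move=> [z Jz e]; apply: J1; rewrite -(subrK z 1); apply: JD => //.
  by apply: PJ; rewrite rmorphB rmorph1 -e subrr.
by move=> y Py; have [z e] := f_surj y; exists z => //; apply: PJ; rewrite -e.
Qed.

End PullBack.

(** * Growth of linearly independent families along a chain of ideals *)

Section Independence.
Variables (K : fieldType) (n : nat).
Local Notation R := {mpoly K[n]}.
Implicit Types (I J : R -> Prop) (s t : seq R).

Definition indep_mod I s := forall c : nat -> K,
  I (\sum_(i < size s) c i *: s`_i) -> forall i, (i < size s)%N -> c i = 0.

(** Modulo [J] the multiples of [y] disappear, so the coefficients on [s] vanish; then [y] is
    cancelled modulo [I]. *)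
Lemma indep_mod_cat I J y s t : is_ideal I -> is_ideal J -> (forall x, I x -> J x) ->
  J y -> nzd_mod I y -> indep_mod J s -> indep_mod I t ->
  indep_mod I (s ++ [seq y * z | z <- t]).
Proof.
move=> hI hJ IJ Jy yI hs ht c; have [J0 JD JM] := hJ.
rewrite size_cat size_map big_split_ord /=.
have -> : \sum_(i < size s) c i *: (s ++ [seq y * z | z <- t])`_i = \sum_(i < size s) c i *: s`_i.
  by apply: eq_bigr => i _; rewrite nth_cat ltn_ord.
have -> : \sum_(i < size t) c (size s + i)%N *: (s ++ [seq y * z | z <- t])`_(size s + i)
    = y * \sum_(i < size t) c (size s + i)%N *: t`_i.
  rewrite mulr_sumr; apply: eq_bigr => i _.
  rewrite nth_cat ltnNge leq_addr /= addKn (nth_map 0) // -scalerAr //.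
set X := \sum_(i < size s) _; set Y := \sum_(i < size t) _ => IXY.
have JX : J X.
  rewrite -(addrK (y * Y) X); apply: idealB => //; first exact: IJ.
  by rewrite mulrC; apply: JM.
have cs i : (i < size s)%N -> c i = 0 by apply: hs JX i.
have X0 : X = 0 by rewrite /X big1 // => i _; rewrite cs ?scale0r.
have IY : I Y by apply: yI; rewrite X0 add0r in IXY.
move=> i ilt; have [/cs//|si] := ltnP i (size s).
rewrite -(subnKC si); apply: (ht (fun j => c (size s + j)%N)) => //.
by rewrite ltn_subLR.
Qed.

Definition deg_le D (p : R) := forall m, m \in msupp p -> (mdeg m <= D)%N.

Lemma deg_leM D E p q : deg_le D p -> deg_le E q -> deg_le (D + E) (p * q).
Proof.
move=> hp hq m /msuppM_le/allpairsP[[a b] /= [/hp ha /hq hb ->]].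
by rewrite mdegD leq_add.
Qed.

Lemma deg_leW D E p : (D <= E)%N -> deg_le D p -> deg_le E p.
Proof. by move=> DE hp m /hp /leq_trans; apply. Qed.

(** The family consists of the products of the elements of [s] with y^j, j < k. *)
Lemma indep_mod_powers I J y s k D e : is_ideal I -> is_ideal J ->
  (forall x, I x -> J x) -> J y -> nzd_mod I y -> indep_mod J s ->
  deg_le e y -> (forall p, p \in s -> deg_le D p) ->
  exists t, [/\ indep_mod I t, size t = (k * size s)%N
    & forall p, p \in t -> deg_le (D + k * e) p].
Proof.
move=> hI hJ IJ Jy yI hs ye sD; elim: k => [|k [t [ht szt tD]]].
  by exists [::]; split=> //; move=> c _ i.
exists (s ++ [seq y * z | z <- t]); split.
- exact: (indep_mod_cat hI hJ IJ Jy yI hs ht).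
- by rewrite size_cat size_map szt mulSn.
move=> p; rewrite mem_cat => /orP[/sD|/mapP[q /tD qD ->]].
  by apply: deg_leW; rewrite leq_addr.
by apply: deg_leW (deg_leM ye qD); rewrite mulSn addnCA.
Qed.

Lemma nzd_chain_indep (I : nat -> R -> Prop) y d : nzd_chain I y d ->
  exists e, forall k, exists s, [/\ indep_mod (I 0%N) s, size s = (k ^ d)%N
    & forall p, p \in s -> deg_le (d * (k * e)) p].
Proof.
move=> [h1 h2 h3]; pose e := \max_(i < d) msize (y i).
exists e => k.
suff h j : (j <= d)%N -> exists s, [/\ indep_mod (I (d - j)%N) s, size s = (k ^ j)%N
    & forall p, p \in s -> deg_le (j * (k * e)) p].
  by have := h d (leqnn d); rewrite subnn.
elim: j => [|j IH] jd.
  exists [:: 1]; rewrite subn0; split=> //; last first.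
    by move=> p; rewrite inE => /eqP -> m; rewrite msupp1 inE => /eqP ->; rewrite mdeg0.
  move=> c; rewrite big_ord1 /= => Ic [|//] _.
  apply: contrapT => /eqP c0; apply: h3; have [_ _ IM] := h1 d (leqnn d).
  by have := IM ((c 0%N)^-1)%:MP _ Ic; rewrite mul_mpolyC scalerA mulVf // scale1r.
have [|s [hs szs sD]] := IH; first exact: ltnW.
have dj : (d - j = (d - j.+1).+1)%N by lia.
have hlt : (d - j.+1 < d)%N by lia.
have [Is Iy yn] := h2 _ hlt; rewrite dj in hs.
have ye : deg_le e (y (d - j.+1)%N).
  move=> m /msize_mdeg_lt /ltnW /leq_trans; apply.
  exact: (leq_bigmax (Ordinal hlt)).
have [t [ht szt tD]] := indep_mod_powers k (h1 _ (ltnW hlt)) (h1 _ hlt) Is Iy yn hs ye sD.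
exists t; split=> //; first by rewrite szt szs expnS.
by move=> p /tD; apply: deg_leW; rewrite mulSn addnC.
Qed.

(** If the |T| functionals detect membership in [I] on the span of [s], their values on [s] form a
    matrix of full row rank. *)
Lemma indep_mod_size I s (T : finType) (P : T -> pred 'X_{1..n}) :
  indep_mod I s ->
  (forall c : nat -> K, (forall t : T, msum (P t) (\sum_(i < size s) c i *: s`_i) = 0) ->
     I (\sum_(i < size s) c i *: s`_i)) ->
  (size s <= #|T|)%N.
Proof.
move=> hs hI.
pose M : 'M[K]_(size s, #|T|) := \matrix_(i, b) msum (P (enum_val b)) s`_i.
suff : row_free M by rewrite /row_free => /eqP <-; apply: rank_leq_col.
rewrite -kermx_eq0; apply/eqP/row_matrixP => i; rewrite row0.
set v := row i _; have vM : v *m M = 0 by rewrite -row_mul mulmx_ker row0.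
pose c j := if insub j is Some j' then v 0 j' else 0.
have cE (j : 'I_(size s)) : c j = v 0 j by rewrite /c valK.
have c0 := hs c (hI c _); apply/rowP => j; rewrite -cE c0 ?mxE // => t.
rewrite raddf_sum; have /matrixP/(_ 0 (enum_rank t)) := vM; rewrite mxE [RHS]mxE => vt; rewrite -[RHS]vt.
apply: eq_bigr => l _; rewrite cE [M _ _]mxE enum_rankK; exact: msumZ.
Qed.

End Independence.

Lemma ideal_gen_cons (A : comPzRingType) (x : A) xs y :
  ideal_gen (fun z => z \in x :: xs) y ->
  exists c z, y = c * x + z /\ ideal_gen (fun z => z \in xs) z.
Proof.
move: y; apply: ideal_gen_ind.
- by exists 0, 0; split; [rewrite mul0r addr0 | exact: ideal_gen0].
- move=> _ _ [c [z [-> hz]]] [c' [z' [-> hz']]]; exists (c + c'), (z + z'); split.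
    by rewrite mulrDl addrACA.
  exact: ideal_genD.
move=> a e; rewrite inE => /orP[/eqP ->|he].
  by exists a, 0; split; [rewrite addr0 | exact: ideal_gen0].
exists 0, (a * e); split; first by rewrite mul0r add0r.
by apply: ideal_genMl; apply: ideal_gen_mem.
Qed.

Lemma ideal_gen_nil (A : comPzRingType) (y : A) :
  ideal_gen (fun z => z \in [::]) y -> y = 0.
Proof.
by move: y; apply: ideal_gen_ind => // x y -> ->; rewrite addr0.
Qed.

(** * Regular sequences of monic polynomials in distinct variables *)

Section Univariate.
Variables (K : fieldType) (n : nat).
Local Notation R := {mpoly K[n]}.
Implicit Types (k j : 'I_n) (f : {poly K}) (p q g : R).

Definition uni k f : R := (map_poly (@mpolyC n K) f).['X_k].

(** The sign puts f(X_k) into the form X_k^d - Theta of the division lemmas, with 1 x 1 matrices. *)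
Let tail k f : R := - \sum_(i < (size f).-1) (f`_i)%:MP * 'X_k ^+ i.

Lemma uniE k f : f \is monic -> uni k f = 'X_k ^+ (size f).-1 - tail k f.
Proof.
move=> fm; have sf : size f = (size f).-1.+1 by rewrite prednK // lt0n size_poly_eq0 monic_neq0.
rewrite /uni horner_coef size_map_poly_id0 ?(monicP fm) ?mpolyC1 ?oner_neq0 //.
rewrite sf big_ord_recr /= coef_map /= -lead_coefE (monicP fm) mpolyC1 mul1r addrC opprK.
by congr (_ + _); apply: eq_bigr => i _; rewrite coef_map.
Qed.

Lemma xdeg_ltC_X k j d c i : (i * (k == j) < d)%N -> xdeg_lt j d (c%:MP * 'X_k ^+ i : R).
Proof.
move=> h; rewrite mul_mpolyC mpolyXn => m /msuppZ_le; rewrite msuppX inE => /eqP ->.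
by rewrite mulmnE mnm1E mulnC.
Qed.

Lemma tail_xdeg k f : xdeg_lt k (size f).-1 (tail k f).
Proof.
apply: xdeg_ltN; apply: xdeg_lt_sum => i _; apply: xdeg_ltC_X.
by rewrite eqxx muln1.
Qed.

Lemma tail_free k f j : j != k -> xdeg_lt j 1 (tail k f).
Proof.
move=> jk; apply: xdeg_ltN; apply: xdeg_lt_sum => i _; apply: xdeg_ltC_X.
by rewrite eq_sym (negPf jk) muln0.
Qed.

Lemma uni_free k f j : f \is monic -> j != k -> xdeg_lt j 1 (uni k f).
Proof.
move=> fm jk; rewrite uniE //; apply: xdeg_ltB; last exact: tail_free.
rewrite -[_ ^+ _]mul1r -(@mpolyC1 n K); apply: xdeg_ltC_X.
by rewrite eq_sym (negPf jk) muln0.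
Qed.

Lemma uni_div k f p : f \is monic -> exists q rho,
  [/\ p = q * uni k f + rho, xdeg_lt k (size f).-1 rho &
      forall j, j != k -> xdeg_lt j 1 p -> xdeg_lt j 1 q /\ xdeg_lt j 1 rho].
Proof.
move=> fm; have hT : mxdeg_lt k (size f).-1 ((tail k f)%:M : 'M_1).
  by move=> i j; rewrite !ord1 mxE eqxx; apply: tail_xdeg.
have [q [rho [e hr hf]]] := divmx_exists hT (p%:M : 'M_1).
exists (q 0 0), (rho 0 0); split.
- have /matrixP/(_ 0 0) := e; rewrite -raddfB -uniE // mul_mx_scalar !mxE eqxx.
  by rewrite mulr1n mulrC.
- exact: hr.
move=> j jk jp; have [||hq hrho] := hf j jk.
- by move=> i l; rewrite !ord1 mxE eqxx; apply: tail_free.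
- by move=> i l; rewrite !ord1 mxE eqxx.
by split.
Qed.

Lemma uni_mul_eq0 k f q : f \is monic -> xdeg_lt k (size f).-1 (q * uni k f) -> q = 0.
Proof.
move=> fm hq; have hT : mxdeg_lt k (size f).-1 ((tail k f)%:M : 'M_1).
  by move=> i j; rewrite !ord1 mxE eqxx; apply: tail_xdeg.
have := @divmx_unique _ _ _ _ _ _ hT (q%:M : 'M_1) _.
rewrite -raddfB -uniE // => /(_ _)/matrixP/(_ 0 0); rewrite !mxE eqxx mulr1n; apply.
by move=> i j; rewrite !ord1 mul_mx_scalar !mxE eqxx mulr1n mulrC.
Qed.

Lemma uni_neq0 k f : f \is monic -> uni k f != 0.
Proof.
move=> fm; apply/eqP => e; have := @uni_mul_eq0 k f 1 fm.
rewrite e mulr0 => /(_ (@xdeg_lt0 _ _ _ _)) /eqP; by rewrite oner_eq0.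
Qed.

(** Dividing the coefficients of the generators suffices: the generators are free of X_k, so they
    leave the remainders reduced. *)
Lemma ideal_uni_div k f E y : f \is monic -> (forall e, E e -> xdeg_lt k 1 e) ->
  ideal_gen E y -> exists q rho, [/\ y = q * uni k f + rho, ideal_gen E q, ideal_gen E rho
    & xdeg_lt k (size f).-1 rho].
Proof.
move=> fm hE; move: y; apply: ideal_gen_ind.
- exists 0, 0; split; rewrite ?mul0r ?addr0 //; try exact: ideal_gen0.
  exact: xdeg_lt0.
- move=> _ _ [q [s [-> Eq Es hs]]] [q' [s' [-> Eq' Es' hs']]].
  exists (q + q'), (s + s'); split; last exact: xdeg_ltD.
  - by rewrite mulrDl addrACA.
  - exact: ideal_genD.
  - exact: ideal_genD.
move=> a e Ee; have [q [s [-> hs _]]] := uni_div k a fm.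
exists (q * e), (s * e); split.
- by rewrite mulrDl mulrAC.
- by apply: ideal_genMl; apply: ideal_gen_mem.
- by apply: ideal_genMl; apply: ideal_gen_mem.
by apply: xdeg_ltW (xdeg_ltM hs (hE _ Ee)); lia.
Qed.

Definition unis (ks : seq ('I_n * {poly K})) := [seq uni kf.1 kf.2 | kf <- ks].

Lemma unis_regular ks g p : all (fun kf => kf.2 \is monic) ks -> uniq (unzip1 ks) ->
  g != 0 -> (forall k, k \in unzip1 ks -> xdeg_lt k 1 g) ->
  ideal_gen (fun z => z \in unis ks) (g * p) -> ideal_gen (fun z => z \in unis ks) p.
Proof.
move=> hm hu g0; elim: ks hm hu p => [_ _ p _ /ideal_gen_nil|[k f] ks IH] /=.
  by move/eqP; rewrite mulf_eq0 (negPf g0) /= => /eqP ->; apply: ideal_gen0.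
move=> /andP[fm hm] /andP[kks hu] p hg /ideal_gen_cons[c [y [e Iy]]].
have Ek z : z \in unis ks -> xdeg_lt k 1 z.
  move=> /mapP[[j f'] jks ->]; apply: uni_free; first exact: (allP hm _ jks).
  by apply: contraNneq kks => ->; apply: map_f jks.
have [q [rho [pE hrho _]]] := uni_div k p fm.
have [q' [rho' [yE _ Irho' hrho']]] := ideal_uni_div fm Ek Iy.
have e0 : (c + q' - g * q) * uni k f = g * rho - rho'.
  rewrite pE yE in e; apply/eqP; rewrite -subr_eq0; apply/eqP.
  transitivity (c * uni k f + (q' * uni k f + rho') - g * (q * uni k f + rho)).
    by ring.
  by rewrite -e subrr.
have gk : xdeg_lt k 1 g by apply: hg; rewrite inE eqxx.
(* Both sides of [g * p = c * uni k f + y] are reduced modulo [uni k f]; uniqueness equates the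
   quotients and leaves [g * rho = rho'] in the ideal of the other polynomials. *)
have d0 : c + q' - g * q = 0.
  apply: (@uni_mul_eq0 k f _ fm); rewrite e0; apply: xdeg_ltB hrho'.
  by apply: xdeg_ltW (xdeg_ltM gk hrho); lia.
have Irho : ideal_gen (fun z => z \in unis ks) rho.
  apply: IH => // [j jks|]; first by apply: hg; rewrite inE jks orbT.
  by move/eqP: e0; rewrite d0 mul0r eq_sym subr_eq0 => /eqP ->.
rewrite pE; apply: ideal_genD.
  by apply: ideal_genMl; apply: ideal_gen_mem; rewrite inE eqxx.
by apply: ideal_gen_mono Irho => z; rewrite inE => ->; rewrite orbT.
Qed.

End Univariate.

Section ModelRegular.
Variables (K : fieldType) (n r : nat) (A : comPzRingType) (pr : {rmorphism {mpoly K[n]} -> A}).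
Local Notation R := {mpoly K[n]}.
Variables (X : seq 'I_n) (b : 'I_r -> restrict pr).
Hypothesis free_gen : forall y : restrict pr, exists w : 'rV[R]_r,
  (forall x, x \in X -> mxdeg_lt x 1 w) /\ y = \sum_l w 0 l *: b l.
Hypothesis b_inj : forall u : 'rV[R]_r, (forall x, x \in X -> mxdeg_lt x 1 u) ->
  \sum_l u 0 l *: b l = 0 -> u = 0.

Lemma ideal_unis_model ks (y : A) : all (fun kf => kf.2 \is monic) ks ->
  (forall k, k \in unzip1 ks -> k \notin X) ->
  ideal_gen (fun z => z \in map pr (unis ks)) y -> exists w : 'rV[R]_r,
  [/\ (forall x, x \in X -> mxdeg_lt x 1 w), (y : restrict pr) = \sum_l w 0 l *: b l
    & forall l, ideal_gen (fun z => z \in unis ks) (w 0 l)].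
Proof.
move=> hm hX; move: y; apply: ideal_gen_ind.
- exists 0; split; first by move=> x _ i j; rewrite mxE; apply: xdeg_lt0.
    by rewrite big1 // => l _; rewrite mxE scale0r.
  by move=> l; rewrite mxE; apply: ideal_gen0.
- move=> y z [w [h1 h2 h3]] [w' [h1' h2' h3']]; exists (w + w'); split.
  + by move=> x xX; apply: mxdeg_ltD; [apply: h1 | apply: h1'].
  + transitivity ((y : restrict pr) + (z : restrict pr)); first by [].
    rewrite h2 h2' -big_split /=; apply: eq_bigr => l _.
    by rewrite mxE scalerDl.
  by move=> l; rewrite mxE; apply: ideal_genD.
move=> a _ /mapP[u /mapP[[k f] kks ->] ->].
have [w [hw aE]] := free_gen a; exists (uni k f *: w); split.
- move=> x xX i j; rewrite mxE; apply: (@xdeg_ltM _ _ x 1 1 _ _ _ (hw x xX i j)).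
  apply: uni_free; first exact: (allP hm _ kks).
  by apply: contraTneq xX => ->; apply: hX; apply: map_f kks.
- transitivity (uni k f *: (a : restrict pr)).
    by rewrite -[LHS]/(a * pr (uni k f)) mulrC.
  by rewrite aE scaler_sumr; apply: eq_bigr => l _; rewrite mxE scalerA.
by move=> l; rewrite mxE mulrC; apply: ideal_genMl; apply: ideal_gen_mem; exact: (map_f (fun kf => uni kf.1 kf.2) kks).
Qed.

(** The polynomials are free of [X], so multiplication by them acts coordinatewise on the basis [b],
    and the claim reduces to [unis_regular] in each coordinate. *)
Lemma model_regular ks (y : A) k f : all (fun kf => kf.2 \is monic) ((k, f) :: ks) ->
  uniq (k :: unzip1 ks) -> (forall j, j \in k :: unzip1 ks -> j \notin X) ->
  ideal_gen (fun z => z \in map pr (unis ks)) (pr (uni k f) * y) ->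
  ideal_gen (fun z => z \in map pr (unis ks)) y.
Proof.
move=> /= /andP[fm hm] /andP[kks hu] hX Iy.
have hX' j : j \in unzip1 ks -> j \notin X by move=> h; apply: hX; rewrite inE h orbT.
have [w [hw wE Iw]] := ideal_unis_model hm hX' Iy.
have [a [ha yE]] := free_gen y.
have aw : uni k f *: a = w.
  apply/eqP; rewrite -subr_eq0; apply/eqP; apply: b_inj.
    move=> x xX; apply: mxdeg_ltB; last exact: hw.
    move=> i j; rewrite mxE; apply: (@xdeg_ltM _ _ x 1 1 _ _ _ (ha x xX i j)).
    apply: uni_free => //; apply: contraTneq xX => ->.
    by apply: hX; rewrite inE eqxx.
  transitivity (\sum_l (uni k f *: a) 0 l *: b l - \sum_l w 0 l *: b l).
    by rewrite -sumrB; apply: eq_bigr => l _; rewrite -scalerBl !mxE.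
  apply/eqP; rewrite subr_eq0; apply/eqP; rewrite -wE.
  transitivity (uni k f *: (y : restrict pr)); last by [].
  by rewrite yE scaler_sumr; apply: eq_bigr => l _; rewrite mxE scalerA.
have Ia l : ideal_gen (fun z => z \in unis ks) (a 0 l).
  apply: (@unis_regular _ _ _ (uni k f)) => //.
  - exact: uni_neq0.
  - move=> j jks; apply: uni_free => //.
    by apply: contraTneq jks => ->.
  by have := Iw l; rewrite -aw mxE.
have -> : y = \sum_l pr (a 0 l) * (b l : A) by exact: yE.
apply: ideal_sum; first exact: ideal_gen_ideal.
move=> l _; rewrite mulrC; apply: ideal_genMl; move: (a 0 l) (Ia l).
apply: ideal_gen_ind; first by rewrite rmorph0; apply: ideal_gen0.
  by move=> p q hp hq; rewrite rmorphD; apply: ideal_genD.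
move=> c e he; rewrite rmorphM; apply: ideal_genMl; apply: ideal_gen_mem.
exact: map_f.
Qed.

End ModelRegular.

(** * Depth and height of the maximal ideals *)

Section JoinCM.
Variables (K : fieldType) (k h n1 n2 : nat) (a1 d1 a2 d2 : 'X_{1..k}).
Hypotheses (hh : (0 < h)%N) (hn1 : (1 < n1)%N) (hn2 : (1 < n2)%N).
Hypothesis hind : lin_indep_Q [tuple a1; d1; a2; d2].

Local Notation N := (n1.+1 + n2.+1)%N.
Local Notation S := (join_gens h n1 n2 a1 d1 a2 d2).
Local Notation gam := (wdeg (tnth S)).
Local Notation R := {mpoly K[N]}.
Local Notation X := (join_X n1 n2).
Local Notation r := #|join_basis n1 n2|.
Local Notation gpr := (@gr_pres K k N S).
Local Notation v1 := (@lshift n1.+1 n2.+1).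
Local Notation v2 := (@rshift n1.+1 n2.+1).
Local Notation gG := (@jgen n1 n2 K _ gpr).
Local Notation G := (gr (sgring_max K S)).

Let gr_rel := jgen_rel (strict := true) hh hn1 hn2 hind
  (@gr_pr_rel K k h n1 n2 a1 d1 a2 d2) (fun _ => @gr_pr_dead K k h n1 n2 a1 d1 a2 d2).
Let gr_inj := jgen_inj (strict := true) hh hind (@gr_pr_ker K k h n1 n2 a1 d1 a2 d2).

Lemma gr_free_gen (y : restrict gpr) : exists w : 'rV[R]_r,
  (forall x, x \in X -> mxdeg_lt x 1 w) /\ y = \sum_l w 0 l *: gG l.
Proof.
have [q yE] := gr_pres_surj y.
pose l0 : 'I_r := enum_rank (jzero hn1 hn2).
pose u : 'rV[R]_r := q *: delta_mx 0 l0.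
have [w [hw e]] := model_free_gen (@join_X_uniq n1 n2) (fun x => @jxi_out h n1 n2 K true x)
  (fun x y => @jxi_free h n1 n2 K true x y)
  gr_rel gr_inj u.
exists w; split=> //; rewrite -e sum_jgen (bigD1 l0) //= big1 ?addr0.
  by rewrite !mxE !eqxx mulr1 enum_rankK bmon_jzero mpolyX0 mulr1.
by move=> l ll0; rewrite !mxE eqxx (negPf ll0) mulr0 mul0r.
Qed.

Lemma wsum_le n (v : 'I_n.+1 -> 'I_N) (f : nat -> nat) c m : (forall i : 'I_n.+1, (f i <= c)%N) ->
  (wsum v f m <= c * wsum v (fun=> 1%N) m)%N.
Proof.
move=> fc; rewrite /wsum big_distrr; apply: leq_sum => i _ /=.
by rewrite mul1n leq_mul2r fc orbT.
Qed.

Lemma wsum_bound c D m : (h <= c)%N -> (n1 <= c)%N -> (n2 <= c)%N -> (mdeg m <= D)%N ->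
  [/\ wsum v1 (wA h) m < (c * D).+1, wsum v1 id m < (c * D).+1,
      wsum v2 (wA h) m < (c * D).+1 & wsum v2 id m < (c * D).+1]%N.
Proof.
move=> hc n1c n2c; rewrite mdeg_join1 => mD.
have cA i : (wA h i <= c)%N.
  by rewrite /wA; case: ifP => // _; apply: leq_trans hc.
have b1 (f : nat -> nat) : (forall i : 'I_n1.+1, (f i <= c)%N) -> (wsum v1 f m < (c * D).+1)%N.
  move=> /(wsum_le v1 m) h1; rewrite ltnS; apply: leq_trans h1 _.
  by rewrite leq_mul2l; apply/orP; right; lia.
have b2 (f : nat -> nat) : (forall i : 'I_n2.+1, (f i <= c)%N) -> (wsum v2 f m < (c * D).+1)%N.
  move=> /(wsum_le v2 m) h1; rewrite ltnS; apply: leq_trans h1 _.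
  by rewrite leq_mul2l; apply/orP; right; lia.
split; [apply: b1 | apply: b1 | apply: b2 | apply: b2] => i //.
  by apply: leq_trans n1c; rewrite -ltnS.
by apply: leq_trans n2c; rewrite -ltnS.
Qed.

(** The monomials of maximal degree in the fibre with coordinates [t]; only such monomials have
    nonzero classes in the graded ring. *)
Definition max_key q (t : 'I_q * 'I_q * 'I_q * 'I_q) : pred 'X_{1..N} := fun m =>
  [&& wsum v1 (wA h) m == t.1.1.1, wsum v1 id m == t.1.1.2,
      wsum v2 (wA h) m == t.1.2, wsum v2 id m == t.2
    & `[< forall m', gam m' = gam m -> (mdeg m' <= mdeg m)%N >]].

(** In degree at most D the coordinates are at most c D, so (c D + 1)^4 functionals decide
    membership in the kernel. If g is not a sum of more than i generators, the monomials of degree i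
    over g are the maximal ones. *)
Lemma gr_pres_eq0_keys c D p : (h <= c)%N -> (n1 <= c)%N -> (n2 <= c)%N -> deg_le D p ->
  (forall t, msum (@max_key (c * D).+1 t) p = 0) -> gpr p = 0.
Proof.
move=> hc n1c n2c pD p0; apply/gr_pres_eq0 => i g ng.
have mx m : gam m = g -> (mdeg m <= i)%N.
  by move=> e; rewrite leqNgt; apply/negP => lt; apply: ng; exists m.
have [[m0 [m0p e0 i0]]|no] := pselect (exists m0, [/\ m0 \in msupp p, gam m0 = g & mdeg m0 = i]);
  last first.
  apply: msum_pred0 => m mp; apply/negP => /andP[/eqP e /eqP ei].
  by apply: no; exists m.
have [b1 b2 b3 b4] := wsum_bound hc n1c n2c (pD _ m0p).
rewrite -[RHS](p0 (Ordinal b1, Ordinal b2, Ordinal b3, Ordinal b4)).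
apply: eq_msum => m mp; rewrite /max_key /=; apply/andP/and5P.
  move=> [/eqP e /eqP ei]; have /(gam_key h hind)[k1 k2 k3 k4] : gam m = gam m0 by rewrite e0.
  by split; [apply/eqP | apply/eqP | apply/eqP | apply/eqP
     | apply/asboolP => m'; rewrite e ei; apply: mx].
move=> [/eqP k1 /eqP k2 /eqP k3 /eqP k4 /asboolP mm].
have e : gam m = gam m0 by apply/(gam_key h hind).
split; first by rewrite e e0.
by rewrite eqn_leq mx ?e //= -i0; apply: mm.
Qed.

Lemma gr_nzd_chain_le (I : nat -> G -> Prop) y d : nzd_chain I y d -> (d <= 4)%N.
Proof.
rewrite leqNgt => hI; apply/negP => d4.
have [y' hc] := nzd_chain_pullback (@gr_pres_surj K k N S) (nzd_chain_take d4 hI).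
have [e he] := nzd_chain_indep hc.
pose c := (h + n1 + n2)%N; pose C := (c * 5 * e).+1.
(* With q = C^4 + 1 there are q^5 independent elements of degree at most D = 5 q e, but at most (c D
   + 1)^4 <= (C q)^4 < q^5 are possible. *)
have [s [hs szs sD]] := he (C ^ 4).+1.
set q := (C ^ 4).+1 in szs sD; set D := (5 * (q * e))%N in sD.
have : (q ^ 5 <= (c * D).+1 ^ 4)%N.
  have -> : ((c * D).+1 ^ 4 = #|{: 'I_(c * D).+1 * 'I_(c * D).+1 * 'I_(c * D).+1 * 'I_(c * D).+1}|)%N.
    by rewrite !card_prod !card_ord !expnSr expn0 mul1n.
  rewrite -szs; apply: (indep_mod_size (P := @max_key (c * D).+1) hs) => b hb.
  have [I0 _ _] := hI; have [i0 _ _] := I0 0%N (leq0n _).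
  suff e0 : gpr (\sum_(i < size s) b i *: s`_i) = 0.
    by move: i0; rewrite -e0.
  apply: (@gr_pres_eq0_keys c D) hb; try (rewrite /c; lia).
  move=> m /msupp_sum_le /flattenP[u /mapP[i _ ->]] /msuppZ_le.
  by apply: sD; apply: mem_nth.
apply/negP; rewrite -ltnNge; have q0 : (0 < q)%N by [].
have le : ((c * D).+1 <= C * q)%N by rewrite /C /D; nia.
apply: (@leq_ltn_trans ((C * q) ^ 4)); first by rewrite leq_exp2r.
by rewrite expnMn [in X in (_ < X)%N]expnS ltn_pmul2r // expn_gt0 q0.
Qed.

Local Notation Z := [:: v1 ord0; v1 ord_max; v2 ord0; v2 ord_max].

Lemma join_Z_uniq : uniq Z.
Proof.
have n10 : v1 ord0 != v1 ord_max by rewrite (inj_eq (@lshift_inj _ _)) -val_eqE /=; lia.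
have n20 : v2 ord0 != v2 ord_max by rewrite (inj_eq (@rshift_inj _ _)) -val_eqE /=; lia.
by rewrite /= !inE (negPf n10) (negPf n20) !eq_lrshift.
Qed.

Lemma join_Z_free x : x \in Z -> x \notin X.
Proof.
by rewrite !inE => /or4P[] /eqP ->; rewrite ?mem_join_X1 ?mem_join_X2 //= ltnn andbF.
Qed.

Lemma gr_regular_seq (P : G -> Prop) : is_maximal P ->
  exists xs, [/\ regular_seq xs, (forall x, x \in xs -> P x) & size xs = 4].
Proof.
move=> hP; have hP' := maximal_pullback (@gr_pres_surj K k N S) hP.
(* The preimage of [P] in the polynomial ring is maximal, so Zariski's lemma supplies the monic
   polynomials there. *)
have /choice[f fP] x := residue_integral ('X_x : R) hP'.
pose ks := [seq (x, f x) | x <- Z].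
have ksm : all (fun kf => kf.2 \is monic) ks by apply/allP => _ /mapP[x _ ->]; case: (fP x).
have xsP x : x \in map gpr (unis ks) -> P x.
  by move=> /mapP[_ /mapP[_ /mapP[z _ ->] ->] ->]; case: (fP z).
exists (map gpr (unis ks)); split=> //; split; last first.
  by case: (hP) => hI P1 _ /ideal_gen_sub h1; apply: P1; apply: h1.
move=> i ilt y; rewrite !size_map in ilt.
pose kf := nth (v1 ord0, 0) ks i.
have ilt' : (i < size ks)%N by rewrite size_map.
rewrite -map_take -[take i (unis _)]map_take -/(unis _).
rewrite (nth_map 0) ?size_map // (nth_map (v1 ord0, 0)) // -/kf.
have eZ j : unzip1 (take j ks) = take j Z by rewrite [unzip1 _]map_take.
have kfE : kf = ((nth (v1 ord0) Z i), f (nth (v1 ord0) Z i)) by rewrite /kf (nth_map (v1 ord0)).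
have sub j : j \in nth (v1 ord0) Z i :: take i Z -> j \in Z.
  by rewrite inE => /orP[/eqP ->|/mem_take //]; apply: mem_nth.
rewrite kfE; apply: (model_regular gr_free_gen gr_inj); rewrite ?eZ.
- apply/allP => kf'; rewrite inE => /orP[/eqP ->|/mem_take]; last exact: (allP ksm).
  by case: (fP (nth (v1 ord0) Z i)).
- by have := take_uniq i.+1 join_Z_uniq; rewrite (take_nth (v1 ord0)) // rcons_uniq.
by move=> j /sub /join_Z_free.
Qed.

Lemma gr_cohen_macaulay : cohen_macaulay G.
Proof.
split.
  by apply: noetherian_surj (@noetherian_mpoly K N); apply: (@gr_pres_surj K k N S).
move=> P hP; have pP := maximal_prime hP; exists 4.
have [xs [xsreg xsP xs4]] := gr_regular_seq hP; split.
  split; first by rewrite -xs4; apply: regular_prime_chain.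
  by move=> d /(prime_chain_nzd pP)[I [y /gr_nzd_chain_le]].
split; first by exists xs.
by move=> ys /regular_seq_nzd /gr_nzd_chain_le.
Qed.

End JoinCM.

Theorem theorem5p14 (K : fieldType) (h n1 n2 : nat) (a1 d1 a2 d2 : 'X_{1..4})
    (hh : (1 <= h)%N) (hn1 : (2 <= n1)%N) (hn2 : (2 <= n2)%N)
    (hind : lin_indep_Q [tuple a1; d1; a2; d2]) :
  let S := join_gens h n1 n2 a1 d1 a2 d2 in
  [/\ cohen_macaulay (gr (sgring_max K S)),
      forall i : nat, betti_gr K S i = betti_sgring K S i
    & gr_has_regularity K S 2].
Proof.
split.
- exact: gr_cohen_macaulay.
- exact: betti_gr_sgring.
exact: gr_regularity.
Qed.
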